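(* Let $r\ge 3$ and let $f,g:S^1\to S^1$ be two $C^r$ multicritical circle maps with the same irrational rotation number and the same number of critical points. Let $h:S^1\to S^1$ be a homeomorphism such that $h\circ f=g\circ h$. If $h$ maps each critical point of $f$ to a critical point of $g$, then $h$ is quasisymmetric.
   Context: $S^1=\mathbb{R}/\mathbb{Z}$. A multicritical circle map (of class $C^r$, $r\ge 3$) is an orientation-preserving homeomorphism $f:S^1\to S^1$ of class $C^r$ having finitely many critical points (points where $f'=0$) $c_0,\dots,c_{N-1}$, $N\ge 1$, such that there exist (open) neighbourhoods $W_i\subseteq S^1$ of $c_i$ ($0\le i\le N-1$) with: (1) $f$ has negative Schwarzian derivative $Sf=\left(\frac{f''}{f'}\right)'-\frac12\left(\frac{f''}{f'}\right)^2<0$ on $W_i\setminus\{c_i\}$; (2) there exist constants $0<\alpha_i<\beta_i$ and a real number $s_i>1$ (not necessarily an integer) such that $\alpha_i|x-c_i|^{s_i-1}<f'(x)<\beta_i|x-c_i|^{s_i-1}$ for all $x\in W_i\setminus\{c_i\}$; (3) the variation of $\log f'$ on $S^1\setminus\bigcup_i W_i$ is finite. The exponents $s_i$ of $f$ and those of $g$ are not assumed to coincide at corresponding critical points. A homeomorphism $h:S^1\to S^1$ is quasisymmetric if there is $K\ge 1$ such that for all $x\in S^1$ and all $t>0$, $\frac1K\le \frac{|h(x+t)-h(x)|}{|h(x)-h(x-t)|}\le K$, where the differences are computed with a lift of $h$ to $\mathbb{R}$. *)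

(* Defs.v *)
From HB Require Import structures.
From mathcomp Require Import all_boot all_order all_algebra ring_quotient.
From mathcomp Require Import all_classical all_reals all_analysis.

Set Implicit Arguments.
Unset Strict Implicit.
Unset Printing Implicit Defensive.

Import Order.TTheory GRing.Theory Num.Theory.
Import numFieldNormedType.Exports.

Local Open Scope classical_set_scope.
Local Open Scope ring_scope.

Definition integers (R : realType) : zmodClosed R :=
  Algebra.ZmodClosed.clone R (@Num.int_num_subdef R) _.

(* The circle R/Z, with the quotient topology. *)
Definition circle (R : realType) : Type :=
  quotient_topology (Quotient.quot (integers R)).

HB.instance Definition _ (R : realType) := Topological.on (circle R).

Definition homeomorphism (T U : topologicalType) (f : T -> U) : Prop :=
  continuous f /\ exists g : U -> T, [/\ continuous g, cancel f g & cancel g f].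

Section circle_maps.
Variable R : realType.
Local Notation S1 := (circle R).
Implicit Types (f h : S1 -> S1) (F : R -> R) (u v c : S1).

Definition to_circle (x : R) : S1 := (\pi_S1 x)%qT.

Definition circle_dist u v : R :=
  inf [set `|x - y| | x in to_circle @^-1` [set u]
                    & y in to_circle @^-1` [set v]].

Definition is_lift f F : Prop :=
  continuous F /\ forall x, f (to_circle x) = to_circle (F x).

(* A choice of lift. Lifts of a homeomorphism exist and differ by an
   integer constant, on which nothing below depends. When f has no lift, the
   value is the zero function, which is neither increasing nor
   quasisymmetric. *)
Definition circle_lift f : R -> R := xget (fun=> 0) [set F | is_lift f F].

Definition class_C (r : nat) F : Prop :=
  (forall k, (k < r)%N -> forall x, derivable (derive1n k F) x 1) /\
  continuous (derive1n r F).

Definition schwarzian F (x : R) : R :=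
  derive1 (fun y => derive1n 2 F y / derive1 F y) x
  - 2^-1 * (derive1n 2 F x / derive1 F x) ^+ 2.

(* Derivatives of lifts are 1-periodic, hence functions on the circle. *)
Definition circle_deriv f u : R := derive1 (circle_lift f) (repr u).

Definition circle_schwarzian f u : R := schwarzian (circle_lift f) (repr u).

Definition critical_points f : set S1 := [set u | circle_deriv f u = 0].

(* Variation over a subset A of the circle: finite families of points of A in
   cyclic order, lifted to increasing families in an interval of length at
   most 1. *)
Definition finite_variation_on (A : set S1) (phi : S1 -> R) : Prop :=
  exists M : R, forall (a b : R) (s : seq R),
    itv_partition a b s -> b <= a + 1 ->
    (forall x, x \in a :: s -> A (to_circle x)) ->
    variation a b (phi \o to_circle) s <= M.

Definition multicritical (r : nat) f : Prop :=
  [/\ homeomorphism f,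
      {homo circle_lift f : x y / x < y},
      class_C r (circle_lift f),
      finite_set (critical_points f) /\ critical_points f !=set0 &
      exists W : S1 -> set S1,
        [/\ forall c, critical_points f c -> open_nbhs c (W c),
            forall c, critical_points f c ->
              forall u, (W c `\ c) u -> circle_schwarzian f u < 0,
            forall c, critical_points f c ->
              exists alpha beta s : R,
                [/\ 0 < alpha, alpha < beta, 1 < s &
                    forall u, (W c `\ c) u ->
                      alpha * circle_dist u c `^ (s - 1) < circle_deriv f u /\
                      circle_deriv f u < beta * circle_dist u c `^ (s - 1)] &
            finite_variation_on (~` \bigcup_(c in critical_points f) W c)
              (fun u => ln (circle_deriv f u))]].

(* The mean translation of a lift, modulo 1; the limit exists and is the same
   for every base point. *)
Definition rotation_number f : S1 :=
  to_circle (lim ((fun n => iter n (circle_lift f) 0 / n%:R) @ \oo)).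

Definition quasisymmetric h : Prop :=
  exists2 K : R, 1 <= K &
    forall x t : R, 0 < t ->
      K^-1 <= `|circle_lift h (x + t) - circle_lift h x|
              / `|circle_lift h x - circle_lift h (x - t)| <= K.

End circle_maps.

(* Main.v *)
(* For a lift F of rotation number rho, the maps x |-> F^k x + p form a free
   action of Z^2 on the line, ordered by k rho + p. The Euclidean algorithm
   yields best approximations a_n in Z^2; the gap of a_n at x, the length of
   [x, a_n x], is the length of a fundamental interval of level n.
   - Cross-ratio distortion is bounded along the first return times, hence the
     gaps of a given level at neighbouring points are comparable and decay
     geometrically in the level.
   - Between two consecutive critical points s < x < r of the return map b
     (b = a_(n+1)), negative Schwarzian derivative forces parabolic behaviour:
     gap a_n x is comparable to (1 + min(k, l))^2 gap b x, where k and l are the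
     numbers of b-steps from s to x and from x to r. These numbers are
     invariant under a conjugacy that preserves critical points.
   - Hence the ratios of consecutive gaps of f at x and of g at h x are
     comparable, so the ratio of the gaps of g and f varies by a bounded factor
     from one level to the next; this is quasisymmetry of h. *)

Require Import Defs.
From mathcomp Require Import all_boot all_order all_algebra ring_quotient.
From mathcomp Require Import all_classical all_reals all_analysis.
From mathcomp Require Import zify ring lra.

Set Implicit Arguments.
Unset Strict Implicit.
Unset Printing Implicit Defensive.

Import Order.TTheory GRing.Theory Num.Theory.
Import numFieldNormedType.Exports.

Local Open Scope classical_set_scope.
Local Open Scope ring_scope.

(* The cost of these tactics grows quickly with the number of hypotheses. *)
Ltac clear_props := repeat match goal with
  H : ?P |- _ => lazymatch type of P with Prop => clear H end end.
Tactic Notation "lra" "using" ne_hyp_list(hs) := revert hs; clear_props; intros; lra.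
Tactic Notation "nra" "using" ne_hyp_list(hs) := revert hs; clear_props; intros; nra.
Tactic Notation "lia" "using" ne_hyp_list(hs) := revert hs; clear_props; intros; lia.

(** The critical exponents of [f] and [g] may differ, so the derivatives of the two maps are never
    compared: every estimate is reduced to combinatorial data, which [h] transports. Cross-ratio
    distortion is controlled in one direction only, as images have cross-ratios at most a constant
    times the original ones. Lower bounds are therefore found at a favourable place, such as a point
    of minimal gap, and pulled back along orbits. The Schwarzian derivative is negative only near
    critical points. With F' = w^(-2), elsewhere w'' is still bounded below by a multiple of -w, so
    the quotients that negative Schwarzian derivative would make monotone are monotone up to a
    constant times a length. Along a return these errors are weighted by slopes and amount to a sum
    of squared gaps; disjointness bounds it by the largest gap. Hence only deep levels are treated,
    and large scales are settled by periodicity and compactness. Return times of consecutive levels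
    have opposite signs; returns in negative time are reduced to positive time by the reflection x
    -> -x. *)

Section Calculus.
Variable R : realType.
Implicit Types (f df : R -> R) (a b x y : R).

Lemma is_derive_continuous f x d : is_derive x 1 f d -> {for x, continuous f}.
Proof. by move=> [fd _]; apply/differentiable_continuous/derivable1_diffP. Qed.

Lemma mvt f df a b : a < b ->
  (forall x, a < x < b -> is_derive x 1 f (df x)) ->
  (forall x, a <= x <= b -> {for x, continuous f}) ->
  exists2 c, a < c < b & f b - f a = df c * (b - a).
Proof.
move=> ab fd fc.
have h1 x : x \in `]a, b[ -> is_derive x 1 f (df x) by rewrite in_itv /=; exact: fd.
have h2 : {within `[a, b], continuous f}.
  by apply: continuous_in_subspaceT => x; rewrite inE /= in_itv /=; exact: fc.
by have [c cab e] := MVT ab h1 h2; rewrite in_itv /= in cab; exists c.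
Qed.

Lemma is_derive_le f x d k e : is_derive x 1 f d -> 0 < e ->
  (forall y, x < y < x + e -> f y - f x <= k * (y - x)) -> d <= k.
Proof.
move=> fd e0 H; rewrite leNgt; apply/negP => kd.
have [df dE] := fd; move: df; rewrite /derivable => /cvg_ex[/= l fl].
have ld : l = d.
  rewrite -dE /derive; apply/esym/cvg_lim => //; exact: fl.
have /cvgrPdist_lt/(_ (d - k)) := fl; rewrite ld subr_gt0 => /(_ kd).
rewrite /= /dnbhs /within /= => -[r /= r0 rH].
pose h := Num.min e r / 2.
have m0 : 0 < Num.min e r by rewrite lt_min e0.
have h0 : 0 < h by rewrite divr_gt0.
have he : h < e by apply: (@lt_le_trans _ _ (Num.min e r)); [rewrite /h; lra|rewrite ge_min lexx].
have hr : h < r by apply: (@lt_le_trans _ _ (Num.min e r)); [rewrite /h; lra|rewrite ge_min lexx orbT].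
have := rH h; rewrite /= sub0r normrN gtr0_norm // => /(_ hr (lt0r_neq0 h0)).
rewrite /= /GRing.scale /= mulr1 addrC => H1.
have H2 := H (x + h); have H3 : x < x + h < x + e by apply/andP; split; lra.
have {H3} := H2 H3; rewrite (_ : x + h - x = h); last by ring.
rewrite addrC [x + h]addrC => H3.
have : h^-1 * (f (h + x) - f x) <= k.
  by rewrite mulrC ler_pdivrMr // addrC.
move: H1; rewrite real_ltr_norml ?num_real // => /andP[_ H1].
lra.
Qed.

Lemma monotone_deriv f df a b : a <= b ->
  (forall x, a < x < b -> is_derive x 1 f (df x)) ->
  (forall x, a <= x <= b -> {for x, continuous f}) ->
  (forall x, a < x < b -> df x <= 0) -> f b <= f a.
Proof.
rewrite le_eqVlt => /predU1P[->//|ab] fd fc df0.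
have [c /df0 c0 E] := mvt ab fd fc.
rewrite -subr_le0 E; apply: mulr_le0_ge0 => //; lra.
Qed.

End Calculus.

(** * The action of Z^2 generated by a lift *)

Section Action.
Variables (R : realType) (F : R -> R) (rho : R).

Definition finv (y : R) : R := xget 0 [set x | F x = y].

Definition itz (k : int) (x : R) : R :=
  match k with Posz n => iter n F x | Negz n => iter n.+1 finv x end.

Definition lift_act (a : int * int) (x : R) : R := itz a.1 x + a.2%:~R.
Local Notation act := lift_act.

Definition rval (a : int * int) : R := a.1%:~R * rho + a.2%:~R.

(** The geometric estimates see the rotation number only through this order on orbits, a form that a
    conjugacy carries over directly. *)
Definition is_rotation : Prop := forall a, 0 < rval a -> forall x, x < act a x.

Definition circle_lift_map : Prop :=
  [/\ {homo F : x y / x < y}, continuous F & forall x, F (x + 1) = F x + 1].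

Lemma rvalD a b : rval (a + b) = rval a + rval b.
Proof. by rewrite /rval /= !intrD; ring. Qed.

Lemma rvalN a : rval (- a) = - rval a.
Proof. by rewrite /rval /= !mulrNz; ring. Qed.

Lemma rvalB a b : rval (a - b) = rval a - rval b.
Proof. by rewrite rvalD rvalN. Qed.

Lemma rvalMn a n : rval (a *+ n) = rval a *+ n.
Proof.
elim: n => [|n IH]; first by rewrite !mulr0n /rval /=; ring.
by rewrite !mulrS rvalD IH.
Qed.

Lemma rval0 : rval 0 = 0.
Proof. by rewrite /rval /=; ring. Qed.

Hypothesis FL : circle_lift_map.

Lemma F_lt : {mono F : x y / x < y}.
Proof. by apply: leW_mono; apply: le_mono; case: FL. Qed.

Lemma F_le : {mono F : x y / x <= y}.
Proof. by apply: le_mono; case: FL. Qed.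

Lemma F_inj : injective F.
Proof. exact: inc_inj F_le. Qed.

Lemma F_nat x n : F (x + n%:R) = F x + n%:R.
Proof.
case: FL => _ _ F1; elim: n => [|n IH]; first by rewrite !addr0.
by rewrite -natr1 addrA F1 IH addrA.
Qed.

Lemma F_int x (m : int) : F (x + m%:~R) = F x + m%:~R.
Proof.
case: m => n; first exact: F_nat.
rewrite NegzE mulrNz; have := F_nat (x - n.+1%:R) n.+1.
by rewrite subrK => ->; rewrite addrK.
Qed.

Lemma F_surj y : exists x, F x = y.
Proof.
case: FL => _ Fc _.
pose k := Num.floor (y - F 0).
have /andP[k1 k2] := mem_rg1_floor (y - F 0).
have h0 := F_int 0 k; have h1 := F_int 0 (k + 1).
rewrite !add0r in h0 h1.
have le01 : (k%:~R : R) <= (k + 1)%:~R by rewrite ler_int lerDl.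
have [] := @IVT R F k%:~R (k + 1)%:~R y le01.
- by apply: continuous_subspaceT => x; exact: Fc.
- rewrite h0 h1; apply/andP; split.
    by rewrite ge_min; apply/orP; left; rewrite -/k in k1; lra.
  by rewrite le_max; apply/orP; right; rewrite -/k in k2; lra.
by move=> x _ <-; exists x.
Qed.

Lemma FinvK y : F (finv y) = y.
Proof. by have [x xy] := F_surj y; rewrite /finv; case: xgetP => // /(_ x). Qed.

Lemma FK x : finv (F x) = x.
Proof. by apply: F_inj; rewrite FinvK. Qed.

Lemma itzS k x : itz (k + 1) x = F (itz k x).
Proof.
case: k => [n|[|n]].
- by rewrite -PoszD addn1.
- by have -> : Negz 0 + 1 = 0 by []; rewrite /= FinvK.
have -> : Negz n.+1 + 1 = Negz n by rewrite !NegzE -[n.+2]addn1 PoszD opprD addrNK.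
by rewrite /= FinvK.
Qed.

Lemma itzB1 k x : itz (k - 1) x = finv (itz k x).
Proof. by rewrite -{2}(subrK 1 k) itzS FK. Qed.

Lemma itzD k l x : itz (k + l) x = itz k (itz l x).
Proof.
elim/int_rect: k => [|n IH|n IH]; first by rewrite add0r.
  by rewrite -addn1 PoszD -addrA (addrC 1) addrA !itzS IH.
by rewrite -addn1 PoszD opprD -addrA (addrC (-1)) addrA !itzB1 IH.
Qed.

Lemma itz_int k x (m : int) : itz k (x + m%:~R) = itz k x + m%:~R.
Proof.
elim/int_rect: k => [|n IH|n IH]; first by [].
  by rewrite -addn1 PoszD !itzS IH F_int.
rewrite -addn1 PoszD opprD !itzB1 IH; apply: F_inj.
by rewrite F_int !FinvK.
Qed.

Lemma itz_lt k : {homo itz k : x y / x < y}.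
Proof.
move=> x y xy; elim/int_rect: k => [|n IH|n IH]; first by [].
  by rewrite -addn1 PoszD !itzS F_lt.
by rewrite -addn1 PoszD opprD !itzB1 -F_lt !FinvK.
Qed.

Lemma actD a b x : act (a + b) x = act a (act b x).
Proof. by rewrite /act /= itzD itz_int intrD -addrA (addrC a.2%:~R). Qed.

Lemma act0 x : act 0 x = x.
Proof. by rewrite /act /= addr0. Qed.

Lemma actK a : cancel (act a) (act (- a)).
Proof. by move=> x; rewrite -actD addNr act0. Qed.

Lemma actNK a : cancel (act (- a)) (act a).
Proof. by move=> x; rewrite -actD addrN act0. Qed.

Lemma actC a b x : act a (act b x) = act b (act a x).
Proof. by rewrite -!actD addrC. Qed.

Lemma act_lt a : {mono act a : x y / x < y}.
Proof.
apply: leW_mono; apply: le_mono => x y xy.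
by rewrite /act ltrD2r; exact: itz_lt.
Qed.

Lemma act_le a : {mono act a : x y / x <= y}.
Proof. by apply: le_mono => x y; rewrite act_lt. Qed.

Lemma act_leN a x y : (x <= act (- a) y) = (act a x <= y).
Proof. by rewrite -(act_le a) actNK. Qed.

Lemma act_ltN a x y : (act (- a) y < x) = (y < act a x).
Proof. by rewrite -(act_lt a) actNK. Qed.

Lemma act_nat (i : nat) x : act (i%:Z, 0) x = iter i F x.
Proof. by rewrite /act /= addr0. Qed.

Lemma act_int (p : int) x : act (0, p) x = x + p%:~R.
Proof. by []. Qed.

Lemma act_iter i a x : act a (iter i F x) = iter i F (act a x).
Proof. by rewrite -!act_nat actC. Qed.

Hypothesis rotF : is_rotation.

Lemma act_rval a b x : rval a < rval b -> act a x < act b x.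
Proof.
move=> ab; rewrite -(subrK a b) actD; apply: rotF.
by rewrite rvalB subr_gt0.
Qed.

Hypothesis irr : forall a, rval a = 0 -> a = 0.

Lemma act_rval_le a b x : rval a <= rval b -> act a x <= act b x.
Proof.
rewrite le_eqVlt => /predU1P[e|/act_rval /ltW//].
suff -> : a = b by [].
by apply/eqP; rewrite -subr_eq0; apply/eqP/irr; rewrite rvalB e subrr.
Qed.

Lemma act_ge a x : 0 <= rval a -> x <= act a x.
Proof. by rewrite -rval0 => /(act_rval_le x); rewrite act0. Qed.

Lemma act_geN a x : 0 <= rval a -> act (- a) x <= x.
Proof. by move=> a0; rewrite -(act_le a) actNK act_ge. Qed.

End Action.

(** * Best approximations *)

Section Levels.
Variables (R : realType) (rho : R).
Local Notation val := (rval rho).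
Implicit Types a b z : int * int.

(** Two consecutive best approximations: the first coordinates are return times, of opposite signs,
    and determinant 1 or -1 makes [a], [b] a basis of Z^2. The number [|b.1|] is the length of the
    orbit segments along which distortion is controlled at this level. *)
Definition level a b : Prop :=
  [/\ 0 < val b < val a, val a <= 1, a.1 * b.1 < 0,
      `|a.1| <= `|b.1| & (a.1 * b.2 - a.2 * b.1) ^+ 2 = 1].

(** Up to sign, z = u a + v b. As [a.1] and [b.1] have opposite signs, coefficients of opposite
    signs, or u = 0, would force |z.1| >= |b.1|. So u is nonzero and v does not have the opposite
    sign, and the positive values of [a] and [b] cannot cancel. *)
Lemma level_best a b z : level a b -> z.1 != 0 -> `|z.1| < `|b.1| ->
  val a <= `|val z|.
Proof.
move=> [/andP[b0 ba] _ ab1 _]; set D := _ - _ => D1 z0 zb.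
pose u := z.1 * b.2 - z.2 * b.1; pose v := a.1 * z.2 - a.2 * z.1.
have Dz1 : D * z.1 = u * a.1 + v * b.1 by rewrite /D /u /v; ring.
have DR : (D%:~R : R) ^+ 2 = 1 by rewrite -rmorphXn /= D1.
have Dz : D%:~R * val z = u%:~R * val a + v%:~R * val b.
  rewrite /rval /D /u /v !rmorphB /= !rmorphM /=; ring.
have -> : `|val z| = `|D%:~R * val z|.
  rewrite normrM; suff -> : `|D%:~R : R| = 1 by rewrite mul1r.
  by apply/eqP; rewrite -sqrp_eq1 // -normrX DR normr1.
have DZ : D = 1 \/ D = -1.
  by move/eqP: D1; rewrite sqrf_eq1 => /orP[/eqP|/eqP] ->; [left|right].
have [[u1 v0]|[u1 v0]] : (1 <= u /\ 0 <= v) \/ (u <= -1 /\ v <= 0).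
  have zD : `|z.1| = `|u * a.1 + v * b.1|.
    by rewrite -Dz1; case: DZ => ->; lia.
  rewrite zD in zb.
  have un0 : u != 0.
    apply/eqP => u0; move: zD zb; rewrite u0 mul0r add0r => zD zb.
    have v0 : v != 0 by apply: contra_eq_neq zD => ->; rewrite mul0r; lia.
    by nia.
  have uv : 0 <= u * v.
    rewrite leNgt; apply/negP => uv.
    have AB : 0 < (u * a.1) * (v * b.1) by rewrite mulrACA nmulr_rgt0.
    have vb : `|b.1| <= `|v * b.1|.
      rewrite normrM ler_peMl //; have : v != 0 by apply: contraTneq uv => ->; rewrite mulr0.
      by lia.
    move: AB vb zb; set A := u * a.1; set B := v * b.1 => AB vb zb.
    have [A0|A0|A0] := ltgtP A 0; last by rewrite A0 mul0r in AB.
      by rewrite nmulr_rgt0 // in AB; lia.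
    by rewrite pmulr_rgt0 // in AB; lia.
  have [u0|u0|u0] := ltgtP u 0; last by rewrite u0 in un0.
    by right; split; [lia|rewrite nmulr_rge0 // in uv].
  by left; split; [lia|rewrite pmulr_rge0 // in uv].
- have u1R : 1 <= u%:~R :> R by rewrite ler1z.
  have v0R : 0 <= v%:~R :> R by rewrite ler0z.
  by rewrite Dz ger0_norm; nra.
- have u1R : u%:~R <= - 1 :> R by rewrite -(ler_int R) mulrNz in u1.
  have v0R : v%:~R <= 0 :> R by rewrite lerz0.
  by rewrite Dz ler0_norm; nra.
Qed.

Hypothesis irr : forall a, val a = 0 -> a = 0.

(** One step of the Euclidean algorithm: [m] is the integer part of [val a / val b], and
    irrationality keeps the remainder positive. The first coordinates have opposite signs, so the
    subtraction adds their absolute values and return times grow. *)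
Lemma level_next a b : level a b ->
  exists m : nat, (0 < m)%N /\ level b (a - b *+ m).
Proof.
move=> [/andP[b0 ba] a1 ab1 abt D1].
pose m := Num.trunc (val a / val b).
have /andP[m1 m2] : m%:R <= val a / val b < m.+1%:R.
  by apply: truncn_itv; rewrite divr_ge0 // ltW // (lt_trans b0).
have m0 : (0 < m)%N.
  rewrite -ltnS -(ltr_nat R); apply: le_lt_trans m2.
  by rewrite ler_pdivlMr // mul1r ltW.
have bm1 : (b *+ m).1 = b.1 * m%:Z.
  by elim: m {m1 m2 m0} => [|k IH]; rewrite ?mulr0 // mulrS /= IH intS; ring.
have bm2 : (b *+ m).2 = b.2 * m%:Z.
  by elim: m {m1 m2 m0 bm1} => [|k IH]; rewrite ?mulr0 // mulrS /= IH intS; ring.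
have vE : val (a - b *+ m) = val a - m%:R * val b.
  by rewrite rvalB rvalMn mulr_natl.
exists m; split => //; split.
- rewrite vE; move: m1 m2.
  rewrite ler_pdivlMr // ltr_pdivrMr // -natr1 => m1 m2.
  apply/andP; split; last by nra.
  rewrite lt_neqAle; apply/andP; split; last by nra.
  apply/negP => /eqP e0; have := irr (a := a - b *+ m).
  rewrite vE -e0 => /(_ erefl)/(congr1 fst) /=; rewrite bm1 => /eqP.
  by rewrite subr_eq0 => /eqP ab; rewrite ab in ab1; nia.
- by apply: le_trans a1; exact: ltW.
- by rewrite /= bm1; nia.
- by rewrite /= bm1; nia.
- by rewrite -D1 /= bm1 bm2; ring.
Qed.

Lemma level_seq : exists e : nat -> int * int,
  forall n, level (e n) (e n.+1) /\
    exists2 m : nat, (0 < m)%N & e n.+2 = e n - e n.+1 *+ m.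
Proof.
pose r := Num.floor rho; have /andP[r1 r2] := mem_rg1_floor rho.
pose a : int * int := (1, - r).
have va : val a = rho - r%:~R by rewrite /rval /a /= mulrNz; ring.
have a0 : 0 < val a.
  rewrite lt_neqAle va; apply/andP; split; last by rewrite -/r in r1; lra.
  by apply/negP => /eqP e0; have := irr (a := a); rewrite va -e0 => /(_ erefl).
have a1 : val a < 1 by rewrite va; move: r2; rewrite -/r; lra.
pose m := Num.trunc (1 / val a).
have /andP[m1 m2] : m%:R <= 1 / val a < m.+1%:R.
  by apply: truncn_itv; rewrite divr_ge0 // ltW.
have m0 : (0 < m)%N.
  rewrite -ltnS -(ltr_nat R); apply: le_lt_trans m2.
  by rewrite ler_pdivlMr // mul1r ltW.
(* The unit translation (0, 1) minus [m] copies of [a]: the algorithm is started at the pair formed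
   by (0, 1) and [a]. *)
pose b : int * int := (- m%:Z, 1 + m%:Z * r).
have vb : val b = 1 - m%:R * val a.
  by rewrite va /rval /b /= mulrNz intrD intrM; ring.
have lab : level a b.
  split.
  - move: m1 m2; rewrite ler_pdivlMr // ltr_pdivrMr // -natr1 => m1 m2.
    rewrite vb; apply/andP; split; last by nra.
    rewrite lt_neqAle; apply/andP; split; last by nra.
    apply/negP => /eqP e0; have := irr (a := b).
    by rewrite vb -e0 => /(_ erefl)/(congr1 fst) /=; lia.
  - exact: ltW.
  - by rewrite /=; lia.
  - by rewrite /=; lia.
  - by rewrite /=; have -> : 1 * (1 + m%:Z * r) - - r * - m%:Z = 1 by ring.
pose T := {p : (int * int) * (int * int) | level p.1 p.2}.
have /choice[nx nxP] : forall t : T, exists t' : T,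
    (sval t').1 = (sval t).2 /\
    exists2 m : nat, (0 < m)%N & (sval t').2 = (sval t).1 - (sval t).2 *+ m.
  move=> [[c d] /= lcd]; have [k [k0 lk]] := level_next lcd.
  by exists (exist _ (d, c - d *+ k) lk); split => //; exists k.
pose s n := iter n nx (exist _ (a, b) lab).
have sE n : (sval (s n.+1)).1 = (sval (s n)).2 by have [] := nxP (s n).
exists (fun n => (sval (s n)).1) => n; split.
  by rewrite sE; exact: (svalP (s n)).
rewrite !sE; have [_ [k k0 ->]] := nxP (s n); first by exists k => //; rewrite -sE.
Qed.
End Levels.

(** The interval with the largest left end lies to the right of all others; once it is removed, the
    rest fits to the left of it and induction applies. *)
Lemma disjoint_sum (R : realType) (I : finType) (S : {set I}) (a b : I -> R) (A B : R) :
  A <= B ->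
  (forall i, i \in S -> [/\ A <= a i, a i < b i & b i <= B]) ->
  (forall i j, i \in S -> j \in S -> i != j -> b i <= a j \/ b j <= a i) ->
  \sum_(i in S) (b i - a i) <= B - A.
Proof.
move: B; have [n] := ubnP #|S|; elim: n S => // n IH S Sn B AB h1 h2.
have [->|/set0Pn[i0 i0S]] := eqVneq S finset.set0.
  by rewrite big_set0 subr_ge0.
pose i := [arg max_(i > i0 in S) a i]%O.
have [iS imax] : i \in S /\ forall j, j \in S -> a j <= a i.
  by rewrite /i; case: arg_maxP => // k kS kM; split => // j /kM.
have [Aa ab bB] := h1 _ iS.
rewrite (bigD1 i) //=.
rewrite (eq_bigl (mem (S :\ i))); last by move=> k; rewrite !inE andbC.
have : \sum_(k in S :\ i) (b k - a k) <= a i - A.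
  apply: IH => //; first by rewrite (cardsD1 i) iS in Sn.
  - move=> k; rewrite !inE => /andP[ki kS]; have [? ? _] := h1 _ kS; split => //.
    by have [//|] := h2 _ _ kS iS ki => bk; have := imax _ kS; lra.
  - by move=> k l; rewrite !inE => /andP[_ kS] /andP[_ lS]; exact: h2.
by lra.
Qed.

Lemma sum_atmost1 (R : realType) (I : finType) (P : I -> Prop) :
  (forall i j, P i -> P j -> i = j) -> \sum_i (`[< P i >]%:R : R) <= 1.
Proof.
move=> h; have [[i Pi]|nP] := pselect (exists i, P i); last first.
  rewrite big1 // => i _; case: asboolP => // Pi; case: nP; by exists i.
rewrite (bigD1 i) //= big1 ?addr0 => [|j ji]; first by case: asboolP.
by case: asboolP => // Pj; move: ji; rewrite (h _ _ Pj Pi) eqxx.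
Qed.

Section Orbits.
Variables (R : realType) (F : R -> R) (rho : R).
Local Notation val := (rval rho).
Local Notation act := (lift_act F).
Hypothesis FL : circle_lift_map F.
Hypothesis rotF : is_rotation F rho.
Hypothesis irr : forall a, val a = 0 -> a = 0.
Implicit Types (a b c : int * int) (x y z : R).

Lemma act_above c x z : 0 < val c -> exists k : nat, z < act (c *+ k) x.
Proof.
move=> c0; pose m := Num.floor (z - x) + 1.
have zm : z < act (0, m) x.
  have /andP[_ h] := mem_rg1_floor (z - x).
  by rewrite act_int /m intrD; lra.
pose k := (Num.trunc (`|m|%:~R / val c)).+1.
exists k; apply: lt_trans zm _; apply: (act_rval FL rotF).
rewrite rvalMn /rval /= mul0r add0r -mulr_natr.
apply: (@le_lt_trans _ _ (`|m|%:~R)); first by rewrite ler_int ler_norm.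
rewrite mulrC -ltr_pdivrMr //; apply: truncnS_gt.
Qed.

Lemma steps c x z : 0 < val c -> x <= z ->
  exists k : nat, act (c *+ k) x <= z < act (c *+ k.+1) x.
Proof.
move=> c0 xz; have /ex_minnP[[|k] zk kmin] := act_above x z c0.
  by rewrite mulr0n act0 in zk; lra.
exists k; rewrite zk andbT leNgt; apply/negP => /kmin; lia.
Qed.

Lemma steps_le c x z : 0 < val c -> z <= x ->
  exists k : nat, x <= act (c *+ k) z < act c x.
Proof.
move=> c0 zx.
have ex : exists k : nat, x <= act (c *+ k) z.
  by have [k /ltW xk] := act_above z x c0; exists k.
have /ex_minnP[[|k] xk kmin] := ex; last first.
  exists k.+1; rewrite xk mulrS (actD FL) (act_lt FL) ltNge /=.
  by apply/negP => /kmin; lia.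
exists 0%N; rewrite xk mulr0n act0.
by rewrite (le_lt_trans zx) // (rotF c0).
Qed.

(** Times are shortened by the return map to [x, (a + b) x), an exchange of two intervals: a point
    beyond the cut moves back by one of [a], [b], a point before it moves forward by the other. Both
    moves stay in the interval, and the opposite signs of [a.1] and [b.1] make both decrease
    [s * c.1], as long as this time is at least [|b.1|]. The sign [s] selects forward or backward
    orbits. *)
Lemma hit (s : int) a b x y : s = 1 \/ s = -1 -> level rho a b ->
  exists c, [/\ 0 <= s * c.1, s * c.1 < `|b.1| & x <= act c y < act (a + b) x].
Proof.
move=> s1 [/andP[b0 ba] a1 ab abt _].
have ab0 : 0 < val (a + b) by rewrite rvalD; lra.
have [c [c0 xc]] : exists c, 0 <= s * c.1 /\ x <= act c y < act (a + b) x.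
  have [t0|t0] := leP (s * (a + b).1) 0.
  - pose p := Num.floor (x - y) + 1.
    have xp : x <= act (0, p) y.
      have /andP[_ h] := mem_rg1_floor (x - y).
      by rewrite act_int /p intrD; lra.
    have [k /andP[k1 k2]] := steps ab0 xp.
    exists (- ((a + b) *+ k) + (0, p)); split.
      rewrite /= addr0; have -> : forall n, ((a + b) *+ n).1 = (a + b).1 * n%:Z.
        by elim=> [|n IH]; rewrite ?mulr0 // mulrS [LHS]/= IH intS; ring.
      by nia.
    by rewrite (actD FL (- _)) (act_leN FL) (act_ltN FL) k1 -(actD FL) -mulrSr.
  - pose p := Num.floor (x - y).
    have xp : act (0, p) y <= x.
      have /andP[h _] := mem_rg1_floor (x - y).
      by rewrite act_int /p; lra.
    have [k kk] := steps_le ab0 xp.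
    exists ((a + b) *+ k + (0, p)); split; last by rewrite (actD FL ((a + b) *+ k)).
    rewrite /= addr0; have -> : forall n, ((a + b) *+ n).1 = (a + b).1 * n%:Z.
      by elim=> [|n IH]; rewrite ?mulr0 // mulrS [LHS]/= IH intS; ring.
    by nia.
move: c0 xc; have [n] := ubnP (absz (s * c.1)); elim: n c => // n IH c cn c0 /andP[xc cx].
have [?|cb] := ltP (s * c.1) `|b.1|; first by exists c; split => //; rewrite xc.
have [sb|sb] := leP (s * b.1) 0.
- have sa : 0 < s * a.1 by nia.
  have [ax|ax] := leP (act a x) (act c y).
    apply: (IH (c - a)); [rewrite /=; lia|rewrite /=; lia|].
    rewrite (addrC c) (actD FL (- _)) (act_leN FL) (act_ltN FL) ax -(actD FL) /=.
    apply: lt_trans cx _.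
    by apply: (act_rval FL rotF); rewrite !rvalD; lra.
  apply: (IH (b + c)); [rewrite /=; lia|rewrite /=; lia|].
  rewrite !(actD FL) (actC FL a) (act_lt FL) ax andbT.
  by rewrite (le_trans xc) // ltW // rotF.
- have sa : s * a.1 < 0 by nia.
  have [ax|ax] := leP (act b x) (act c y).
    apply: (IH (c - b)); [rewrite /=; lia|rewrite /=; lia|].
    rewrite (addrC c) (actD FL (- _)) (act_leN FL) (act_ltN FL) ax -(actD FL) /=.
    apply: lt_trans cx _.
    by apply: (act_rval FL rotF); rewrite !rvalD; lra.
  apply: (IH (a + c)); [rewrite /=; lia|rewrite /=; lia|].
  rewrite !(actD FL) (act_lt FL) ax andbT.
  by rewrite (le_trans xc) // ltW // rotF // ; lra.
Qed.

Lemma level_sep a b c c' x : level rho a b -> c.1 != c'.1 ->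
  `|c.1 - c'.1| < `|b.1| ->
  act a (act c x) <= act c' x \/ act a (act c' x) <= act c x.
Proof.
move=> lab cc cb; have := level_best (z := c - c') lab.
rewrite /= subr_eq0 => /(_ cc cb); rewrite rvalB.
rewrite real_ler_normr ?num_real // => /orP[h|h]; [right|left];
  by rewrite -(actD FL); apply: (act_rval_le FL rotF irr); rewrite rvalD; lra.
Qed.

(** Integer translations bring the left ends into [x, x + 1), and [level_sep] makes the intervals
    disjoint. Separation from the translate (0, 1) of [x] itself prevents the last interval from
    sticking out beyond x + 1. *)
Lemma level_sum a b x : level rho a b ->
  \sum_(i < `|b.1|) (act a (iter i F x) - iter i F x) <= 1.
Proof.
move=> lab; have [/andP[b0 ba] a1 _ _ _] := lab.
pose p (i : nat) := - Num.floor (iter i F x - x).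
pose y (i : nat) := act (i%:Z, p i) x.
have yE i : y i = iter i F x + (p i)%:~R by [].
have yx i : x <= y i < x + 1.
  have /andP[h1 h2] := mem_rg1_floor (iter i F x - x).
  by rewrite yE /p mulrNz; apply/andP; split; lra.
have ayE i : act a (y i) = act a (iter i F x) + (p i)%:~R.
  by rewrite yE -(act_int F) (actC FL).
pose S := finset.finset (fun _ : 'I_(`|b.1|) => true).
have := @disjoint_sum R _ S (fun i => y i) (fun i => act a (y i)) x (x + 1).
rewrite (eq_bigr (fun i : 'I_(`|b.1|) => act a (iter i F x) - iter i F x)); last first.
  by move=> i _; rewrite ayE yE; ring.
rewrite (eq_bigl predT) => [|i]; last by rewrite inE.
have -> : x + 1 - x = 1 :> R by ring.
apply; first by lra.
- move=> i _; have /andP[x1 x2] := yx i; split => //; first by apply: rotF; lra.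
  have -> : x + 1 = act (0, 1) x by rewrite act_int.
  have [i0|i0] := eqVneq (i : nat) 0%N.
    rewrite /y -(actD FL); apply: (act_rval_le FL rotF irr).
    rewrite rvalD i0 /rval /=; have -> : p 0%N = 0 by rewrite /p /= subrr floor0.
    by rewrite /rval in a1; lra.
  have := @level_sep a b (i%:Z, p i) (0, 1) x lab.
  case; [by rewrite /=; lia|by rewrite /=; have := ltn_ord i; lia|by []|].
  by rewrite act_int -/(y i) => h; have := rotF (_ : 0 < val a) (x + 1); lra.
- move=> i j _ _ ij; apply: level_sep lab _ _ => /=.
    by apply: contra ij => /eqP[e]; apply/eqP/val_inj.
  by have := ltn_ord i; have := ltn_ord j; lia.
Qed.

Lemma level_hits a b x (c : R) : level rho a b ->
  \sum_(i < `|b.1|)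
    `[< exists p : int, iter i F x <= c + p%:~R < act a (iter i F x) >]%:R <= 1 :> R.
Proof.
move=> lab; apply: sum_atmost1 => i j [p /andP[p1 p2]] [p' /andP[p3 p4]].
apply/val_inj/eqP; apply: contraT => ij.
have E (k : nat) (l : int) : act (k%:Z, l) x = iter k F x + l%:~R by [].
have E' (k : nat) (l : int) : act a (act (k%:Z, l) x) = act a (iter k F x) + l%:~R.
  by rewrite E -(act_int F) (actC FL).
have := @level_sep a b (i%:Z, - p) (j%:Z, - p') x lab.
rewrite !E' !E !mulrNz => -[]; [by []| |lra|lra].
by rewrite /=; have := ltn_ord i; have := ltn_ord j; lia.
Qed.

End Orbits.

(** * Cross-ratio distortion and gaps *)

Section CrossRatio.
Variable R : realType.
Implicit Types p q r s k : R.

(** The Moebius-invariant product of (q - p) / (r - p) and (s - r) / (s - q). Both factors are at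
    most 1, so a lower bound says that neither outer interval is short compared with the middle
    one. *)
Definition cross p q r s : R := (q - p) * (s - r) / ((r - p) * (s - q)).

Lemma cross_ge0 p q r s : p < q -> q < r -> r < s -> 0 <= cross p q r s.
Proof. by move=> *; rewrite /cross divr_ge0 // mulr_ge0 //; lra. Qed.

Lemma crossN p q r s : cross (- s) (- r) (- q) (- p) = cross p q r s.
Proof.
rewrite /cross; have -> : - r - - s = s - r by ring.
have -> : - p - - q = q - p by ring.
have -> : - q - - s = s - q by ring.
have -> : - p - - r = r - p by ring.
by rewrite (mulrC (s - r)) (mulrC (s - q)).
Qed.

Lemma crossDr p q r s t : cross (p + t) (q + t) (r + t) (s + t) = cross p q r s.
Proof.
rewrite /cross; have -> : q + t - (p + t) = q - p by ring.
have -> : s + t - (r + t) = s - r by ring.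
have -> : r + t - (p + t) = r - p by ring.
by have -> : s + t - (q + t) = s - q by ring.
Qed.

Lemma cross_lel p q r s : p < q -> q < r -> r < s ->
  cross p q r s <= (q - p) / (r - p).
Proof.
move=> pq qr rs; rewrite /cross invfM mulrACA ler_piMr //.
  by rewrite divr_ge0; lra.
by rewrite ler_pdivrMr; lra.
Qed.

Lemma cross_ler p q r s : p < q -> q < r -> r < s ->
  cross p q r s <= (s - r) / (s - q).
Proof.
move=> pq qr rs; rewrite /cross invfM mulrACA ler_piMl //.
  by rewrite divr_ge0; lra.
by rewrite ler_pdivrMr; lra.
Qed.

Lemma le_crossl p q r s k : p < q -> q < r -> r < s -> k <= cross p q r s ->
  k * (r - p) <= q - p.
Proof.
move=> pq qr rs kc; rewrite -ler_pdivlMr; last by lra.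
exact: le_trans kc (cross_lel _ _ _).
Qed.

Lemma le_crossr p q r s k : p < q -> q < r -> r < s -> k <= cross p q r s ->
  k * (s - q) <= s - r.
Proof.
move=> pq qr rs kc; rewrite -ler_pdivlMr; last by lra.
exact: le_trans kc (cross_ler _ _ _).
Qed.

Lemma cross_geM p q r s k l : p < q -> q < r -> r < s -> 0 <= k -> 0 <= l ->
  k * (r - p) <= q - p -> l * (s - q) <= s - r -> k * l <= cross p q r s.
Proof.
move=> pq qr rs k0 l0 h1 h2; rewrite /cross invfM mulrACA.
by apply: ler_pM => //; rewrite ler_pdivlMr //; lra.
Qed.

Lemma cross_ge p q r s k : p < q -> q < r -> r < s -> 0 <= k ->
  k * (r - p) <= q - p -> k * (s - q) <= s - r -> k ^+ 2 <= cross p q r s.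
Proof. by move=> pq qr rs k0 h1 h2; rewrite expr2 cross_geM. Qed.

(* The sum counts the points of the finite set [cs] that have a translate in [p, s]. *)
Definition cross_bound (F : R -> R) : Prop :=
  exists C cs, 0 <= C /\ forall p q r s, p < q -> q < r -> r < s ->
    cross (F p) (F q) (F r) (F s) <=
    expR (C * (s - p) +
          C * \sum_(c <- cs) `[< exists m : int, p <= c + m%:~R <= s >]%:R)
    * cross p q r s.

End CrossRatio.

Section Gaps.
Variables (R : realType) (F : R -> R) (rho : R).
Local Notation val := (rval rho).
Local Notation act := (lift_act F).
Hypothesis FL : circle_lift_map F.
Hypothesis rotF : is_rotation F rho.
Hypothesis irr : forall a, val a = 0 -> a = 0.
Hypothesis crF : cross_bound F.
Implicit Types (a b c : int * int) (x y z : R) (k m : nat).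

Lemma iterF_lt k : {mono iter k F : x y / x < y}.
Proof. by move=> x y; rewrite -!act_nat (act_lt FL). Qed.

Lemma iterF_le k : {mono iter k F : x y / x <= y}.
Proof. by move=> x y; rewrite -!act_nat (act_le FL). Qed.

(** The image under F^j of [x, a^K x] is a chain of [K] fundamental intervals. For j < |b.1| the
    links at each position in the chain are disjoint modulo 1, so the lengths sum to at most [K] and
    each point of [cs] is met at most [K.+1] times, the extra one because of the closed right end.
    The exponents of the one-step bounds thus add up to a constant independent of the level. *)
Lemma cross_iter (K : nat) : exists2 B : R, 1 <= B &
  forall a b x, level rho a b -> forall p q r s,
  x <= p -> p < q -> q < r -> r < s -> s <= act (a *+ K) x ->
  forall i, (i <= `|b.1|)%N ->
  cross (iter i F p) (iter i F q) (iter i F r) (iter i F s) <= B * cross p q r s.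
Proof.
have [C [cs [C0 crC]]] := crF.
pose N : R := C * K%:R + C * ((size cs)%:R * K.+1%:R).
have N0 : 0 <= N by rewrite addr_ge0 // mulr_ge0 // mulr_ge0.
exists (expR N); first by rewrite -expR0 ler_expR.
move=> a b x lab p q r s xp pq qr rs sx i iq.
pose ind (c : R) (j : nat) : R :=
  `[< exists m : int, iter j F p <= c + m%:~R <= iter j F s >]%:R.
pose l (j : nat) := C * (iter j F s - iter j F p) + C * \sum_(c <- cs) ind c j.
have l0 j : 0 <= l j.
  apply: addr_ge0; rewrite mulr_ge0 //; first by rewrite subr_ge0 iterF_le; lra.
  by rewrite sumr_ge0.
have step j : cross (iter j F p) (iter j F q) (iter j F r) (iter j F s)
    <= expR (\sum_(k < j) l k) * cross p q r s.
  elim: j => [|j IH]; first by rewrite big_ord0 expR0 mul1r.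
  rewrite !iterS; apply: le_trans (crC _ _ _ _ _ _ _) _; rewrite ?iterF_lt //.
  have -> : \sum_(k < j.+1) l k = l j + \sum_(k < j) l k.
    by rewrite big_ord_recr addrC.
  by rewrite (expRD (l j)) -mulrA; apply: ler_wpM2l => //; exact: expR_ge0.
apply: le_trans (step i) _; rewrite ler_wpM2r ?cross_ge0 // ler_expR.
apply: (@le_trans _ _ (\sum_(j < `|b.1|) l j)).
  by rewrite -!(big_mkord predT l) (big_cat_nat _ iq) //= lerDl sumr_ge0.
pose X k := act (a *+ k) x.
have XK j k : iter j F (X k) = act (a *+ k) (iter j F x).
  by rewrite /X (act_iter FL).
have XS j k : iter j F (X k.+1) = act a (iter j F (X k)).
  by rewrite /X mulrS (actD FL) (act_iter FL).
have X0 j : iter j F (X 0%N) = iter j F x by rewrite /X mulr0n act0.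
have [/andP[b0 ba] _ _ _ _] := lab.
have a0 : 0 < val a by lra.
rewrite /l big_split /= -!mulr_sumr /N; apply: lerD; apply: ler_wpM2l => //.
  apply: (@le_trans _ _ (\sum_(j < `|b.1|) \sum_(k < K)
     (act a (iter j F (X k)) - iter j F (X k)))).
    apply: ler_sum => j _; apply: (@le_trans _ _ (iter j F (X K) - iter j F (X 0%N))).
      by rewrite X0; apply: lerB; rewrite iterF_le.
    rewrite -(telescope_sumr (fun k => iter j F (X k))) // big_mkord.
    by apply: ler_sum => k _; rewrite XS.
  rewrite exchange_big /= -[leRHS]mulr1 -[K in K%:R]card_ord -sumr_const mulr_suml.
  by apply: ler_sum => k _; rewrite mul1r; exact: (level_sum FL rotF irr).
rewrite exchange_big /= -[size cs]sum1_size natr_sum mulr_suml.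
apply: ler_sum => c _; rewrite mul1r.
apply: (@le_trans _ _ (\sum_(j < `|b.1|) \sum_(k < K.+1) (`[< exists m : int,
     iter j F (X k) <= c + m%:~R < act a (iter j F (X k)) >]%:R : R))).
  apply: ler_sum => j _; rewrite /ind; case: asboolP => [[m /andP[m1 m2]]|_]; last first.
    by rewrite sumr_ge0.
  have xm : iter j F x <= c + m%:~R.
    by apply: le_trans m1; rewrite iterF_le.
  have [k /andP[k1 k2]] := steps FL rotF a0 xm.
  have kK : (k < K.+1)%N.
    rewrite ltnS leqNgt; apply/negP => Kk.
    have : act (a *+ K) (iter j F x) < act (a *+ k) (iter j F x).
      by apply: (act_rval FL rotF); rewrite !rvalMn ltr_pMn2l.
    rewrite (act_iter FL) => h; have : iter j F s <= iter j F (act (a *+ K) x).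
      by rewrite iterF_le.
    lra using h k1 m2.
  rewrite (bigD1 (Ordinal kK)) //= -[leLHS]addr0; apply: lerD; last by rewrite sumr_ge0.
  case: asboolP => // -[]; exists m; rewrite XK k1 /=.
  by rewrite -(actD FL) -mulrS.
rewrite exchange_big /= -[leRHS]mulr1 -[in K.+1%:R](card_ord K.+1) -sumr_const mulr_suml.
by apply: ler_sum => k _; rewrite mul1r; exact: (level_hits FL rotF irr).
Qed.

Definition lift_gap a x : R := act a x - x.
Local Notation gap := lift_gap.

Lemma gap_gt0 a x : 0 < val a -> 0 < gap a x.
Proof. by move=> a0; rewrite subr_gt0; exact: rotF. Qed.

Lemma gapD a x (m : int) : gap a (x + m%:~R) = gap a x.
Proof. by rewrite /gap -(act_int F) (actC FL) !act_int; ring. Qed.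

Lemma act_continuous a : 0 <= a.1 -> continuous (act a).
Proof.
case: a => -[k|//] p _ /=; have [_ Fc _] := FL.
have ck : continuous (iter k F).
  elim: k => [|k IH] x; first exact: cvg_id.
  have -> : iter k.+1 F = F \o iter k F by [].
  by apply: continuous_comp; [exact: IH|exact: Fc].
by move=> x; apply: cvgD; [exact: ck|exact: cvg_cst].
Qed.

Lemma periodic_min (g : R -> R) : continuous g ->
  (forall x (m : int), g (x + m%:~R) = g x) -> exists x0, forall x, g x0 <= g x.
Proof.
move=> gc gp.
have [x0 _ x0m] := @EVT_min R g 0 1 ler01 (continuous_subspaceT gc).
exists x0 => x; have /andP[h1 h2] := mem_rg1_floor x.
rewrite -(gp x (- Num.floor x)); apply: x0m.
by rewrite in_itv /= mulrNz; apply/andP; split; lra.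
Qed.

Lemma gap_min a : exists x0, forall x, gap a x0 <= gap a x.
Proof.
have [a0|a0] := leP 0 a.1.
  apply: periodic_min => [x|]; last exact: gapD.
  by apply: cvgB; [exact: (act_continuous a0)|exact: cvg_id].
(* For negative time it is [act (- a)] whose continuity is available, so the gap is minimised as a
   function of its right end. *)
have a0' : 0 <= (- a).1 by rewrite /=; lia.
have [|x m|x0 h] := @periodic_min (fun y => y - act (- a) y).
- by move=> x; apply: cvgB; [exact: cvg_id|exact: (act_continuous a0')].
- by rewrite -(act_int F) (actC FL) !act_int; ring.
exists (act (- a) x0) => x; have := h (act a x).
by rewrite /gap (actNK FL) (actK FL).
Qed.

(** Taken on four consecutive points of an orbit of [a], so that a lower bound compares the gap at
    [y] with both neighbouring gaps. *)
Definition cross4 a y := cross (act (- a) y) y (act a y) (act (a + a) y).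

Lemma cross4_act a c y : cross4 a (act c y) =
  cross (act c (act (- a) y)) (act c y) (act c (act a y)) (act c (act (a + a) y)).
Proof. by rewrite /cross4 !(actC FL _ c). Qed.

Lemma cross4_iter : exists2 B : R, 1 <= B & forall a b c y, level rho a b ->
  0 <= c.1 -> c.1 <= `|b.1| -> cross4 a (act c y) <= B * cross4 a y.
Proof.
have [B B1 HB] := cross_iter 3; exists B => // a b [[k|//] p] y lab /= _ kb.
have [/andP[b0 ba] _ _ _ _] := lab; have a0 : 0 < val a by lra.
rewrite cross4_act /lift_act /= -/(itz F k) crossDr.
have := HB a b (act (- a) y) lab (act (- a) y) y (act a y) (act (a + a) y).
apply => //.
- by rewrite -[ltRHS](act0 F); apply: (act_rval FL rotF); rewrite rvalN /rval /=; move: a0; rewrite /rval; lra.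
- exact: rotF.
- by rewrite (actD FL); exact: rotF.
- rewrite -(actD FL); have -> : a *+ 3 - a = a + a by rewrite mulrSr addrK mulr2n.
  by [].
Qed.

Lemma gap_cross a y (e : R) : 0 < val a -> e <= cross4 a y ->
  e * gap a y <= gap a (act (- a) y) /\ e * gap a y <= gap a (act a y).
Proof.
move=> a0 ec.
have p1 : act (- a) y < y by rewrite (act_ltN FL); exact: rotF.
have p2 : y < act a y by exact: rotF.
have p3 : act a y < act (a + a) y by rewrite (actD FL); exact: rotF.
have h1 := le_crossl p1 p2 p3 ec; have h2 := le_crossr p1 p2 p3 ec.
rewrite /gap (actNK FL) -(actD FL).
have [e0|e0] := leP 0 e; first by nra.
by nra.
Qed.

(** Where [gap a] is minimal, both neighbouring gaps are at least as long and the cross-ratio is at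
    least 1/4. Two pullbacks, by whichever of [a] and [- a] has nonnegative time, give three
    consecutive gaps comparable to the minimum. Every orbit enters this stretch within [|b.1|]
    iterates ([hit]); at the entry point the gap is nearly minimal, so the cross-ratio is again
    bounded below, and pulling it back reaches an arbitrary point. *)
Lemma gap_step : exists2 e : R, 0 < e & forall a b x, level rho a b ->
  e * gap a x <= gap a (act a x) /\ e * gap a x <= gap a (act (- a) x).
Proof.
have [B B1 HB] := cross4_iter.
(* The bound 1/4 at the minimum after two pullbacks, each costing a factor [B]. *)
pose e0 : R := (4 * B ^+ 2)^-1.
have e00 : 0 < e0 by rewrite invr_gt0; nra.
(* Bounds the total length of the three consecutive intervals, in units of the minimal gap. *)
pose L : R := 1 + e0^-1 + e0^-1 ^+ 2.
have L1 : 1 <= L by rewrite /L -addrA lerDl addr_ge0 // ?sqr_ge0 // invr_ge0 ltW.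
pose e1 : R := (1 + L)^-1 ^+ 2 / B.
have B0 : 0 < B by lra.
have e10 : 0 < e1 by rewrite divr_gt0 // exprn_gt0 // invr_gt0; lra.
exists e1 => // a b x lab.
have [/andP[b0 ba] _ _ ab _] := lab; have a0 : 0 < val a by lra.
have [x0 x0m] := gap_min a.
have gp y := gap_gt0 y a0.
have c0 : 1 / 4 <= cross4 a x0.
  have -> : (1 : R) / 4 = (1 / 2) ^+ 2 by field.
  have h1 := x0m (act (- a) x0); have h2 := x0m (act a x0).
  have h3 := gp x0; have h4 := gp (act (- a) x0); have h5 := gp (act a x0).
  rewrite /gap (actNK FL) in h1 h4; rewrite /gap -(actD FL) in h2 h5.
  by rewrite /gap in h1 h2 h3; apply: cross_ge; lra using h1 h2 h3 h4 h5.
have [w hw] : exists w, forall z, w <= z -> z <= act (a + a) w ->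
    gap a z <= L * gap a x0.
  have main u v : e0 <= cross4 a u -> e0 <= cross4 a v ->
      e0 * gap a u <= gap a x0 -> e0 * gap a v <= gap a u ->
      gap a x0 + gap a u + gap a v <= L * gap a x0.
    move=> cu cv ux vu; rewrite /L !mulrDl mul1r.
    have gu : gap a u <= e0^-1 * gap a x0 by rewrite mulrC ler_pdivlMr // mulrC.
    have gv : gap a v <= e0^-1 * gap a u by rewrite mulrC ler_pdivlMr // mulrC.
    rewrite lerD // ?lerD // (le_trans gv) // expr2 -mulrA ler_wpM2l //.
    by rewrite invr_ge0 ltW.
  have le14 : B * e0 <= 1 / 4 /\ B * (B * e0) <= 1 / 4.
    have E : B * (B * e0) = 1 / 4 by rewrite /e0; field; lra.
    by split; nra using B1 E.
  have [sa|sa] := leP 0 a.1.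
  - have ca : a.1 <= `|b.1| by lia using ab sa.
    have c1 : B * e0 <= cross4 a (act (- a) x0).
      have := HB _ _ a (act (- a) x0) lab sa ca; rewrite (actNK FL) => h.
      by nra.
    have c2 : e0 <= cross4 a (act (- a) (act (- a) x0)).
      have := HB _ _ a (act (- a) (act (- a) x0)) lab sa ca; rewrite (actNK FL) => h.
      by nra.
    have c1' : e0 <= cross4 a (act (- a) x0) by nra.
    exists (act (- a) (act (- a) x0)) => z wz zw.
    have [_ h1] := gap_cross a0 c1'; have [_ h2] := gap_cross a0 c2.
    rewrite !(actNK FL) in h1 h2.
    apply: le_trans (main _ _ c1' c2 h1 h2).
    rewrite (actD FL) !(actNK FL) in zw; rewrite /gap !(actNK FL).
    have : act a z <= act a x0 by rewrite (act_le FL).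
    by lra using wz.
  - have sa' : 0 <= (- a).1 by rewrite /=; lia using sa.
    have ca : (- a).1 <= `|b.1| by rewrite /=; lia using ab sa.
    have c1 : B * e0 <= cross4 a (act a x0).
      have := HB _ _ (- a) (act a x0) lab sa' ca; rewrite (actK FL) => h.
      by nra.
    have c2 : e0 <= cross4 a (act a (act a x0)).
      have := HB _ _ (- a) (act a (act a x0)) lab sa' ca; rewrite (actK FL) => h.
      by nra using B1 c1 h.
    have c1' : e0 <= cross4 a (act a x0) by nra using B1 c1 e00.
    exists x0 => z wz zw.
    have [h1 _] := gap_cross a0 c1'; have [h2 _] := gap_cross a0 c2.
    rewrite !(actK FL) in h1 h2.
    apply: le_trans (main _ _ c1' c2 h1 h2).
    rewrite (actD FL) in zw; rewrite /gap.
    have : act a z <= act a (act a (act a x0)) by rewrite (act_le FL).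
    by lra using wz.
have [c [c1 cb /andP[h1 h2]]] := hit FL rotF w x (or_introl erefl) lab.
rewrite mul1r in c1; rewrite mul1r in cb.
have := HB _ _ c x lab c1 (ltW cb); set z := act c x => cz.
have gz : gap a z <= L * gap a x0.
  apply: hw => //; apply/ltW; apply: lt_trans h2 _.
  by apply: (act_rval FL rotF); rewrite !rvalD; lra using ba.
have cz' : (1 + L)^-1 ^+ 2 <= cross4 a z.
  have g1 := x0m (act (- a) z); have g2 := x0m (act a z).
  have g3 := gp z; have g4 := gp (act (- a) z); have g5 := gp (act a z).
  rewrite /gap (actNK FL) -/(gap a x0) in g1 g4.
  rewrite /gap -(actD FL) -/(gap a x0) in g2 g5.
  have g6 := gp x0; rewrite {1}/gap in gz; rewrite /gap in g3.
  apply: cross_ge; [lra using g3 g4 g5|lra using g3 g4 g5|lra using g3 g4 g5| | |].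
  - by rewrite invr_ge0; lra using L1.
  - by rewrite mulrC ler_pdivrMr; [nra using L1 g1 gz|lra using L1 g1 gz].
  - by rewrite mulrC ler_pdivrMr; [nra using L1 g2 gz|lra using L1 g2 gz].
have cx : e1 <= cross4 a x by rewrite /e1 ler_pdivrMr // mulrC; lra.
by have [] := gap_cross a0 cx.
Qed.

Lemma gap_comp (m : nat) : exists2 C : R, 1 <= C & forall a b x y, level rho a b ->
  act (- (a *+ m)) x <= y -> y <= act (a *+ m) x -> gap a y <= C * gap a x.
Proof.
have [e e0 he] := gap_step.
pose L : R := 1 + e^-1.
have e1 : 0 < e^-1 by rewrite invr_gt0.
have L1 : 1 <= L by rewrite /L; lra.
exists (L ^+ m); first exact: exprn_ege1.
move=> a b x y lab; have [/andP[b0 ba] _ _ _ _] := lab; have a0 : 0 < val a by lra.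
have gp z := gap_gt0 z a0.
have up z : gap a (act a z) <= e^-1 * gap a z.
  by rewrite mulrC ler_pdivlMr // mulrC; have [_] := he a b (act a z) lab; rewrite (actK FL).
have dn z : gap a (act (- a) z) <= e^-1 * gap a z.
  by rewrite mulrC ler_pdivlMr // mulrC; have [] := he a b (act (- a) z) lab; rewrite (actNK FL).
elim: m y => [|m IH] y.
  rewrite mulr0n oppr0 !act0 expr0 mul1r => h1 h2.
  by have -> : y = x by lra.
rewrite mulrSr opprD [- _ - a]addrC !(actD FL) => h1 h2.
have base z : x <= z -> z <= act a x -> gap a z <= L * gap a x.
  move=> xz zx; have : act a z <= act a (act a x) by rewrite (act_le FL).
  by have := up x; rewrite /gap /L; lra.
have base' z : act (- a) x <= z -> z <= x -> gap a z <= L * gap a x.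
  move=> xz zx; have : act a z <= act a x by rewrite (act_le FL).
  by have := dn x; rewrite /gap /L (actNK FL); lra.
have Lm : L <= L ^+ m.+1 by rewrite exprS ler_peMr ?exprn_ege1 //; lra.
have big : L * gap a x <= L ^+ m.+1 * gap a x by rewrite ler_wpM2r // ltW.
have [xy|yx] := leP x y.
  have [ya|ya] := leP y (act a x); first exact: le_trans (base _ xy ya) big.
  have h : gap a (act (- a) y) <= L ^+ m * gap a x.
    apply: IH; last by rewrite -(act_le FL a) (actNK FL) (actC FL a).
    apply: le_trans (act_geN FL rotF irr x _) _; first by rewrite rvalMn mulrn_wge0 // ltW.
    by rewrite (act_leN FL) ltW.
  have := up (act (- a) y); rewrite (actNK FL) => h'.
  apply: le_trans h' _; rewrite exprS -mulrA.
  apply: (@le_trans _ _ (L * gap a (act (- a) y))).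
    by rewrite ler_wpM2r ?(ltW (gp _)) // /L; lra.
  by rewrite ler_wpM2l //; lra.
have [ya|ya] := leP (act (- a) x) y; first exact: le_trans (base' _ ya (ltW yx)) big.
have h : gap a (act a y) <= L ^+ m * gap a x.
  apply: IH; first by rewrite -(act_le FL (- a)) (actK FL).
  apply: (@le_trans _ _ x); first by rewrite -(act_leN FL) ltW.
  by apply: (act_ge FL rotF irr); rewrite rvalMn mulrn_wge0 // ltW.
have := dn (act a y); rewrite (actK FL) => h'.
apply: le_trans h' _; rewrite exprS -mulrA.
apply: (@le_trans _ _ (L * gap a (act a y))).
  by rewrite ler_wpM2r ?(ltW (gp _)) // /L; lra.
by rewrite ler_wpM2l //; lra.
Qed.

Lemma gap_mono a b x : val a < val b -> gap a x <= gap b x.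
Proof. by move=> ab; rewrite lerD2r ltW // (act_rval FL rotF). Qed.

(** With c = a - m b, a step by [a] contains a step by [c] followed by one by [b]. The latter is
    longer than the second step by [c], which by [gap_step] is at least [e] times the first one. *)
Lemma gap_contract : exists2 t : R, 0 < t < 1 & forall a b (m : nat) x,
  level rho a b -> (0 < m)%N -> level rho b (a - b *+ m) ->
  gap (a - b *+ m) x <= t * gap a x.
Proof.
have [e e0 he] := gap_step.
exists (1 + e)^-1; first by rewrite invr_gt0 invf_lt1; lra.
move=> a b m x lab m0 lbc; set c := a - b *+ m in lbc *.
have aE : a = b *+ m + c by rewrite /c addrC subrK.
clearbody c; have [/andP[c0 cb] _ _ _ _] := lbc.
rewrite mulrC ler_pdivlMr; last by lra.
have : act b (act c x) <= act a x.
  rewrite aE (actD FL) -(prednK m0) mulrS (actD FL) (act_le FL).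
  by apply: (act_ge FL rotF irr); rewrite rvalMn mulrn_wge0 //; lra.
have := gap_mono (act c x) cb.
have [d0 ld] := level_next irr lbc.
have [hc _] := he _ _ x ld.2.
by move: hc; rewrite /gap; lra.
Qed.

End Gaps.

(** * Gaps at critical points of return maps *)

Section CriticalGeometry.
Variables (R : realType) (F : R -> R) (rho : R) (crit : set R).
Local Notation val := (rval rho).
Local Notation act := (lift_act F).
Local Notation gap := (lift_gap F).
Hypothesis FL : circle_lift_map F.
Hypothesis rotF : is_rotation F rho.
Hypothesis irr : forall a, val a = 0 -> a = 0.
Hypothesis crF : cross_bound F.
Implicit Types (a b c : int * int) (x y z : R) (k m : nat).

Lemma gap_window (m : nat) : exists2 C : R, 1 <= C & forall a b x y, level rho a b ->
  act (- (a *+ m)) x <= y -> y <= act (a *+ m) x ->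
  [/\ gap a y <= C * gap a x, gap a x <= C * gap a y &
    act (a *+ m) x - act (- (a *+ m)) x <= C * gap a x].
Proof.
have [C C1 HC] := gap_comp FL rotF irr crF m.
exists (C * (2 * m%:R + 1)).
  by have : 0 <= m%:R :> R by []; nra.
move=> a b x y lab h1 h2; have [/andP[b0 ba] _ _ _ _] := lab; have a0 : 0 < val a by lra.
have gp z := gap_gt0 rotF z a0.
have m0 : 0 <= m%:R :> R by [].
have CC : C <= C * (2 * m%:R + 1) by rewrite ler_peMr; lra.
have W z : act (- (a *+ m)) x <= z -> z <= act (a *+ m) x ->
    gap a z <= C * gap a x by exact: HC lab.
split.
- by apply: le_trans (W y h1 h2) _; rewrite ler_wpM2r // ltW.
- apply: (@le_trans _ _ (C * gap a y)); last by rewrite ler_wpM2r // ltW.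
  apply: HC lab _ _; first by rewrite -(act_le FL (a *+ m)) (actNK FL).
  by rewrite -(act_le FL (- (a *+ m))) (actK FL).
- have up k : (k <= m)%N -> act (a *+ k) x - x <= k%:R * (C * gap a x).
    elim: k => [|k IH] km; first by rewrite mulr0n act0 mul0r subrr.
    have : gap a (act (a *+ k) x) <= C * gap a x.
      apply: W.
        apply: (@le_trans _ _ x); last by apply: (act_ge FL rotF irr); rewrite rvalMn mulrn_wge0 // ltW.
        by apply: (act_geN FL rotF irr); rewrite rvalMn mulrn_wge0 // ltW.
      by apply: (act_rval_le FL rotF irr); rewrite !rvalMn ler_pMn2l // ltnW.
    have := IH (ltnW km); rewrite /lift_gap mulrS (actD FL) -natr1; lra.
  have dn k : (k <= m)%N -> x - act (- (a *+ k)) x <= k%:R * (C * gap a x).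
    elim: k => [|k IH] km; first by rewrite mulr0n oppr0 act0 mul0r subrr.
    have h := IH (ltnW km).
    have : gap a (act (- (a *+ k.+1)) x) <= C * gap a x.
      apply: W.
        by apply: (act_rval_le FL rotF irr); rewrite !rvalN !rvalMn lerN2 ler_pMn2l.
      apply: (@le_trans _ _ x); last by apply: (act_ge FL rotF irr); rewrite rvalMn mulrn_wge0 // ltW.
      by apply: (act_geN FL rotF irr); rewrite rvalMn mulrn_wge0 // ltW.
    have E : a + - (a *+ k.+1) = - (a *+ k) by rewrite mulrS opprD addrA subrr add0r.
    by rewrite {1}/lift_gap -(actD FL) E -natr1; lra.
  have := up m (leqnn m); have := dn m (leqnn m); have := gp x; nra.
Qed.

(** Flatness at a critical point: on one side of it, points that are relatively much closer are
    brought closer still by an arbitrarily small extra factor. The exponent is not named; it is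
    hidden in [l] and [t]. *)
Definition crit_contraction : Prop :=
  forall e : R, 0 < e -> exists l t : R, [/\ 0 < l, 0 < t & forall c y z : R,
    crit c -> 0 < (y - c) * (z - c) -> `|z - c| < t -> `|y - c| <= l * `|z - c| ->
    `|F y - F c| * `|z - c| <= e * `|y - c| * `|F z - F c|].

Hypothesis ccF : crit_contraction.

Lemma iter_act b x : 0 <= b.1 -> iter `|b.1| F x = act b x - b.2%:~R.
Proof. by case: b => -[n|//] p _; rewrite /lift_act /= addrK. Qed.

Lemma gap_near (m : nat) : exists2 C : R, 1 <= C & forall a b x c, level rho a b ->
  `|val c| <= m%:R * val a ->
  [/\ gap a (act c x) <= C * gap a x, gap a x <= C * gap a (act c x) &
    `|act c x - x| <= C * gap a x].
Proof.
have [C C1 HC] := gap_window m; exists C => // a b x c lab.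
rewrite ler_norml => /andP[c1 c2].
have h1 : act (- (a *+ m)) x <= act c x.
  by apply: (act_rval_le FL rotF irr); rewrite rvalN rvalMn -mulr_natl.
have h2 : act c x <= act (a *+ m) x.
  by apply: (act_rval_le FL rotF irr); rewrite rvalMn -mulr_natl.
have [g1 g2 g3] := HC a b x (act c x) lab h1 h2; split => //.
have [/andP[b0 ba] _ _ _ _] := lab.
have h3 : act (- (a *+ m)) x <= x.
  by apply: (act_geN FL rotF irr); rewrite rvalMn mulrn_wge0 //; lra.
have h4 : x <= act (a *+ m) x.
  by apply: (act_ge FL rotF irr); rewrite rvalMn mulrn_wge0 //; lra.
by rewrite ler_norml; apply/andP; split; lra using g3 h1 h2 h3 h4.
Qed.

Lemma act_window a b x : level rho a b ->
  [/\ act (- (a *+ 3)) x < act (- (a *+ 2)) x,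
      act (- (a *+ 2)) x < act (- b) x, act (- b) x < x & act (- a) x < act (- b) x].
Proof.
move=> [/andP[b0 ba] _ _ _ _].
split.
- by apply: (act_rval FL rotF); rewrite !rvalN !rvalMn; lra.
- by apply: (act_rval FL rotF); rewrite !rvalN !rvalMn; lra.
- by rewrite (act_ltN FL); exact: rotF.
- by apply: (act_rval FL rotF); rewrite !rvalN; lra.
Qed.

(** Put r = b^(-1) c, q = a^(-2) c and p = a^(-3) c. If [r] were too close to [c] compared with [q],
    the flatness of [F] at [c] would make the cross-ratio of the images of p, q, r, c small against
    (c - r) / (c - q), and the remaining |b.1| - 1 iterates enlarge it by at most [B]. But these
    iterates bring [F r] to [c] and [F c] to [act b c] up to a translation, where comparability of
    gaps bounds the same cross-ratio from below. *)
Lemma crit_gap : exists C t : R, [/\ 1 <= C, 0 < t & forall a b, level rho a b ->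
  0 < b.1 -> (forall x, gap a x < t) -> forall c : R, crit c -> gap a c <= C * gap b c].
Proof.
have [B B1 HB] := cross_iter FL rotF irr crF 3.
have [G G1 HG] := gap_near 3.
have G0 : 0 < G by lra.
have B0 : 0 < B by lra.
(* Chosen so that the upper estimate in [bad] is half of the lower one. *)
pose e : R := (4 * B * G ^+ 5)^-1.
have P : 1 <= G ^+ 5 by rewrite exprn_ege1.
have e0 : 0 < e by rewrite invr_gt0; nra.
have [l [t [l0 t0 Hl]]] := ccF e0.
exists (G ^+ 2 / l + 1), (t / G); split; first by rewrite lerDr divr_ge0 ?sqr_ge0 // ltW.
  by rewrite divr_gt0 //; lra.
move=> a b lab b1 gt c cc.
have [/andP[b0 ba] _ _ abt _] := lab; have a0 : 0 < val a by lra using b0 ba.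
have [w1 w2 w3 w4] := act_window c lab.
have [d [_ ld]] := level_next irr lab.
have near (z : int * int) := HG a b c z lab.
have nb : `|val (- b)| <= 3 * val b by rewrite rvalN normrN gtr0_norm; lra using b0.
have [gb _ _] := HG _ _ c _ ld nb.
have g0 := gap_gt0 rotF c a0; have h0 := gap_gt0 rotF c b0.
have na : `|val (- a)| <= 3 * val a by rewrite rvalN normrN gtr0_norm; lra using b0 ba.
have nb3 : `|val (b - a *+ 3)| <= 3 * val a.
  by rewrite rvalB rvalMn ler_norml; apply/andP; split; lra using b0 ba.
have n2 : `|val (- (a *+ 2))| <= 3 * val a.
  by rewrite rvalN rvalMn ler_norml; apply/andP; split; lra using b0 ba.
have [_ ga _] := near _ na.
have [_ gp2 gp3] := near _ nb3.
have [_ _ gq] := near _ n2.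
rewrite {1}/lift_gap (actNK FL) in gb; rewrite {2}/lift_gap (actNK FL) in ga.
rewrite ler_norml in gq; case/andP: gq => gq _.
rewrite ler_norml in gp3; case/andP: gp3 => gp3 _.
set p := act _ c in w1; set q := act _ c in w1 w2 gq; set r := act _ c in w2 w3 w4 gb.
set D := gap a c in g0 ga gp2 gp3 gq *; set E := gap b c in gb h0 *.
have DE : E <= D by exact: (gap_mono FL rotF).
have qr : act (- a) c - q >= 0.
  rewrite subr_ge0; apply: ltW; apply: (act_rval FL rotF).
  by rewrite !rvalN rvalMn; lra using b0 ba.
have cq : D <= G * (c - q) by nra using G1 ga qr.
(* If [r] is not close to [c], the step by [b] is already comparable to the gap of [a]; the other
   case is refuted below. *)
have [crs|crs] := leP (c - r) (l * (c - q)); last first.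
  have : l * D <= G ^+ 2 * E by rewrite expr2; nra using G1 cq crs gb l0.
  move=> h; rewrite mulrDl mul1r mulrAC.
  have : D <= G ^+ 2 * E / l by rewrite ler_pdivlMr // mulrC.
  by lra using h0.
have Y1 : (F c - F r) / (F c - F q) <= e * ((c - r) / (c - q)).
  have Fqc : F q < F c by rewrite (F_lt FL); lra using w2 w3.
  have Frc : F r < F c by rewrite (F_lt FL).
  have := Hl c r q cc; rewrite nmulr_rgt0; last by lra using w3.
  rewrite !ltr0_norm ?subr_lt0 //; last by lra using w2 w3.
  rewrite !opprB => H.
  have {}H : (F c - F r) * (c - q) <= e * (c - r) * (F c - F q).
    apply: H => //; first by lra using w2 w3.
    by have := gt c; rewrite -/D ltr_pdivlMr // => h; apply: le_lt_trans h; rewrite mulrC; lra using gq.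
  rewrite ler_pdivrMr ?subr_gt0 //.
  have -> : e * ((c - r) / (c - q)) * (F c - F q) = e * (c - r) * (F c - F q) / (c - q).
    by field; lra using w2 w3.
  by rewrite ler_pdivlMr //; lra using w2 w3.
have X1 : cross (act b p) (act b q) c (act b c) <= B * (e * ((c - r) / (c - q))).
  have pq : F p < F q by rewrite (F_lt FL).
  have qr' : F q < F r by rewrite (F_lt FL).
  have rc : F r < F c by rewrite (F_lt FL).
  apply: le_trans (_ : B * cross (F p) (F q) (F r) (F c) <= _).
    have := HB a b (F p) lab (F p) (F q) (F r) (F c) (lexx _) pq qr' rc.
    have -> : act (a *+ 3) (F p) = F c.
      by rewrite -[F p]/(iter 1 F p) (act_iter FL) (actNK FL).
    move=> /(_ (lexx _)) /(_ `|b.1|.-1 (leq_pred _)).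
    have q0 : (0 < `|b.1|)%N by rewrite absz_gt0 gt_eqF.
    have E' (z : R) : iter `|b.1|.-1 F (F z) = act b z + - b.2%:~R.
      by rewrite -iterSr prednK // iter_act // ltW.
    rewrite !E' crossDr.
    by rewrite /r (actNK FL).
  rewrite ler_wpM2l; [by []|lra using B1|].
  exact: le_trans (cross_ler pq qr' rc) Y1.
have X2 : (G ^+ 2)^-1 * (E / (2 * G * D)) <= cross (act b p) (act b q) c (act b c).
  have bp : act b p = act (b - a *+ 3) c by rewrite (actD FL).
  have bq : act b q = act a (act b p).
    rewrite /q /p -!(actD FL); congr (act _ c).
    by rewrite [a *+ 3]mulrSr opprD; ring.
  have bqc : act b q < c.
    by rewrite -[ltRHS](actNK FL b) -/r (act_lt FL).
  have qbq : q <= act b q by rewrite ltW // rotF.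
  apply: cross_geM.
  - by rewrite (act_lt FL).
  - by [].
  - exact: rotF.
  - by rewrite invr_ge0 sqr_ge0.
  - by rewrite ltW // divr_gt0 // !mulr_gt0 ?ltr0n.
  - rewrite mulrC ler_pdivrMr ?exprn_gt0 //.
    rewrite bq -/(lift_gap F a _) bp expr2; nra.
  - rewrite -/E mulrAC ler_pdivrMr; last by rewrite !mulr_gt0 ?ltr0n.
    apply: ler_wpM2l; first exact: ltW.
    have h1 : act b c - c = E by [].
    have h2 : D <= G * D by rewrite ler_peMl // ltW.
    by lra using DE crs gq h1 h2 qbq.
have bad : (G ^+ 2)^-1 * (E / (2 * G * D)) <= B * (e * (G ^+ 2 * (E / D))).
  apply: le_trans X2 (le_trans X1 _).
  apply: ler_wpM2l; first exact: ltW.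
  apply: ler_wpM2l; first exact: ltW.
  rewrite ler_pdivrMr; last by lra using w2 w3.
  have ED : E / D * D = E by rewrite divfK // gt_eqF.
  have u0 : 0 < E / D by rewrite divr_gt0.
  have -> : G ^+ 2 * (E / D) * (c - q) = G * (E / D * (G * (c - q))) by ring.
  apply: le_trans gb _; rewrite -{1}ED.
  apply: ler_wpM2l; first exact: ltW.
  by apply: ler_wpM2l; first exact: ltW.
exfalso; move: bad; set u := E / D.
have u0 : 0 < u by rewrite divr_gt0.
have -> : (G ^+ 2)^-1 * (E / (2 * G * D)) = 2 * (u / (4 * G ^+ 3)) by rewrite /u; field; lra using G1 g0.
have -> : B * (e * (G ^+ 2 * u)) = u / (4 * G ^+ 3) by rewrite /e; field; lra using B1 G1.
have : 0 < u / (4 * G ^+ 3) by rewrite divr_gt0 // mulr_gt0 // exprn_gt0; lra using B1 G1.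
by lra.
Qed.

(** Comparable gaps at F^i y bound from below the cross-ratio of the images of that point under
    a^(-3), a^(-2), b^(-1) and the identity. The bound pulls back to [y], where it says that the
    step by [b] ending at [y] is not short. *)
Lemma pull_gap (C : R) : 1 <= C -> exists2 C' : R, 1 <= C' & forall a b, level rho a b ->
  forall y i, (i <= `|b.1|)%N -> gap a (iter i F y) <= C * gap b (iter i F y) ->
  gap a y <= C' * gap b y.
Proof.
move=> C1.
have [B B1 HB] := cross_iter FL rotF irr crF 3.
have [G G1 HG] := gap_near 3.
have G0 : 0 < G by lra.
have B0 : 0 < B by lra.
pose k := (G ^+ 2)^-1 * (C * G ^+ 2)^-1 / B.
have k0 : 0 < k by rewrite divr_gt0 ?mulr_gt0 ?invr_gt0 ?mulr_gt0 ?exprn_gt0; lra using B1 C1 G1.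
exists (G ^+ 2 / k + 1); first by rewrite lerDr divr_ge0 ?sqr_ge0 // ltW.
move=> a b lab y i iq hx; set x := iter i F y in hx.
have [/andP[b0 ba] _ _ abt _] := lab; have a0 : 0 < val a by lra.
have [d [_ ld]] := level_next irr lab.
have nb : `|val (- b)| <= 3 * val b by rewrite rvalN normrN gtr0_norm; lra.
have na : `|val (- a)| <= 3 * val a by rewrite rvalN normrN gtr0_norm; lra using b0 ba.
have n3 : `|val (- (a *+ 3))| <= 3 * val a.
  by rewrite rvalN rvalMn ler_norml; apply/andP; split; lra using b0 ba.
have n2 : `|val (- (a *+ 2))| <= 3 * val a.
  by rewrite rvalN rvalMn ler_norml; apply/andP; split; lra using b0 ba.
have [w1 w2 w3 w4] := act_window x lab.
have lo : k * B <= cross (act (- (a *+ 3)) x) (act (- (a *+ 2)) x) (act (- b) x) x.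
  rewrite /k divfK; last by lra using B1.
  have g0 := gap_gt0 rotF x a0; have h0 := gap_gt0 rotF x b0.
  have [_ g3 l3] := HG a b x _ lab n3; have [_ _ l2] := HG a b x _ lab n2.
  have [_ gb _] := HG b _ x _ ld nb.
  rewrite ler_norml in l3; case/andP: l3 => l3 _.
  rewrite ler_norml in l2; case/andP: l2 => l2 _.
  rewrite {2}/lift_gap (actNK FL) in gb.
  have E : act a (act (- (a *+ 3)) x) = act (- (a *+ 2)) x.
    rewrite -(actD FL); congr (act _ x); rewrite [a *+ 3]mulrSr opprD; ring.
  rewrite {2}/lift_gap E in g3.
  apply: cross_geM => //.
  - by rewrite invr_ge0 sqr_ge0.
  - by rewrite invr_ge0 mulr_ge0 ?sqr_ge0; lra using C1.
  - by rewrite mulrC ler_pdivrMr ?exprn_gt0 //;rewrite expr2; nra.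
  - rewrite mulrC ler_pdivrMr; last by rewrite mulr_gt0 ?exprn_gt0 ?ltr0n //; lra using C1.
    have : C * gap b x <= C * (G * (x - act (- b) x)) by rewrite ler_wpM2l //; lra using C1.
    have : G * gap a x <= G * (C * gap b x) by rewrite ler_wpM2l //; lra using G1.
    by rewrite expr2; nra.
have [v1 v2 v3 v4] := act_window y lab.
have up := HB a b (act (- (a *+ 3)) y) lab _ _ _ _ (lexx _) v1 v2 v3 _ i iq.
rewrite (actNK FL) -!(act_iter FL) -/x in up.
have {}up := up (lexx _).
have ck : k <= cross (act (- (a *+ 3)) y) (act (- (a *+ 2)) y) (act (- b) y) y.
  rewrite -(ler_pM2l (_ : 0 < B)); last by lra using B1.
  by rewrite mulrC; lra using lo up.
have := le_crossr v1 v2 v3 ck.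
have [_ ga _] := HG a b y _ lab na.
have [gb _ _] := HG b _ y _ ld nb.
rewrite {2}/lift_gap (actNK FL) in ga; rewrite {1}/lift_gap (actNK FL) in gb.
have g0 := gap_gt0 rotF y a0; have h0 := gap_gt0 rotF y b0.
have v5 : act (- (a *+ 2)) y < act (- a) y.
  by apply: (act_rval FL rotF); rewrite !rvalN rvalMn; lra using b0 ba.
move=> hk.
have : gap a y <= G ^+ 2 * gap b y / k.
  rewrite ler_pdivlMr // expr2.
  have : gap a y * k <= G * (y - act (- (a *+ 2)) y) * k.
    by rewrite ler_wpM2r; [by []|lra|nra].
  have : G * (k * (y - act (- (a *+ 2)) y)) <= G * (G * gap b y).
    by apply: ler_wpM2l; [exact: ltW|lra using gb hk].
  by nra.
by rewrite mulrDl mul1r mulrAC; lra using h0.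
Qed.

Lemma phi_crit_gap : exists C t : R, [/\ 1 <= C, 0 < t & forall a b, level rho a b ->
  0 < b.1 -> (forall x, gap a x < t) -> forall s i, (i < `|b.1|)%N ->
  crit (iter i F s) -> gap a s <= C * gap b s].
Proof.
have [C [t [C1 t0 H]]] := crit_gap; have [C' C'1 H'] := pull_gap C1.
exists C', t; split => // a b lab b1 gt s i ib cs.
by apply: (H' _ _ lab s i (ltnW ib)); exact: H.
Qed.

(** The points a^(m+1) x and a^(m+2) x complete [y], [z] to a quadruple whose cross-ratio measures z
    - y against the gap at [x]. This holds at time 0 and at time [i], so bounded distortion becomes
    an upper bound for the slopes of F^i, in spite of critical points. *)
Lemma iter_lip (m : nat) : exists2 C : R, 1 <= C & forall a b x y z, level rho a b ->
  act (- (a *+ m)) x <= y -> y < z -> z <= act (a *+ m) x ->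
  forall i, (i <= `|b.1|)%N ->
  (iter i F z - iter i F y) * gap a x <= C * (z - y) * gap a (iter i F x).
Proof.
have [B B1 HB] := cross_iter FL rotF irr crF (2 * m + 2).
have [G G1 HG] := gap_near m.+2.
have G0 : 0 < G by lra.
have B0 : 0 < B by lra.
exists (B * (4 * G ^+ 4)).
  have G4 : 1 <= G ^+ 4 by rewrite exprn_ege1.
  by nra.
move=> a b x y z lab xy yz zx i ib.
have [/andP[b0 ba] _ _ abt _] := lab; have a0 : 0 < val a by lra.
have m0 : 0 <= m%:R :> R by [].
have nm (k : nat) : (k <= m.+2)%N -> `|val (a *+ k)| <= m.+2%:R * val a.
  move=> km; rewrite rvalMn ger0_norm; last by rewrite mulrn_wge0 // ltW.
  by rewrite mulr_natl ler_pMn2l.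
have n3 : `|val (- (a *+ m))| <= m.+2%:R * val a by rewrite rvalN normrN nm // (leq_trans (leqnSn _) (leqnSn _)).
have zu : z < act (a *+ m.+1) x.
  apply: le_lt_trans zx _; apply: (act_rval FL rotF).
  by rewrite !rvalMn ltr_pMn2l.
have uv : act (a *+ m.+1) x < act (a *+ m.+2) x.
  by apply: (act_rval FL rotF); rewrite !rvalMn ltr_pMn2l.
have := HB a b (act (- (a *+ m)) x) lab y z _ _ xy yz zu uv _ i ib.
have -> : act (a *+ (2 * m + 2)) (act (- (a *+ m)) x) = act (a *+ m.+2) x.
  rewrite -(actD FL); congr (act _ x).
  have -> : (2 * m + 2 = m + m.+2)%N by rewrite mul2n -addnn -addnA addn2.
  by rewrite mulrnDr addrC addKr.
move=> /(_ (lexx _)); rewrite -!(act_iter FL); set x' := iter i F x => crs.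
have iz := iterF_le FL i; have iz' := iterF_lt FL i.
have h1 : act (- (a *+ m)) x' <= iter i F y by rewrite (act_iter FL) iz.
have h2 : iter i F y < iter i F z by rewrite iz'.
have h3 : iter i F z < act (a *+ m.+1) x' by rewrite (act_iter FL) iz'.
have h4 : act (a *+ m.+1) x' < act (a *+ m.+2) x'.
  by apply: (act_rval FL rotF); rewrite !rvalMn ltr_pMn2l.
have gx' := gap_gt0 rotF x' a0; have gx := gap_gt0 rotF x a0.
have [_ _ l3] := HG a b x' _ lab n3.
have [_ g5 _] := HG a b x' (a *+ m.+1) lab (nm _ (leqnSn _)).
have [_ _ l5] := HG a b x' (a *+ m.+2) lab (nm _ (leqnn _)).
rewrite ler_norml in l3; case/andP: l3 => l3 _.
rewrite ler_norml in l5; case/andP: l5 => _ l5.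
rewrite {2}/lift_gap -(actD FL) -mulrS in g5.
have [_ g6 _] := HG a b x (a *+ m) lab (nm _ (leq_trans (leqnSn _) (leqnSn _))).
rewrite {2}/lift_gap -(actD FL) -mulrS in g6.
have lo : (iter i F z - iter i F y) / (2 * G * gap a x') * (2 * G ^+ 2)^-1 <=
   cross (iter i F y) (iter i F z) (act (a *+ m.+1) x') (act (a *+ m.+2) x').
  apply: cross_geM => //.
  - by rewrite ltW // divr_gt0 ?subr_gt0 // !mulr_gt0 ?ltr0n.
  - by rewrite invr_ge0 mulr_ge0 ?sqr_ge0.
  - rewrite mulrAC ler_pdivrMr; last by rewrite !mulr_gt0 ?ltr0n.
    by apply: ler_wpM2l; [rewrite subr_ge0 ltW|lra using h1 h4 l3 l5].
  - rewrite mulrC ler_pdivrMr; last by rewrite mulr_gt0 ?exprn_gt0 ?ltr0n //; lra.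
    by rewrite expr2; nra.
have hi : cross y z (act (a *+ m.+1) x) (act (a *+ m.+2) x) <= G * (z - y) / gap a x.
  apply: le_trans (cross_lel yz zu uv) _.
  rewrite ler_pdivrMr; last by lra using yz zu.
  rewrite mulrAC ler_pdivlMr //.
  have : gap a x <= G * (act (a *+ m.+1) x - y) by nra.
  by nra.
have tot : (iter i F z - iter i F y) / (2 * G * gap a x') * (2 * G ^+ 2)^-1 <=
    B * (G * (z - y) / gap a x).
  by apply: le_trans lo (le_trans crs _); rewrite ler_wpM2l //; lra using B1.
have := ler_wpM2r (_ : 0 <= 4 * G ^+ 3 * gap a x' * gap a x) tot.
have -> : (iter i F z - iter i F y) / (2 * G * gap a x') * (2 * G ^+ 2)^-1 *
    (4 * G ^+ 3 * gap a x' * gap a x) = (iter i F z - iter i F y) * gap a x.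
  by field; lra using G1 gx'.
have -> : B * (G * (z - y) / gap a x) * (4 * G ^+ 3 * gap a x' * gap a x)
   = B * (4 * G ^+ 4) * (z - y) * gap a x' by field; lra using gx.
by apply; rewrite !mulr_ge0 ?exprn_ge0 ?ltW.
Qed.

End CriticalGeometry.

(** * Parabolic funnels *)

Ltac pos := repeat first
  [ assumption | exact: ltr01 | exact: ler01 | exact: ltr0n | exact: ler0n
  | by apply: ltW | exact: sqr_ge0
  | apply: exprn_gt0 | apply: exprn_ge0
  | apply: divr_gt0 | apply: divr_ge0
  | apply: mulr_gt0 | apply: mulr_ge0 | apply: addr_gt0 | apply: addr_ge0
  | rewrite invr_gt0 | rewrite invr_ge0 ].

Section Funnel.
Variables (R : realType) (A : R).
Implicit Types (f : R -> R) (s t p x y z D : R).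

(** Models a return map between two consecutive critical points, at scale [D]: the ends move by a
    definite part of [D], [p] is the slowest point, and displacements within one step are
    comparable. The last clause stands for negative Schwarzian derivative together with derivative 1
    at [p]: the difference of reciprocals would then be nonincreasing, and constant for a Moebius
    map. The slack is half of the lower bound that [funnel_valley] finds at the end [t]. *)
Definition funnel D f s t p : Prop :=
  [/\ {homo f : x y / x < y},
      [/\ s <= p <= t, t - s <= A * D, D <= A * (f s - s) & D <= A * (f t - t)],
      forall y, s <= y <= t -> 0 < f y - y <= A * D /\ f p - p <= f y - y,
      forall y z, s <= y -> z <= t -> y <= z <= f y ->
        f z - z <= A * (f y - y) /\ f y - y <= A * (f z - z) &
      s < p < t -> forall x y, s <= x -> x < y -> y <= t -> x != p -> y != p ->
        (y - p)^-1 - (f y - f p)^-1 <= (x - p)^-1 - (f x - f p)^-1 + (8 * A ^+ 3 * D)^-1].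

Definition valley_lo : R := (8 * A ^+ 3)^-1 / (1 + (8 * A ^+ 3)^-1 * A).

Definition valley_hi : R := 2 * (2 * A ^+ 4) + 4 * A * (2 * A ^+ 4) ^+ 2.

Lemma valley_gt0 : 1 <= A -> 0 < valley_lo /\ 1 <= valley_hi.
Proof.
move=> A1; have A0 : 0 < A by lra.
have a4 : 1 <= A ^+ 4 by rewrite exprn_ege1.
split; last first.
  have : 0 <= 4 * A * (2 * A ^+ 4) ^+ 2 by rewrite !mulr_ge0 ?sqr_ge0; lra using A1.
  by rewrite /valley_hi; lra.
have k0 : 0 < (8 * A ^+ 3)^-1 by rewrite invr_gt0 mulr_gt0 ?exprn_gt0 ?ltr0n.
by rewrite divr_gt0 // addr_gt0 // mulr_gt0.
Qed.

(** The difference of reciprocals at y equals v / ((y - p) (f y - f p)), where v is the excess of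
    the displacement over its minimum. It is at most [A ^+ 4] at [s] and at least twice the slack at
    [t], so near-monotonicity keeps it between positive constants throughout, and v is comparable to
    (y - p)^2. *)
Lemma funnel_valley f s t p : 1 <= A -> funnel 1 f s t p ->
  f p - p < (4 * A ^+ 2)^-1 -> forall y, s <= y -> y <= t ->
  valley_lo * (y - p) ^+ 2 <= (f y - y) - (f p - p) <= valley_hi * (y - p) ^+ 2.
Proof.
move=> A1; have A0 : 0 < A by lra.
set h := (4 * _)^-1; set c1 := valley_lo; set c2 := valley_hi.
pose k1 : R := (8 * A ^+ 3)^-1; pose k2 : R := 2 * A ^+ 4.
have c1E : c1 = k1 / (1 + k1 * A) by [].
have c2E : c2 = 2 * k2 + 4 * A * k2 ^+ 2 by [].
have k1_gt0 : 0 < k1 by rewrite invr_gt0 mulr_gt0 ?exprn_gt0 ?ltr0n.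
have k2_ge1 : 1 <= k2 by have : 1 <= A ^+ 4 by [rewrite exprn_ege1]; rewrite /k2; lra.
have k2_ge0 : 0 <= k2 by lra.
have c1_gt0 : 0 < c1 by rewrite c1E divr_gt0 // addr_gt0 // mulr_gt0.
clearbody c1 c2; move=> [fi [/andP[sp pt] ts us ut] u0 slow K] ph.
have h2 : A * h <= (4 * A)^-1 /\ A * h * A = 1 / 4 /\ h <= 1 / 4.
  have A2 : 1 <= A ^+ 2 by rewrite exprn_ege1.
  have E : A * h * A = 1 / 4 by rewrite /h; field; lra using A1.
  split; last split => //.
    by rewrite /h le_eqVlt; apply/orP; left; apply/eqP; field; lra using A1.
  by rewrite /h invf_ple ?posrE ?invr_gt0; lra using A2.
case: h2 => h2 [h3 h4].
have U y : s <= y -> y <= t -> [/\ 0 < f y - y, f y - y <= A & f p - p <= f y - y].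
  move=> sy yt; have /u0 : s <= y <= t by rewrite sy yt.
  by rewrite mulr1 => -[/andP[]].
have [up _ _] := U p sp pt.
have sp' : f s <= p.
  rewrite leNgt; apply/negP => ps.
  have [] := slow s p (lexx _) pt; first by rewrite sp ltW.
  by move=> _ h5; nra using A1 h3 h5 ph us.
have pt' : f p <= t.
  rewrite leNgt; apply/negP => ps.
  have [] := slow p t sp (lexx _); first by rewrite pt ltW.
  by move=> h5 _; nra using A1 h3 h5 ph ut.
have {}sp : s < p by nra using A1 sp' us.
have {}pt : p < t by nra using pt' up.
have st : s <= t by lra using pt' sp up.
have Ks : (s - p)^-1 - (f s - f p)^-1 <= A ^+ 4.
  have fsp : f s < f p by exact: fi.
  have -> : (s - p)^-1 - (f s - f p)^-1 =
     ((f s - s) - (f p - p)) / ((p - s) * (f p - f s)) by field; lra using sp sp' up.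
  have [us0 us' _] := U s (lexx _) st.
  have [|_ h6] := slow s (f s) (lexx _) (le_trans sp' (ltW pt)).
    by rewrite lexx andbT; lra using us0.
  have ffs : f (f s) <= f p by move: sp'; rewrite le_eqVlt => /predU1P[->//|/fi/ltW].
  rewrite ler_pdivrMr; last by rewrite mulr_gt0 ?subr_gt0.
  have a1 : 1 <= A * (p - s) by nra using A1 sp' us.
  have a2 : 1 <= A ^+ 2 * (f p - f s).
    have : f s - s <= A * (f p - f s) by nra using A1 ffs h6.
    by rewrite expr2; nra using A1 us.
  have a3 : 1 <= A * (p - s) * (A ^+ 2 * (f p - f s)).
    by rewrite -[leLHS]mulr1 ler_pM.
  have -> : A ^+ 4 * ((p - s) * (f p - f s)) =
     A * (A * (p - s) * (A ^+ 2 * (f p - f s))) by ring.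
  by nra using A1 a3 pt' sp' ts up.
have Kt : 2 * k1 <= (t - p)^-1 - (f t - f p)^-1.
  have fpt : f p < f t by exact: fi.
  have -> : (t - p)^-1 - (f t - f p)^-1 =
     ((f t - t) - (f p - p)) / ((t - p) * (f t - f p)) by field; lra using fpt pt' up.
  have [_ ut' _] := U t st (lexx _).
  rewrite ler_pdivlMr; last by rewrite mulr_gt0 ?subr_gt0.
  have b1 : f t - f p <= 2 * A by lra using sp ts up ut'.
  have b2 : (t - p) * (f t - f p) <= A * (2 * A).
    by apply: ler_pM; lra using fpt pt' sp ts up ut'.
  have b3 : 2 * k1 * ((t - p) * (f t - f p)) <= 2 * k1 * (A * (2 * A)).
    by apply: ler_wpM2l => //; lra using k1_gt0.
  have b4 : 2 * k1 * (A * (2 * A)) = 1 / (2 * A) by rewrite /k1; field; lra using A1.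
  have b5 : 1 / (2 * A) * A = 1 / 2 by field; lra using A1.
  by nra using A1 b3 b4 b5 h2 ph ut.
have k1A : (8 * A ^+ 3 * 1)^-1 = k1 by rewrite mulr1.
have KK := K; rewrite sp pt k1A in KK.
have kA : k1 <= A ^+ 4.
  have : 1 <= A ^+ 4 by rewrite exprn_ege1.
  have : 1 <= A ^+ 3 by rewrite exprn_ege1.
  move=> a3 a4; apply: le_trans a4; rewrite /k1 invf_ple ?posrE; lra using a3.
have Kb y : s <= y -> y <= t -> y != p ->
    k1 <= (y - p)^-1 - (f y - f p)^-1 <= k2.
  move=> sy yt yp; apply/andP; split.
    move: yt; rewrite le_eqVlt => /predU1P[->|yt]; first lra using Kt k1_gt0.
    by have := KK isT y t sy yt (lexx _) yp; rewrite gt_eqF // => /(_ isT); lra using Kt.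
  move: sy; rewrite le_eqVlt => /predU1P[<-|sy]; first by rewrite /k2; lra using Ks k1_gt0 kA.
  have := KK isT s y (lexx _) sy yt; rewrite lt_eqF // => /(_ isT yp).
  by rewrite /k2; lra using Ks kA.
move=> y sy yt; have [->|yp] := eqVneq y p.
  by rewrite !subrr expr0n /= !mulr0 lexx.
have [uy0 uyA upy] := U y sy yt.
have /andP[ka kb] := Kb y sy yt yp.
set v := f y - y - (f p - p).
have v0 : 0 <= v by rewrite /v; lra using upy.
have [py|] := ltP p y.
  have fpy : f p < f y by exact: fi.
  set r := y - p; have r0 : 0 < r by rewrite /r; lra using py.
  have frv : f y - f p = r + v by rewrite /r /v; ring.
  set k := _ - _ in ka kb.
  have vE : v = k * (r * (r + v)).
    by rewrite /k -/r frv; field; rewrite -frv; lra using py r0 upy.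
  have k0 : 0 < k by lra using k1_gt0 ka.
  apply/andP; split.
    have : c1 <= k1.
      have q : 0 < k1 * A by rewrite mulr_gt0.
      have q' : 0 < 1 + k1 * A by lra using q.
      by rewrite c1E ler_pdivrMr // ler_peMr ?ltW //; lra using q.
    move=> ck; have h5 : k * (r * r) <= v.
      rewrite vE; apply: ler_wpM2l; first exact: ltW.
      by apply: ler_wpM2l; [exact: ltW|lra using v0].
    have h6 : c1 * (r * r) <= k * (r * r).
      by apply: ler_wpM2r; [rewrite mulr_ge0 ?ltW|lra using ck ka].
    by rewrite expr2; lra using h5 h6.
  (* Here v = k r (r + v). If k r is small, the term in v is absorbed and [2 * k2] suffices;
     otherwise r is bounded below and v <= A gives [4 * A * k2 ^+ 2]. These are the two terms of
     [valley_hi]. *)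
  have [kr|kr] := leP (k * r) (1 / 2).
    have : v <= 2 * k * r ^+ 2 by rewrite expr2; nra using kr v0 vE.
    have : 2 * k * r ^+ 2 <= 2 * k2 * r ^+ 2 by rewrite ler_wpM2r ?sqr_ge0 //; lra using kb.
    have : 0 <= 4 * A * k2 ^+ 2 * r ^+ 2 by pos.
    by rewrite c2E; lra.
  have kr2 : 1 / 4 <= k2 ^+ 2 * r ^+ 2.
    rewrite -exprMn; have : 1 / 2 < k2 * r by nra using kb kr r0.
    by rewrite expr2; nra.
  have : 0 <= k2 * r ^+ 2 by pos.
  have : v <= A by rewrite /v; lra using up uyA.
  by rewrite c2E; nra using A1 kr2.
rewrite le_eqVlt (negbTE yp) /= => py.
have fpy : f y < f p by exact: fi.
set r := p - y; have r0 : 0 < r by rewrite /r; lra using py.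
have -> : (y - p) ^+ 2 = r ^+ 2 by rewrite /r; ring.
have frv : f p - f y = r - v by rewrite /r /v; ring.
set k := _ - _ in ka kb.
have vE : v = k * (r * (r - v)).
  rewrite /k -[y - p]opprB -/r -[f y - f p]opprB frv; field; rewrite -frv; lra using fpy r0.
have rv : 0 < r - v by rewrite -frv; lra using fpy.
have rA : r <= A by rewrite /r; lra using pt' sy ts up.
apply/andP; split.
  (* To the left of [p], v = k r (r - v). Moving the term in v across produces the factor 1 + k1 r,
     at most 1 + k1 A, the denominator of [valley_lo]. *)
  rewrite c1E mulrAC ler_pdivrMr; last by rewrite addr_gt0 // mulr_gt0.
  have : k1 * (r * (r - v)) <= v.
    by rewrite [leRHS]vE ler_wpM2r // mulr_ge0 // ltW.
  rewrite expr2; have : v * (k1 * r) <= v * (k1 * A).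
    by apply: ler_wpM2l => //; apply: ler_wpM2l => //; exact: ltW.
  by nra.
have : v <= k2 * r ^+ 2.
  rewrite [leLHS]vE expr2; apply: ler_pM => //; [lra using k1_gt0 ka|by rewrite mulr_ge0 ?ltW|].
  by apply: ler_wpM2l; [exact: ltW|lra using v0].
have : 0 <= 4 * A * k2 ^+ 2 * r ^+ 2 by pos.
have : 0 <= k2 * r ^+ 2 by pos.
by rewrite c2E; lra.
Qed.

End Funnel.

(** * Counting the steps through a funnel *)

Section FunnelCount.
Variables (R : realType) (A : R).
Implicit Types (f u : R -> R) (s t p x y z D : R).

Lemma orbit_between f s x (k j : nat) : {homo f : x y / x < y} ->
  (forall y, s <= y -> y <= x -> y < f y) -> s <= x -> iter k f s <= x ->
  (j <= k)%N -> s <= iter j f s /\ iter j f s <= x.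
Proof.
move=> fi U sx ks jk.
have dn i : iter i.+1 f s <= x -> iter i f s <= x.
  move=> h; rewrite leNgt; apply/negP => /fi h2.
  by have := U x sx (lexx _); rewrite iterS in h; lra.
have le i : iter (j + i) f s <= x -> iter j f s <= x.
  by elim: i => [|i IH]; rewrite ?addn0 // addnS => /dn.
have jx : iter j f s <= x by apply: (le (k - j)%N); rewrite subnKC.
split => //; elim: j jx {jk le} => [//|j IH] h.
have h2 := IH (dn _ h); apply: (le_trans h2).
exact: ltW (U _ h2 (dn _ h)).
Qed.

Definition rad_lo : R := Num.min 1 (valley_lo A) / 2.

Definition rad_hi : R := 1 + valley_hi A.

Lemma rad_gt0 : 1 <= A -> 0 < rad_lo /\ 1 <= rad_hi.
Proof.
move=> A1; have [clo chi] := valley_gt0 A1.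
rewrite /rad_lo /rad_hi; split; last by lra.
by rewrite divr_gt0 // lt_min ltr01.
Qed.

(* In the valley [u] is comparable to the square of [|y - p| + sqrt (u p)]. *)
Lemma funnel_radius f s t p : 1 <= A -> funnel A 1 f s t p ->
  f p - p < (4 * A ^+ 2)^-1 -> exists r : R -> R,
  [/\ forall y, 0 < r y,
      forall y, s <= y -> y <= t -> rad_lo * r y ^+ 2 <= f y - y <= rad_hi * r y ^+ 2,
      forall y, s <= y -> y <= t -> r y <= A + 1,
      forall y z, `|r y - r z| <= `|y - z| &
      (forall y z, y <= z -> z <= p -> r y = r z + (z - y)) /\
      (forall y z, p <= y -> y <= z -> r z = r y + (z - y))].
Proof.
move=> A1 Ff ph; have A0 : 0 < A by lra.
have valley := funnel_valley A1 Ff ph.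
have [clo chi] := valley_gt0 A1.
have h1 : (4 * A ^+ 2)^-1 <= 1.
  have : 1 <= A ^+ 2 by rewrite exprn_ege1.
  by move=> a2; rewrite invf_ple ?posrE ?invr1; lra.
have [d0 ts sp pt] : [/\ 0 < f p - p, t - s <= A, s <= p & p <= t].
  have [_ [/andP[sp pt] ts _ _] u0 _ _] := Ff.
  have /u0[/andP[h _] _] : s <= p <= t by rewrite sp pt.
  by split => //; rewrite mulr1 in ts.
have ml : 2 * rad_lo <= 1 /\ 2 * rad_lo <= valley_lo A.
  by rewrite /rad_lo mulrC divfK ?pnatr_eq0 // !ge_min !lexx orbT.
have [m0 _] := rad_gt0 A1.
case: ml; move: m0 clo chi valley; rewrite /rad_hi.
move: (valley_lo A) (valley_hi A) rad_lo => c1 c2 m1 m0 clo chi valley m1a m1b.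
move: Ff => _; set d := f p - p in d0 ph valley.
pose e := Num.sqrt d; have e0 : 0 < e by rewrite sqrtr_gt0.
have ee : e ^+ 2 = d by rewrite sqr_sqrtr // ltW.
have e1 : e <= 1 by rewrite -sqrtr1 ler_wsqrtr //; lra.
clearbody e d; exists (fun y => `|y - p| + e); split.
- by move=> y; rewrite ltr_wpDl.
- move=> y sy yt; have /andP[v1 v2] := valley y sy yt.
  have aa : (y - p) ^+ 2 = `|y - p| ^+ 2 by rewrite real_normK ?num_real.
  rewrite aa in v1 v2; set a := `|y - p| in v1 v2 *.
  have a0 : 0 <= a := normr_ge0 _.
  clearbody a; clear aa valley.
  have q1 : 0 <= 2 * a * e by rewrite !mulr_ge0 // ltW.
  have q2 : (a + e) ^+ 2 = a ^+ 2 + 2 * a * e + d by rewrite -ee; ring.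
  have q3 : (a + e) ^+ 2 <= 2 * (a ^+ 2 + d) by rewrite -ee; have := sqr_ge0 (a - e); nra.
  apply/andP; split.
    have g1 : m1 * (a + e) ^+ 2 <= m1 * (2 * (a ^+ 2 + d)) by rewrite ler_pM2l.
    have g2 : 2 * m1 * a ^+ 2 <= c1 * a ^+ 2 by rewrite ler_wpM2r ?sqr_ge0.
    have g3 : 2 * m1 * d <= d by rewrite ger_pMl //; lra.
    by lra using g1 g2 g3 v1.
  have g1 : (1 + c2) * (a ^+ 2 + d) <= (1 + c2) * (a + e) ^+ 2.
    by apply: ler_wpM2l; lra using chi ee q1.
  have g2 : 0 <= c2 * d by rewrite mulr_ge0; lra using A1 chi d0.
  have g3 : 0 <= a ^+ 2 by rewrite sqr_ge0.
  by lra using g1 g2 g3 v2.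
- move=> y sy yt; suff : `|y - p| <= A by lra.
  by rewrite ler_norml; apply/andP; split; lra using pt sp sy ts yt.
- move=> y z; have -> : `|y - p| + e - (`|z - p| + e) = `|y - p| - `|z - p| by ring.
  by apply: le_trans (ler_dist_dist _ _) _; rewrite (_ : y - p - (z - p) = y - z) //; ring.
- by split=> y z h2 h3; [rewrite !ler0_norm|rewrite !ger0_norm]; lra using h2 h3.
Qed.

(** Displacements are of order r^2 and the radius changes by no more than the displacement. So a
    step changes r by at most [M * (ry * rz)], and its inverse by at most [M]: the inverse radius
    bounds numbers of steps from below. *)
Lemma radius_step (m2 M ry rz uy uz : R) :
  1 <= A -> 1 <= m2 -> M = A * m2 -> 0 < ry -> 0 < rz ->
  0 <= uy -> uy <= m2 * ry ^+ 2 -> uz <= m2 * rz ^+ 2 -> uy <= A * uz ->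
  `|ry - rz| <= uy ->
  ry^-1 <= rz^-1 + M /\ rz^-1 <= ry^-1 + M.
Proof.
move=> A1 m21 ME ry0 rz0 u0 b1 b2 h2 dist.
have A0 : 0 < A by lra.
have m20 : 0 < m2 by lra.
have uM : uy <= M * (ry * rz).
  have P0 : 0 <= M * (ry * rz) by rewrite ME; pos.
  rewrite -ler_sqr ?nnegrE // expr2.
  have -> : (M * (ry * rz)) ^+ 2 = (A * m2 * ry ^+ 2) * (A * (m2 * rz ^+ 2)).
    by rewrite ME; ring.
  apply: ler_pM => //.
    by apply: le_trans b1 _; rewrite -mulrA ler_peMl //; pos.
  by apply: le_trans h2 _; rewrite ler_pM2l.
move: dist; rewrite ler_norml => /andP[n1 n2].
have E1 : rz^-1 - ry^-1 = (ry - rz) / (ry * rz) by field; lra.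
have P1 : 0 < ry * rz by rewrite mulr_gt0.
have B1 : (ry - rz) / (ry * rz) <= M by rewrite ler_pdivrMr //; lra.
have B2 : - M <= (ry - rz) / (ry * rz) by rewrite ler_pdivlMr //; lra.
by split; lra using B1 B2 E1.
Qed.

Lemma radius_end (m2 M ry uy : R) : 1 <= A -> 1 <= m2 -> M = A * m2 -> 0 < ry ->
  uy <= m2 * ry ^+ 2 -> 1 <= A * uy -> ry^-1 <= M.
Proof.
move=> A1 m21 ME ry0 b1 ay.
have A0 : 0 < A by lra.
have M1 : 1 <= M by rewrite ME; nra.
have q1 : 1 <= M * ry ^+ 2.
  by apply: le_trans ay _; rewrite ME -mulrA ler_pM2l.
have q2 : 1 <= (M * ry) ^+ 2.
  by rewrite exprMn expr2 -mulrA -[leLHS]mul1r; apply: ler_pM.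
have P0 : 0 <= M * ry by rewrite mulr_ge0 // ltW //; lra.
have q3 : 1 <= M * ry by rewrite -(@ler_sqr _ 1) ?nnegrE ?expr1n.
by rewrite -[leLHS]mul1r ler_pdivrMr.
Qed.

Lemma radius_lower (m1 M r0 u C : R) (n : nat) :
  0 < r0 -> 0 < m1 -> 0 < M -> m1 * r0 ^+ 2 <= u -> 4 * M ^+ 2 / m1 <= C ->
  r0^-1 <= (n%:R + 2) * M -> 1 <= C * (u * (1 + n%:R) ^+ 2).
Proof.
move=> rx m10 M0 b1 hC h2; have n0 : 0 <= n%:R :> R by [].
have C0 : 0 <= C by apply: le_trans hC; pos.
have h3 : 1 <= 2 * M * ((1 + n%:R) * r0).
  have h4 : r0^-1 * r0 <= (n%:R + 2) * M * r0 by rewrite ler_pM2r.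
  rewrite mulVf ?gt_eqF // in h4; apply: le_trans h4 _.
  have -> : 2 * M * ((1 + n%:R) * r0) = 2 * (1 + n%:R) * (M * r0) by ring.
  by rewrite -mulrA; apply: ler_wpM2r; [pos|lra].
have h4 : 1 <= (2 * M * ((1 + n%:R) * r0)) ^+ 2 by rewrite exprn_ege1.
have h5 : 4 * M ^+ 2 <= C * m1 by rewrite -ler_pdivrMr.
apply: le_trans h4 _.
have -> : (2 * M * ((1 + n%:R) * r0)) ^+ 2 =
   4 * M ^+ 2 * ((1 + n%:R) ^+ 2 * r0 ^+ 2) by ring.
apply: (@le_trans _ _ (C * m1 * ((1 + n%:R) ^+ 2 * r0 ^+ 2))).
  by rewrite ler_wpM2r // mulr_ge0 ?sqr_ge0.
have -> : C * m1 * ((1 + n%:R) ^+ 2 * r0 ^+ 2) =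
   C * ((m1 * r0 ^+ 2) * (1 + n%:R) ^+ 2) by ring.
by apply: ler_wpM2l => //; rewrite ler_wpM2r ?sqr_ge0.
Qed.

(** A discrete form of the equations r' = -r^2 before [p] and r' = r^2 after it. Before [p] each
    step lowers r by at least [m1 * r ^+ 2], so j steps from [s] leave r at most 1 / (j m1). After
    [p] each step towards [t] lowers the positive quantity 1/r by at least [m3]. Each side controls
    one of the counts [k], [l] only, hence the minimum. *)
Lemma radius_upper (m1 : R) (r : R -> R) f s t p x (k l : nat) :
  1 <= A -> 0 < m1 -> (forall y, 0 < r y) ->
  (forall y, s <= y -> y <= t -> m1 * r y ^+ 2 <= f y - y) ->
  (forall y, s <= y -> y <= t -> r y <= A + 1) ->
  (forall y z, y <= z -> z <= p -> r y = r z + (z - y)) ->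
  (forall y z, p <= y -> y <= z -> r z = r y + (z - y)) ->
  s <= x -> x <= t ->
  (forall j, (j <= k)%N -> s <= iter j f s /\ iter j f s <= x) ->
  (forall j, (j <= l)%N -> x <= iter j f x /\ iter j f x <= t) ->
  (1 + (minn k l)%:R) * r x <= A + 1 + (1 + m1 * (A + 1)) / m1.
Proof.
move=> A1 m10 r0 rb rA rL rR sx xt orbs orbt; have A0 : 0 < A by lra.
set m := minn k l.
have m0 : 0 <= m%:R :> R by [].
have mk : m%:R <= k%:R :> R by rewrite ler_nat geq_minl.
have ml : m%:R <= l%:R :> R by rewrite ler_nat geq_minr.
have rx := r0 x; have rxA := rA x sx xt.
have mA0 : 0 < 1 + m1 * (A + 1) by pos.
have [xp|px] := leP x p.
  have lk j : (j <= k)%N -> j%:R * m1 * r (iter j f s) <= 1.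
    elim: j => [_|j IH jk]; first by rewrite !mul0r.
    have [i1 i2] := orbs j (ltnW jk); have [i3 i4] := orbs _ jk.
    have b1 := rb _ i1 (le_trans i2 xt).
    have w0 := r0 (iter j f s); have w'0 := r0 (iter j.+1 f s).
    have jw := IH (ltnW jk).
    have u0 : iter j f s <= iter j.+1 f s.
      by rewrite iterS -subr_ge0; apply: le_trans b1; pos.
    have := rL _ _ u0 (le_trans i4 xp); rewrite -natr1.
    move: b1 w0 w'0 jw; rewrite iterS; move: (r (iter j f s)) (r (f _)) => w w' b1 w0 w'0 jw wE.
    have j0 : 0 <= j%:R :> R by [].
    clear -b1 w0 w'0 jw wE j0 m10.
    apply: (@le_trans _ _ ((j%:R + 1) * m1 * (w - m1 * w ^+ 2))).
      by apply: ler_wpM2l; [pos|lra].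
    have mw : 0 < 1 - m1 * w by rewrite expr2 in b1; nra.
    have -> : (j%:R + 1) * m1 * (w - m1 * w ^+ 2) = (j%:R * m1 * w + m1 * w) * (1 - m1 * w) by ring.
    have mw0 : 0 < m1 * w by rewrite mulr_gt0.
    by nra.
  have [i1 i2] := orbs k (leqnn _).
  have rxk : r x <= r (iter k f s) by have := rL _ _ i2 xp; lra.
  have h2 : m%:R * m1 * r x <= 1.
    apply: le_trans (lk k (leqnn _)).
    by apply: ler_pM; [pos|pos|rewrite ler_pM2r|].
  have h3 : m%:R * r x <= m1^-1 by rewrite -[leRHS]mul1r ler_pdivlMr // mulrAC.
  have h4 : m1^-1 <= (1 + m1 * (A + 1)) / m1.
    by rewrite -[leLHS]mul1r ler_pM2r ?invr_gt0 // lerDl; pos.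
  by rewrite mulrDl mul1r; lra.
pose m3 : R := m1 / (1 + m1 * (A + 1)).
have m30 : 0 < m3 by rewrite divr_gt0.
have lk j : (j <= l)%N -> (r (iter j f x))^-1 + j%:R * m3 <= (r x)^-1.
  elim: j => [_|j IH jl]; first by rewrite mul0r addr0.
  have [i1 i2] := orbt j (ltnW jl); have [i3 i4] := orbt _ jl.
  have b1 := rb _ (le_trans sx i1) i2.
  have wA := rA _ (le_trans sx i1) i2.
  have w0 := r0 (iter j f x); have w'0 := r0 (iter j.+1 f x).
  have jw := IH (ltnW jl).
  have u0 : iter j f x <= iter j.+1 f x.
    by rewrite iterS -subr_ge0; apply: le_trans b1; pos.
  have := rR _ _ (le_trans (ltW px) i1) u0; rewrite -natr1.
  move: b1 w0 w'0 jw wA; rewrite iterS.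
  move: (r (iter j f x)) (r (f _)) (f _ - _) => w w' u b1 w0 w'0 jw wA wE.
  have u1 : 0 <= u by apply: le_trans b1; pos.
  clear -b1 u1 w0 w'0 jw wA wE m10 mA0 m30 A0.
  suff : w'^-1 + m3 <= w^-1 by lra.
  have -> : w^-1 = w'^-1 + u / (w * w') by rewrite wE in w'0 *; field; lra.
  rewrite lerD2l ler_pdivlMr ?mulr_gt0 // /m3 mulrAC ler_pdivrMr // wE.
  have : m1 * w * u <= m1 * (A + 1) * u.
    by apply: ler_wpM2r => //; rewrite ler_pM2l.
  by rewrite expr2 in b1; lra.
have [i1 i2] := orbt l (leqnn _).
have h2 : l%:R * m3 <= (r x)^-1.
  by have := lk l (leqnn _); have : 0 < (r (iter l f x))^-1 by [rewrite invr_gt0]; lra.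
have h3 : m%:R * r x <= m3^-1.
  rewrite -[leRHS]mul1r ler_pdivlMr //.
  have h4 : l%:R * m3 * r x <= 1.
    by rewrite -ler_pdivlMr // mul1r.
  by rewrite mulrAC; apply: le_trans h4; rewrite ler_pM2r // ler_pM2r.
have E3 : (1 + m1 * (A + 1)) / m1 = m3^-1 by rewrite /m3 invf_div.
by rewrite E3 mulrDl mul1r; lra.
Qed.

Lemma funnel_count1 : 1 <= A -> exists2 C : R, 1 <= C & forall f s t p x (k l : nat),
  funnel A 1 f s t p -> s <= x -> x <= t ->
  iter k f s <= x -> x < iter k.+1 f s -> iter l f x <= t -> t < iter l.+1 f x ->
  1 <= C * ((f x - x) * (1 + (minn k l)%:R) ^+ 2) /\
  (f x - x) * (1 + (minn k l)%:R) ^+ 2 <= C.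
Proof.
move=> A1; have A0 : 0 < A by lra.
have [m10 m21] := rad_gt0 A1.
have m20 : 0 < rad_hi by lra.
pose M : R := A * rad_hi; have M0 : 0 < M by rewrite mulr_gt0.
pose h : R := (4 * A ^+ 2)^-1.
have h0 : 0 < h by rewrite invr_gt0 mulr_gt0 ?exprn_gt0 ?ltr0n.
pose Q : R := 1 + A / h.
pose T : R := (A + 1 + (1 + rad_lo * (A + 1)) / rad_lo).
pose C : R := h^-1 + A * Q ^+ 2 + rad_hi * T ^+ 2 + 4 * M ^+ 2 / rad_lo + 1.
have e1 : 0 <= h^-1 by rewrite invr_ge0 ltW.
have e2 : 0 <= A * Q ^+ 2 by pos.
have e3 : 0 <= rad_hi * T ^+ 2 by pos.
have e4 : 0 <= 4 * M ^+ 2 / rad_lo by pos.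
have [C1 C2 C3 C4] : [/\ h^-1 <= C, A * Q ^+ 2 <= C, rad_hi * T ^+ 2 <= C &
    4 * M ^+ 2 / rad_lo <= C] by rewrite /C; split; lra using e1 e2 e3 e4.
exists C; first by rewrite /C; lra.
move=> f s t p x k l Ff sx xt ks kx lx tl; set m := minn k l.
clearbody C; clear e1 e2 e3 e4.
have [fi [/andP[sp pt] ts us ut] u0 slow _] := Ff.
rewrite mulr1 in ts.
have st : s <= t by lra using sx xt.
have U y : s <= y -> y <= t -> [/\ 0 < f y - y, f y - y <= A & f p - p <= f y - y].
  move=> sy yt; have /u0 : s <= y <= t by rewrite sy yt.
  by rewrite mulr1 => -[/andP[]].
clear u0; have [ux0 uxA uxp] := U x sx xt.
have orbs j (jk : (j <= k)%N) : s <= iter j f s /\ iter j f s <= x.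
  apply: orbit_between fi _ sx ks jk => y sy yx.
  by have [] := U y sy (le_trans yx xt); rewrite subr_gt0.
have orbt j (jl : (j <= l)%N) : x <= iter j f x /\ iter j f x <= t.
  apply: orbit_between fi _ xt lx jl => y sy yx.
  by have [] := U y (le_trans sx sy) yx; rewrite subr_gt0.
(* Without a narrow passage every step has length at least [h], so [k] is bounded and all
   displacements are of order one. *)
have [ph|ph] := leP h (f p - p).
  have m0 : 0 <= m%:R :> R by [].
  have mk : m%:R <= k%:R :> R by rewrite ler_nat geq_minl.
  have kQ : 1 + k%:R <= Q.
    have kk j : (j <= k)%N -> j%:R * h <= iter j f s - s.
      elim: j => [_|j IH jk]; first by rewrite mul0r subrr.
      have [i1 i2] := orbs j (ltnW jk).
      have [_ _ i3] := U _ i1 (le_trans i2 xt).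
      by have := IH (ltnW jk); rewrite -natr1 iterS; lra using i3 ph.
    have kA : k%:R * h <= A by have := kk k (leqnn _); lra using ks ts xt.
    by rewrite /Q lerD2l ler_pdivlMr.
  have mQ : (1 + m%:R) ^+ 2 <= Q ^+ 2 :> R by rewrite ler_sqr ?nnegrE; lra using kQ m0 mk.
  have m1' : 1 <= (1 + m%:R) ^+ 2 :> R by rewrite exprn_ege1 // lerDl.
  have hC : 1 <= C * h by rewrite -ler_pdivrMr // mul1r.
  have C0 : 0 <= C by apply: le_trans C1; rewrite invr_ge0 ltW.
  split; last exact: le_trans (ler_pM (ltW ux0) (sqr_ge0 _) uxA mQ) C2.
  apply: le_trans hC _; apply: ler_wpM2l => //.
  by rewrite -[leLHS]mulr1; apply: ler_pM; lra using h0 m1' ph uxp.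
have [r [r0 rb rA rl [rL rR]]] := funnel_radius A1 Ff ph.
have up := radius_upper A1 m10 r0 _ rA rL rR sx xt orbs orbt.
have {}up : (1 + m%:R) * r x <= T.
  by apply: up => y sy yt; have /andP[] := rb y sy yt.
have /andP[bx1 bx2] := rb x sx xt.
split; last first.
  have rx := r0 x.
  apply: le_trans C3; apply: (@le_trans _ _ (rad_hi * ((1 + m%:R) * r x) ^+ 2)).
    have -> : rad_hi * ((1 + m%:R) * r x) ^+ 2 = rad_hi * r x ^+ 2 * (1 + m%:R) ^+ 2 by ring.
    by rewrite ler_wpM2r ?sqr_ge0.
  have P0 : 0 <= (1 + m%:R) * r x by pos.
  by rewrite ler_pM2l // ler_sqr ?nnegrE // (le_trans P0).
have link y z : s <= y -> z <= t -> y <= z -> z <= f y ->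
    (r y)^-1 <= (r z)^-1 + M /\ (r z)^-1 <= (r y)^-1 + M.
  move=> sy zt yz zf.
  have [_ h2] := slow y z sy zt (introT andP (conj yz zf)).
  have /andP[_ b1] := rb y sy (le_trans yz zt).
  have /andP[_ b2] := rb z (le_trans sy yz) zt.
  have [u0 _ _] := U y sy (le_trans yz zt).
  apply: radius_step A1 m21 erefl (r0 y) (r0 z) (ltW u0) b1 b2 h2 _.
  by apply: le_trans (rl y z) _; rewrite ler0_norm; lra using orbs uxp yz zf.
have rend y : s <= y -> y <= t -> 1 <= A * (f y - y) -> (r y)^-1 <= M.
  move=> sy yt; have /andP[_ b1] := rb y sy yt.
  exact: radius_end A1 m21 erefl (r0 y) b1.
have low := radius_lower (r0 x) m10 M0 bx1 C4.
clear bx1 bx2 C1 C2 C3 C4 up ph.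
(* Besides the [k] full steps, one [M] bounds the inverse radius at the end and one pays for the
   incomplete step to [x]. *)
have lowk : (r x)^-1 <= (k%:R + 2) * M.
  have lk j : (j <= k)%N -> (r (iter j f s))^-1 <= (j%:R + 1) * M.
    elim: j => [_|j IH jk]; first by rewrite add0r mul1r rend.
    have [i1 i2] := orbs j (ltnW jk); have [i3 i4] := orbs _ jk.
    have [i5 _ _] := U _ i1 (le_trans i2 xt).
    have [||_ h2] := link (iter j f s) (iter j.+1 f s) i1 (le_trans i4 xt).
    - by rewrite iterS; lra using i5.
    - by rewrite iterS.
    by have := IH (ltnW jk); rewrite -natr1; lra using h2.
  have [i1 i2] := orbs k (leqnn _).
  have [|_ h2] := link (iter k f s) x i1 xt i2; first by rewrite iterS in kx; exact: ltW.
  by have := lk k (leqnn _); lra using h2.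
have lowl : (r x)^-1 <= (l%:R + 2) * M.
  have lk j : (j <= l)%N -> (r x)^-1 <= (r (iter j f x))^-1 + j%:R * M.
    elim: j => [_|j IH jl]; first by rewrite mul0r addr0.
    have [i1 i2] := orbt j (ltnW jl); have [i3 i4] := orbt _ jl.
    have [i5 _ _] := U _ (le_trans sx i1) i2.
    have [||h2 _] := link (iter j f x) (iter j.+1 f x) (le_trans sx i1) i4.
    - by rewrite iterS; lra using i5.
    - by rewrite iterS.
    by have := IH (ltnW jl); rewrite -natr1; lra using h2.
  have [i1 i2] := orbt l (leqnn _).
  have [|h2 _] := link (iter l f x) t (le_trans sx i1) (lexx _) i2; first by rewrite iterS in tl; exact: ltW.
  by have := lk l (leqnn _); have := rend t st (lexx _) ut; lra using h2.
by rewrite /m; case: (leqP k l) => _; exact: low.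
Qed.

Lemma funnel_count : 1 <= A -> exists2 C : R, 1 <= C & forall D f s t p x (k l : nat),
  0 < D -> funnel A D f s t p -> s <= x -> x <= t ->
  iter k f s <= x -> x < iter k.+1 f s -> iter l f x <= t -> t < iter l.+1 f x ->
  D <= C * ((f x - x) * (1 + (minn k l)%:R) ^+ 2) /\
  (f x - x) * (1 + (minn k l)%:R) ^+ 2 <= C * D.
Proof.
move=> /funnel_count1[C C1 H]; exists C => // D f s t p x k l D0 Ff sx xt ks kx lx tl.
pose g y := f (D * y) / D.
have gE y : g (y / D) = f y / D by rewrite /g mulrCA divff ?mulr1 // gt_eqF.
have gi i y : iter i g (y / D) = iter i f y / D.
  by elim: i => //= i ->; rewrite gE.
have Di : 0 < D^-1 by rewrite invr_gt0.
have gu y : g y - y = (f (D * y) - D * y) / D by rewrite /g; field; lra.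
have gu' y : g (y / D) - y / D = (f y - y) / D by rewrite gE mulrBl.
have sc y z : (y / D <= z) = (y <= D * z) by rewrite ler_pdivrMr // mulrC.
have sc' y z : (z <= y / D) = (D * z <= y) by rewrite ler_pdivlMr // mulrC.
have sl y z : (y / D < z) = (y < D * z) by rewrite ltr_pdivrMr // mulrC.
have sl' y z : (z < y / D) = (D * z < y) by rewrite ltr_pdivlMr // mulrC.
have [] := H g (s / D) (t / D) (p / D) (x / D) k l; rewrite ?gi ?ler_pM2r ?ltr_pM2r //.
  have [fi [sp ts us ut] u0 slow K] := Ff; split.
  - by move=> y z yz; rewrite /g ltr_pM2r //; apply: fi; rewrite ltr_pM2l.
  - rewrite !ler_pM2r // sp; split => //.
    + by rewrite -mulrBl ler_pdivrMr // mulr1.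
    + by rewrite gu' mulrA ler_pdivlMr // mul1r.
    + by rewrite gu' mulrA ler_pdivlMr // mul1r.
  - move=> y; rewrite sc sc' => /u0[/andP[q1 q2] q3].
    rewrite gu gu' divr_gt0 // ler_pM2r // q3; split => //.
    by rewrite ler_pdivrMr // mulr1.
  - move=> y z; rewrite sc sc' => sy zt /andP[yz zy].
    rewrite /g sc' in zy; rewrite -(ler_pM2l D0) in yz.
    have [q1 q2] := slow (D * y) (D * z) sy zt (introT andP (conj yz zy)).
    by rewrite !gu !mulrA !ler_pM2r.
  - rewrite !ltr_pM2r // => spt y z; rewrite sc sc' => sy yz zt yp zp.
    have yp' : D * y != p by apply: contra yp => /eqP <-; rewrite mulrAC divff ?mul1r // gt_eqF.
    have zp' : D * z != p by apply: contra zp => /eqP <-; rewrite mulrAC divff ?mul1r // gt_eqF.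
    have yz' : D * y < D * z by rewrite ltr_pM2l.
    have := K spt (D * y) (D * z) sy yz' zt yp' zp'.
    have E w : (w - p / D)^-1 - (g w - g (p / D))^-1 =
        D * ((D * w - p)^-1 - (f (D * w) - f p)^-1).
      have e1 : w - p / D = (D * w - p) / D by field; lra using D0.
      by rewrite e1 gE /g -mulrBl !invf_div; ring.
    rewrite !E => /(ler_wpM2l (ltW D0)).
    rewrite [X in _ <= X -> _]mulrDr => hh; apply: le_trans hh _; rewrite lerD2l mulr1.
    by rewrite invfM mulrCA mulfV ?mulr1 // gt_eqF.
rewrite gu' => /(ler_wpM2l (ltW D0)) h1 /(ler_wpM2l (ltW D0)) h2.
have E w : D * ((f x - x) / D * w) = (f x - x) * w by field; lra.
by split; [move: h1; rewrite mulr1 mulrCA E|move: h2; rewrite E [leRHS]mulrC].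
Qed.

End FunnelCount.

(** * Return maps between critical points *)

Section Bridge.
Variables (R : realType) (F dF : R -> R) (rho : R).
Local Notation val := (rval rho).
Local Notation act := (lift_act F).
Local Notation gap := (lift_gap F).
Implicit Types (a b c : int * int) (x y z p : R) (i j k : nat).

(** As a function of [x] this is constant for a Moebius map and nonincreasing on either side of [p]
    when the Schwarzian derivative is negative. *)
Definition quot p x : R := dF p / (F p - F x) - (p - x)^-1.

(** The trace of the Schwarzian condition that survives away from the critical points: monotonicity
    up to a multiple of the length, also across the singularity at [p]. *)
Definition quot_bound : Prop := exists C t : R, [/\ 0 <= C, 0 < t &
  forall a b p x y : R, b - a < t -> (forall z, a < z < b -> dF z != 0) ->
  a < p < b -> a <= x -> x < y -> y <= b -> x != p -> y != p ->
  quot p y <= quot p x + C * (y - x)].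

(** The critical points of F^|b.1|. Forward iterates are meant even when [b.1] is negative. *)
Definition phi_crit b y : Prop := exists i, (i < `|b.1|)%N /\ dF (iter i F y) = 0.

Definition tame : Prop :=
  [/\ circle_lift_map F, forall x, is_derive x 1 F (dF x),
      continuous dF /\ (forall x, 0 <= dF x), cross_bound F /\ quot_bound &
      crit_contraction F [set x | dF x = 0]].

Hypothesis tF : tame.
Hypothesis rotF : is_rotation F rho.
Hypothesis irr : forall a, val a = 0 -> a = 0.

Let FL : circle_lift_map F. Proof. by case: tF. Qed.
Let crF : cross_bound F. Proof. by case: tF => _ _ _ []. Qed.
Let Fd x : is_derive x 1 F (dF x). Proof. by case: tF. Qed.
Let dF_ge0 x : 0 <= dF x. Proof. by case: tF => _ _ []. Qed.

Definition diter i p : R := \prod_(j < i) dF (iter j F p).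

Lemma is_derive_iter i p : is_derive p 1 (iter i F) (diter i p).
Proof.
elim: i => [|i IH]; first by rewrite /diter big_ord0; exact: is_derive_id.
rewrite /diter big_ord_recr /=.
have -> : iter i.+1 F = F \o iter i F by [].
rewrite mulrC; exact: (@is_derive1_comp _ F (iter i F)).
Qed.

Lemma diter_ge0 i p : 0 <= diter i p.
Proof. by apply: prodr_ge0. Qed.

(** A chain rule: the quotient of a composition is that of the inner map plus the derivative of the
    inner map at [p] times that of the outer one, so the sum telescopes. *)
Lemma quot_iter i p x : x != p ->
  diter i p / (iter i F p - iter i F x) - (p - x)^-1 =
  \sum_(j < i) diter j p * quot (iter j F p) (iter j F x).
Proof.
move=> xp; elim: i => [|i IH].
  by rewrite big_ord0 /diter big_ord0 /= mul1r subrr.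
rewrite big_ord_recr /= -IH /quot {1}/diter big_ord_recr /= -/(diter i p).
by ring.
Qed.

Lemma iter_actn k b x : iter k (act b) x = act (b *+ k) x.
Proof. by elim: k => [|k IH]; rewrite ?mulr0n ?act0 // iterS IH mulrS (actD FL). Qed.

Lemma is_derive_unique (f : R -> R) x d d' :
  is_derive x 1 f d -> is_derive x 1 f d' -> d = d'.
Proof. by move=> [_ <-] [_ <-]. Qed.

(* At a fixed distance from the identity, [diter p = 1] turns the quotient of
   [act b] into the difference of reciprocals used for funnels. *)
Lemma bridge_quot (G L Cq tq t : R) a b s r p y z : level rho a b -> 0 < b.1 ->
  (forall a b x y, level rho a b -> act (- (a *+ 4)) x <= y -> y <= act (a *+ 4) x ->
    [/\ gap a y <= G * gap a x, gap a x <= G * gap a y &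
      act (a *+ 4) x - act (- (a *+ 4)) x <= G * gap a x]) ->
  (forall a b x y z, level rho a b -> act (- (a *+ 4)) x <= y -> y < z ->
    z <= act (a *+ 4) x -> forall i, (i <= `|b.1|)%N ->
    (iter i F z - iter i F y) * gap a x <= L * (z - y) * gap a (iter i F x)) ->
  (forall a b p x y : R, b - a < tq -> (forall z, a < z < b -> dF z != 0) ->
    a < p < b -> a <= x -> x < y -> y <= b -> x != p -> y != p ->
    quot p y <= quot p x + Cq * (y - x)) ->
  0 <= Cq -> 0 <= L -> 0 <= G -> (forall x, gap a x <= t) -> G * t < tq ->
  s < p < r -> r <= act (a *+ 4) s -> (forall y, s < y < r -> ~ phi_crit b y) ->
  (forall y, s <= y <= r -> gap b p <= gap b y) ->
  s <= y -> y < z -> z <= r -> y != p -> z != p ->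
  (z - p)^-1 - (act b z - act b p)^-1 <= (y - p)^-1 - (act b y - act b p)^-1 +
    Cq * L ^+ 2 * G * t / gap a s.
Proof.
move=> lab b1 HG HL Hq Cq0 L0 G0 tb Gt /andP[sp pr] rs ncr pm sy yz zr yp zp.
have [/andP[b0 ba] _ _ _ _] := lab; have a0 : 0 < val a by lra.
set q := absz b.1; set D := gap a s.
have D0 : 0 < D := gap_gt0 rotF s a0.
have a4 : 0 <= val (a *+ 4) by rewrite rvalMn mulrn_wge0 // ltW.
have s4 w : act (- (a *+ 4)) w <= w by apply: (act_geN FL rotF irr).
have bE w : act b w = iter q F w + b.2%:~R by rewrite iter_act ?subrK // ltW.
have gd : is_derive p 1 (gap b) (diter q p - 1).
  have -> : gap b = (iter q F + cst (b.2%:~R)) - id.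
    by apply/funext => w; rewrite /lift_gap bE.
  have -> : diter q p - 1 = diter q p + 0 - 1 by rewrite addr0.
  apply: is_deriveB; apply: is_deriveD; exact: is_derive_iter.
(* The derivative of [gap b] vanishes at its interior minimum [p]. *)
have dq : diter q p = 1.
  suff : diter q p - 1 = 0 by lra.
  apply: is_derive_unique gd _.
  apply: (@derive1_at_min _ _ s r); [by lra using pr sp| |by rewrite in_itv /= sp|].
    move=> w _; have [//] : is_derive w 1 (gap b) (diter q w - 1).
    have -> : gap b = (iter q F + cst (b.2%:~R)) - id.
      by apply/funext => v; rewrite /lift_gap bE.
    have -> : diter q w - 1 = diter q w + 0 - 1 by rewrite addr0.
    apply: is_deriveB; apply: is_deriveD; exact: is_derive_iter.
  by move=> w; rewrite in_itv /= => /andP[w1 w2]; apply: pm; rewrite !ltW.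
have KE w : w != p -> (w - p)^-1 - (act b w - act b p)^-1 =
    \sum_(j < q) diter j p * quot (iter j F p) (iter j F w).
  move=> wp; rewrite -quot_iter // dq div1r !bE.
  have -> : iter q F w + b.2%:~R - (iter q F p + b.2%:~R) = - (iter q F p - iter q F w) by ring.
  by rewrite -[w - p]opprB !invrN; ring.
rewrite !KE // -lerBlDl -sumrB.
pose g j := gap a (iter j F s).
have g0 j : 0 <= g j := ltW (gap_gt0 rotF _ a0).
(* The slope bound of the iterates, applied to chords that start at [p], passes to the
   derivative. *)
have dp j : (j <= q)%N -> diter j p <= L * g j / D.
  move=> jq; apply: (is_derive_le (is_derive_iter j p) (e := r - p)); first by lra using pr.
  move=> w /andP[pw wr]; have -> : L * g j / D * (w - p) = L * (w - p) * g j / D by ring.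
  rewrite ler_pdivlMr //; apply: HL lab (le_trans (s4 s) (ltW sp)) pw _ _ jq.
  by apply: le_trans rs; lra using wr.
have step j : (j < q)%N ->
   diter j p * quot (iter j F p) (iter j F z) - diter j p * quot (iter j F p) (iter j F y)
   <= Cq * L ^+ 2 * G * t / D * g j.
  move=> jq.
  have mon := iterF_lt FL j; have mon' := iterF_le FL j.
  have nc w : iter j F s < w < iter j F r -> dF w != 0.
    move=> /andP[w1 w2]; apply/eqP => dw.
    have wE : w = iter j F (act (- (j%:Z, 0)) w) by rewrite -act_nat (actNK FL).
    apply: (ncr (act (- (j%:Z, 0)) w)); last by exists j; rewrite -wE.
    by rewrite -(mon s) -(mon _ r) -wE w1.
  have len : iter j F r - iter j F s < tq.
    have h1 : iter j F r <= act (a *+ 4) (iter j F s) by rewrite (act_iter FL) mon'.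
    have [_ _ h2] := HG a b _ _ lab (s4 (iter j F s)) (act_ge FL rotF irr _ a4).
    have h3 := s4 (iter j F s).
    have h4 : G * gap a (iter j F s) <= G * t by apply: ler_wpM2l.
    by lra using Gt h1 h2 h3 h4.
  have inj w : w != p -> iter j F w != iter j F p.
    by move=> wp; rewrite -(inj_eq (inc_inj mon')) // in wp.
  have h := Hq (iter j F s) (iter j F r) (iter j F p) (iter j F y) (iter j F z) len nc.
  have {}h : quot (iter j F p) (iter j F z) <= quot (iter j F p) (iter j F y) +
      Cq * (iter j F z - iter j F y).
    by apply: h; rewrite ?mon ?mon' ?inj // sp.
  have yzj : iter j F z - iter j F y <= L * (z - y) * g j / D.
    rewrite ler_pdivlMr //; apply: HL lab _ yz _ _ (ltnW jq).
      exact: le_trans (s4 s) sy.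
    exact: le_trans zr rs.
  have zy : z - y <= G * D.
    have [_ _ h2] := HG a b _ _ lab (s4 s) (act_ge FL rotF irr _ a4).
    by have h3 := s4 s; rewrite /D; lra using h2 h3 rs sy zr.
  rewrite -mulrBr; apply: (@le_trans _ _ (L * g j / D * (Cq * (L * (z - y) * g j / D)))).
    apply: (@le_trans _ _ (diter j p * (Cq * (L * (z - y) * g j / D)))).
      apply: ler_wpM2l; first exact: diter_ge0.
      have : Cq * (iter j F z - iter j F y) <= Cq * (L * (z - y) * g j / D) by apply: ler_wpM2l.
      by lra using h.
    apply: ler_wpM2r; last exact: dp (ltnW jq).
    have : 0 <= z - y by lra using yz.
    by move=> zy0; have := g0 j; move=> gj; pos.
  have -> : L * g j / D * (Cq * (L * (z - y) * g j / D)) =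
     Cq * L ^+ 2 * g j / D ^+ 2 * ((z - y) * g j).
    by field; exact: lt0r_neq0 D0.
  have -> : Cq * L ^+ 2 * G * t / D * g j = Cq * L ^+ 2 * g j / D ^+ 2 * ((G * D) * t).
    by field; exact: lt0r_neq0 D0.
  have gj := g0 j.
  apply: ler_wpM2l; first by pos.
  by apply: ler_pM => //; [lra using yz|exact: tb].
apply: (@le_trans _ _ (\sum_(j < q) Cq * L ^+ 2 * G * t / D * g j)).
  by apply: ler_sum => j _; exact: step.
have t0 : 0 <= t by apply: le_trans (tb s); exact: ltW.
(* Each error contained a squared gap: one factor was bounded by [t], and the other one is summed
   over disjoint intervals. *)
rewrite -mulr_sumr ler_piMr //; first by have D0' := ltW D0; pos.
exact: (level_sum FL rotF irr).
Qed.

(** The return map [act b] on [s, r] is a funnel at scale [gap a s]: [phi_crit_gap] makes both ends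
    move by a definite amount, comparability of gaps gives the size and the slow variation, and
    [bridge_quot] gives the last clause because no critical point lies inside. The step counts then
    determine the displacement by [funnel_count]. *)
Lemma bridge : exists C t : R, [/\ 1 <= C, 0 < t & forall a b, level rho a b ->
  0 < b.1 -> (forall x, gap a x < t) -> forall (s r x : R) k l,
  phi_crit b s -> phi_crit b r -> (forall y, s < y < r -> ~ phi_crit b y) ->
  s < x < r -> r <= act (a *+ 4) s ->
  act (b *+ k) s <= x < act (b *+ k.+1) s -> act (b *+ l) x <= r < act (b *+ l.+1) x ->
  gap a x <= C * (gap b x * (1 + (minn k l)%:R) ^+ 2) /\
  gap b x * (1 + (minn k l)%:R) ^+ 2 <= C * gap a x].
Proof.
have [_ _ _ [_ qF] ccF] := tF.
have [C1 [t1 [C11 t10 H1]]] := phi_crit_gap FL rotF irr crF ccF.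
have [G G1 HG] := gap_window FL rotF irr crF 4.
have [L L1 HL] := iter_lip FL rotF irr crF 4.
have [Cq [tq [Cq0 tq0 Hq]]] := qF.
pose A := G * C1.
have A1 : 1 <= A by rewrite /A -[leLHS]mulr1 ler_pM; lra using C11 G1.
have GA : G <= A by rewrite /A ler_peMr; lra using C11 G1.
have CA : C1 <= A by rewrite /A ler_peMl; lra using C11 G1.
have A0 : 0 < A by lra.
have [Cf Cf1 Hf] := funnel_count A1.
(* Below this gap size the error of [bridge_quot] fits into the slack of a funnel. The summand 1
   keeps the inverse meaningful when [Cq] is 0. *)
pose t2 := (8 * A ^+ 5 * (Cq * L ^+ 2 + 1))^-1.
have P0 : 0 < Cq * L ^+ 2 + 1.
  by have : 0 <= Cq * L ^+ 2 by [rewrite mulr_ge0 ?sqr_ge0]; lra.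
have t20 : 0 < t2 by rewrite invr_gt0; pos.
pose tt := Num.min (tq / (2 * G)) t2.
have tt0 : 0 < tt by rewrite lt_min t20 divr_gt0 //; lra using G1.
have Gtt : G * tt < tq.
  have : tt <= tq / (2 * G) by rewrite ge_min lexx.
  by rewrite ler_pdivlMr; lra using G1 tq0.
have ttb : Cq * L ^+ 2 * G * tt <= (8 * A ^+ 3)^-1.
  have tt2 : tt <= t2 by rewrite ge_min lexx orbT.
  have G0 : 0 < G by lra using G1.
  apply: (@le_trans _ _ ((Cq * L ^+ 2 + 1) * A * t2)).
    have q0 : 0 <= Cq * L ^+ 2 by rewrite mulr_ge0 ?sqr_ge0.
    apply: ler_pM => //; [by pos|by pos|].
    by apply: ler_pM => //; [by pos|lra].
  have -> : (Cq * L ^+ 2 + 1) * A * t2 = (8 * A ^+ 3)^-1 / A by rewrite /t2; field; lra using A1 P0.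
  by rewrite ler_pdivrMr // ler_peMr // invr_ge0; pos.
exists (Cf * G), (Num.min t1 tt); split.
- by rewrite -[leLHS]mulr1 ler_pM; lra using C11 Cf1 G1.
- by rewrite lt_min t10.
move=> a b lab b1 small s r x k l cs cr ncr /andP[sx xr] rs kx lx.
have sm1 y : gap a y < t1 by have := small y; rewrite lt_min => /andP[].
have sm2 y : gap a y <= tt by have := small y; rewrite lt_min => /andP[_ /ltW].
clearbody tt; clear small.
have [/andP[b0 ba] _ _ _ _] := lab; have a0 : 0 < val a by lra using b0 ba.
have [d [_ ld]] := level_next irr lab.
have ga0 y := gap_gt0 rotF y a0; have gb0 y := gap_gt0 rotF y b0.
have a4 : 0 <= val (a *+ 4) by rewrite rvalMn mulrn_wge0 // ltW.
have W y : s <= y -> y <= r -> [/\ gap a y <= G * gap a s, gap a s <= G * gap a y &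
    act (a *+ 4) s - act (- (a *+ 4)) s <= G * gap a s].
  move=> sy yr; apply: HG lab _ _; last by lra using rs yr.
  by apply: le_trans sy; apply: (act_geN FL rotF irr).
have s4 y : act (- (a *+ 4)) y <= y by apply: (act_geN FL rotF irr).
set D := gap a s.
have D0 : 0 < D := ga0 s.
have sr : s < r by lra using sx xr.
have rsD : r - s <= G * D.
  have [_ _] := W s (lexx _) (ltW sr); have := s4 s; rewrite -/D; lra using rs.
have actc : continuous (act b) by apply: act_continuous FL _ _; exact: ltW.
have [p psr pm] : exists2 p, s <= p <= r & forall y, s <= y <= r -> gap b p <= gap b y.
  have [|p pin pm] := @EVT_min R (gap b) s r (ltW sr).
    by apply: continuous_subspaceT => y; apply: cvgB; [exact: actc|exact: cvg_id].
  by exists p => [|y ysr]; [move: pin|apply: pm]; rewrite in_itv.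
have F1 : funnel A D (act b) s r p.
  split.
  - by move=> y z yz; rewrite (act_lt FL).
  - split => //.
    + by apply: le_trans rsD _; rewrite ler_wpM2r // ltW.
    + have [i [ib ci]] := cs; have := H1 a b lab b1 sm1 s i ib ci.
      move=> h; apply: le_trans h _; rewrite -/(lift_gap F b s) ler_wpM2r // ltW //.
    + have [i [ib ci]] := cr; have := H1 a b lab b1 sm1 r i ib ci.
      have [_ g2 _] := W r (ltW sr) (lexx _) => h.
      apply: le_trans g2 _; rewrite /A -mulrA ler_pM2l //; lra using G1.
  - move=> y /[dup] ysr /andP[sy yr]; rewrite -!/(lift_gap F b _) pm //.
    rewrite gb0; split => //=.
    have [g1 _ _] := W y sy yr; apply: le_trans (gap_mono FL rotF y ba) _.
    by apply: le_trans g1 _; rewrite ler_wpM2r // ltW.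
  - move=> y z sy zr /andP[yz zy].
    have b4 : 0 <= val (b *+ 4) by rewrite rvalMn mulrn_wge0 // ltW.
    have z1 : act (- (b *+ 4)) y <= z.
      by apply: le_trans yz; apply: (act_geN FL rotF irr).
    have z2 : z <= act (b *+ 4) y.
      apply: le_trans zy _; apply: (act_rval_le FL rotF irr).
      by rewrite rvalMn -{1}(mulr1n (val b)) ler_pMn2l.
    have [g1 g2 _] := HG _ _ y z ld z1 z2.
    rewrite -!/(lift_gap F b _).
    by split; [apply: le_trans g1 _|apply: le_trans g2 _]; rewrite ler_wpM2r // ltW.
  - move=> /andP[sp pr] y z sy yz zr yp zp.
    have L0 : 0 <= L by lra using L1.
    have G0 : 0 <= G by lra using G1.
    have spr : s < p < r by rewrite sp.
    have h := bridge_quot lab b1 HG HL Hq Cq0 L0 G0 sm2 Gtt spr rs ncr pm sy yz zr yp zp.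
    apply: le_trans h _; rewrite lerD2l -/D invfM; apply: ler_wpM2r => //.
    by rewrite invr_ge0 ltW.
have [k1 k2] := andP kx; have [l1 l2] := andP lx.
have := Hf D (act b) s r p x k l D0 F1 (ltW sx) (ltW xr).
rewrite !iter_actn => /(_ k1 k2 l1 l2) [h1 h2].
have [g1 g2 _] := W x (ltW sx) (ltW xr).
have Cf0 : 0 < Cf by lra using Cf1.
have G0 : 0 < G by lra.
move: h1 h2; rewrite -/(lift_gap F b x); set X := gap b x * _ => h1 h2.
split.
  apply: le_trans g1 _; have -> : Cf * G * X = G * (Cf * X) by ring.
  by rewrite ler_pM2l.
by apply: le_trans h2 _; rewrite -mulrA ler_pM2l.
Qed.

End Bridge.

(** * Reflection of the line, for returns in negative time *)

Section Reflection.
Variables (R : realType).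
Implicit Types (F dF : R -> R) (rho : R) (a b : int * int).

Definition refl F : R -> R := fun x => - F (- x).

Definition aflip a : int * int := (- a.1, a.2).

Lemma refl_lift F : circle_lift_map F -> circle_lift_map (refl F).
Proof.
move=> [Fi Fc F1]; split.
- by move=> x y xy; rewrite /refl ltrN2; apply: Fi; rewrite ltrN2.
- move=> x; apply: continuousN; apply: continuous_comp; last exact: Fc.
  by apply: continuousN; exact: cvg_id.
- move=> x; rewrite /refl; have := F1 (- x - 1).
  by rewrite subrK => ->; rewrite opprD; ring.
Qed.

Lemma rval_aflip rho a : rval (- rho) (aflip a) = rval rho a.
Proof. by rewrite /rval /aflip /= mulrNz mulrNN. Qed.

Lemma itz_refl F k x : circle_lift_map F -> itz (refl F) k x = - itz F k (- x).
Proof.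
move=> FL; have RL := refl_lift FL.
have pos n y : iter n (refl F) y = - iter n F (- y).
  by elim: n => [|n IH]; rewrite /= ?opprK // IH /refl opprK.
have inv y : finv (refl F) y = - finv F (- y).
  by apply: (F_inj RL); rewrite (FinvK RL) /refl opprK (FinvK FL) opprK.
case: k => n; first exact: pos.
rewrite /itz; elim: n.+1 => [|m IH]; first by rewrite /= opprK.
by rewrite !iterS IH inv opprK.
Qed.

(** Reflection turns moves to the right into moves to the left, and the inverse [- a] restores the
    direction. The time of [aflip a] is [- a.1], positive when [a.1] is negative. *)
Lemma act_refl F a x : circle_lift_map F ->
  lift_act (refl F) (aflip a) x = - lift_act F (- a) (- x).
Proof.
by move=> FL; rewrite /lift_act (itz_refl _ _ FL) /= mulrNz opprD opprK.
Qed.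

Lemma refl_rotation F rho : circle_lift_map F -> is_rotation F rho ->
  is_rotation (refl F) (- rho).
Proof.
move=> FL rF a a0 x; have -> : a = aflip (aflip a) by case: a {a0} => k p; rewrite /aflip /= opprK.
rewrite (act_refl _ _ FL) ltrNr (act_ltN FL).
by apply: rF; rewrite -(opprK rho) rval_aflip.
Qed.

Lemma refl_level rho a b : level rho a b -> level (- rho) (aflip a) (aflip b).
Proof.
rewrite /level !rval_aflip /aflip /= !normrN mulrNN => -[h1 h2 h3 h4 h5]; split => //.
by rewrite -h5; ring.
Qed.

Lemma gap_refl F a x : circle_lift_map F ->
  lift_gap (refl F) (aflip a) x = lift_gap F a (lift_act F (- a) (- x)).
Proof. by move=> FL; rewrite /lift_gap (act_refl _ _ FL) (actNK FL); ring. Qed.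

Lemma phi_crit_refl F dF b y :
  phi_crit (refl F) (fun x => dF (- x)) (aflip b) y <-> phi_crit F dF b (- y).
Proof.
have pos n z : iter n (refl F) z = - iter n F (- z).
  by elim: n => [|n IH]; rewrite /= ?opprK // IH /refl opprK.
by rewrite /phi_crit /aflip /= abszN; split=> -[i [ib h]]; exists i; split => //;
  rewrite ?pos ?opprK // -h pos opprK.
Qed.

Lemma refl_tame F dF : tame F dF -> tame (refl F) (fun x => dF (- x)).
Proof.
move=> [FL Fd [dc d0] [crF qF] ccF]; split.
- exact: refl_lift.
- move=> x; rewrite /refl.
  have h : is_derive x 1 (F \o -%R) (- dF (- x)).
    have hF := Fd (- x); have hN : is_derive x 1 (-%R : R -> R) (- 1) by exact: is_deriveNid.
    by rewrite -mulrN1; apply: is_derive1_comp.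
  by have := is_deriveN h; rewrite opprK.
- split; last by move=> x; exact: d0.
  move=> x; apply: continuous_comp; last exact: dc.
  by apply: continuousN; exact: cvg_id.
- split.
    have [C [cs [C0 H]]] := crF; exists C, (map -%R cs); split => // p q r s pq qr rs.
    have := H (- s) (- r) (- q) (- p); rewrite !ltrN2 => /(_ rs qr pq).
    rewrite /refl !crossN -[cross (F _) _ _ _]crossN.
    have -> : - p - - s = s - p by ring.
    rewrite big_map.
    have E c : `[< exists m : int, p <= - c + m%:~R <= s >] = `[< exists m : int, - s <= c + m%:~R <= - p >].
      by apply/asboolP/asboolP => -[m /andP[h1 h2]]; exists (- m); rewrite mulrNz; apply/andP; split; lra using h1 h2.
    by under [in X in _ -> X]eq_bigr => c _ do rewrite E.
  have [C [t [C0 t0 H]]] := qF; exists C, t; split => // a b p x y ab dn /andP[ap pb] ax xy yb xp yp.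
  have qE z : quot (refl F) (fun x => dF (- x)) p z = - quot F dF (- p) (- z).
    rewrite /quot /refl.
    have -> : - F (- p) - - F (- z) = - (F (- p) - F (- z)) by ring.
    have -> : - p - - z = - (p - z) by ring.
    by rewrite !invrN; ring.
  rewrite !qE; have := H (- b) (- a) (- p) (- y) (- x).
  rewrite !ltrN2 !lerN2 ap pb !eqr_opp => h.
  have : quot F dF (- p) (- x) <= quot F dF (- p) (- y) + C * (- x - - y).
    apply: h => //; first by lra.
    move=> z /andP[z1 z2]; rewrite -[z]opprK; apply: dn; apply/andP; split; lra using z1 z2.
  by lra.
- move=> e e0; have [l [t [l0 t0 H]]] := ccF e e0; exists l, t; split => //.
  move=> c y z /= cc yz zt yl; rewrite /refl.
  have := H (- c) (- y) (- z) cc.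
  have N (u v : R) : - u - - v = - (u - v) by ring.
  rewrite !N !normrN mulrNN; exact.
Qed.

End Reflection.

Section BridgeAll.
Variables (R : realType) (F dF : R -> R) (rho : R).
Local Notation val := (rval rho).
Local Notation act := (lift_act F).
Local Notation gap := (lift_gap F).
Hypothesis tF : tame F dF.
Hypothesis rotF : is_rotation F rho.
Hypothesis irr : forall a, val a = 0 -> a = 0.
Implicit Types (a b c : int * int) (x y z p : R) (i j k : nat).

(** For negative [b.1] the estimates are applied to the reflected map. Its gap at -x is the original
    gap one step before [x], comparable to the gap at [x]; each of the two gaps costs a factor [G],
    and the counts [k] and [l] change places. *)
Lemma bridge_all : exists C t : R, [/\ 1 <= C, 0 < t & forall a b, level rho a b ->
  (forall x, gap a x < t) ->
  (forall x, phi_crit F dF b x -> gap a x <= C * gap b x) /\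
  forall (s r x : R) k l,
  phi_crit F dF b s -> phi_crit F dF b r ->
  (forall y, s < y < r -> ~ phi_crit F dF b y) ->
  s < x < r -> r <= act (a *+ 4) s ->
  act (b *+ k) s <= x < act (b *+ k.+1) s -> act (b *+ l) x <= r < act (b *+ l.+1) x ->
  gap a x <= C * (gap b x * (1 + (minn k l)%:R) ^+ 2) /\
  gap b x * (1 + (minn k l)%:R) ^+ 2 <= C * gap a x].
Proof.
have [FL _ _ [crF _] ccF] := tF.
have tF' := refl_tame tF; have FL' := refl_lift FL.
have [_ _ _ [crF' _] ccF'] := tF'.
have rotF' := refl_rotation FL rotF.
have irr' a : rval (- rho) a = 0 -> a = 0.
  have -> : a = aflip (aflip a) by case: a => u v; rewrite /aflip /= opprK.
  by rewrite rval_aflip => /irr ->; rewrite /aflip /= oppr0.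
have [C1 [t1 [C11 t10 H1]]] := bridge tF rotF irr.
have [C2 [t2 [C21 t20 H2]]] := bridge tF' rotF' irr'.
have [C3 [t3 [C31 t30 H3]]] := phi_crit_gap FL rotF irr crF ccF.
have [C4 [t4 [C41 t40 H4]]] := phi_crit_gap FL' rotF' irr' crF' ccF'.
have [G G1 HG] := gap_near FL rotF irr crF 1.
pose C := (C1 + C2 + C3 + C4) * G ^+ 2.
have G2 : 1 <= G ^+ 2 by rewrite exprn_ege1.
have G0 : 0 < G by lra using G1.
exists C, (Num.min (Num.min t1 t2) (Num.min t3 t4)); split.
- by rewrite -[leLHS]mulr1 ler_pM; lra using C11 C21 C31 C41 G2.
- by rewrite !lt_min t10 t20 t30.
move=> a b lab small.
have [/andP[b0 ba] _ ab _ _] := lab; have a0 : 0 < val a by lra using b0 ba.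
have ga0 y := gap_gt0 rotF y a0; have gb0 y := gap_gt0 rotF y b0.
have weak (D u v : R) : D * G ^+ 2 <= C -> 0 <= v -> u <= D * G ^+ 2 * v -> u <= C * v.
  by move=> DC v0 h; apply: le_trans h _; apply: ler_wpM2r.
have W1 D : D <= C1 + C2 + C3 + C4 -> D * G ^+ 2 <= C.
  by move=> h; apply: ler_wpM2r => //; lra using G2.
have up (D v : R) : 0 <= D -> 0 <= v -> D * v <= D * G ^+ 2 * v.
  by move=> D0 v0; rewrite mulrAC ler_peMr // mulr_ge0.
have [b1|b1] := ltP 0 b.1.
  have s1 y : gap a y < t1 by have := small y; rewrite !lt_min => /andP[/andP[]].
  have s3 y : gap a y < t3 by have := small y; rewrite !lt_min => /andP[_ /andP[]].
  split.
    move=> x [i [ib cx]]; have h := H3 a b lab b1 s3 x i ib cx.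
    apply: (weak C3); [by apply: W1; lra using C11 C21 C41|exact: ltW (gb0 _)|].
    by apply: le_trans h (up _ _ _ _); [lra using C31|exact: ltW (gb0 _)].
  move=> s r x k l cs cr nc sxr rs kx lx.
  have [h1 h2] := H1 a b lab b1 s1 s r x k l cs cr nc sxr rs kx lx.
  have X0 : 0 <= gap b x * (1 + (minn k l)%:R) ^+ 2 by rewrite mulr_ge0 ?sqr_ge0 // ltW.
  split; apply: (weak C1); [by apply: W1; lra using C21 C31 C41|by []| |by apply: W1; lra using C21 C31 C41|exact: ltW (ga0 _)|].
    by apply: le_trans h1 (up _ _ _ _); [lra using C11|].
  by apply: le_trans h2 (up _ _ _ _); [lra using C11|exact: ltW (ga0 _)].
have b1' : 0 < (aflip b).1.
  rewrite /aflip /= oppr_gt0 lt_neqAle b1 andbT.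
  by apply: contraTneq ab => ->; rewrite mulr0.
have lab' := refl_level lab.
have s2 y : lift_gap (refl F) (aflip a) y < t2.
  by rewrite gap_refl //; have := small (act (- a) (- y)); rewrite !lt_min => /andP[/andP[]].
have s4 y : lift_gap (refl F) (aflip a) y < t4.
  by rewrite gap_refl //; have := small (act (- a) (- y)); rewrite !lt_min => /andP[_ /andP[]].
have na : `|val (- a)| <= 1 * val a by rewrite rvalN normrN gtr0_norm; lra using b0 ba.
have nb : `|val (- b)| <= 1 * val b by rewrite rvalN normrN gtr0_norm; lra using b0.
have [d [_ ld]] := level_next irr lab.
have [ga1 ga2] : (forall x, lift_gap (refl F) (aflip a) (- x) <= G * gap a x) /\
    (forall x, gap a x <= G * lift_gap (refl F) (aflip a) (- x)).
  by split=> x; rewrite gap_refl // opprK; have [] := HG a b x _ lab na.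
have [gb1 gb2] : (forall x, lift_gap (refl F) (aflip b) (- x) <= G * gap b x) /\
    (forall x, gap b x <= G * lift_gap (refl F) (aflip b) (- x)).
  by split=> x; rewrite gap_refl // opprK; have [] := HG b _ x _ ld nb.
have chain (u u' v v' D : R) : 0 <= D -> u <= G * u' -> u' <= D * v' -> v' <= G * v ->
    u <= D * G ^+ 2 * v.
  move=> D0 h1 h2 h3; apply: le_trans h1 _.
  have -> : D * G ^+ 2 * v = G * (D * (G * v)) by ring.
  by rewrite ler_pM2l //; apply: le_trans h2 _; apply: ler_wpM2l.
split.
  move=> x cx; have [i [ib cx']] := (phi_crit_refl F dF b (- x)).2 (eq_ind_r _ cx (opprK x)).
  have h := H4 _ _ lab' b1' s4 (- x) i ib cx'.
  apply: (weak C4); [by apply: W1; lra using C11 C21 C31|exact: ltW (gb0 _)|].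
  by apply: chain h _ => //; lra using C41.
move=> s r x k l cs cr nc /andP[sx xr] rs /andP[k1 k2] /andP[l1 l2].
have actR c y z : (lift_act (refl F) (aflip c) (- y) <= - z) = (act c z <= y).
  by rewrite (act_refl _ _ FL) opprK lerN2 (act_leN FL).
have actR' c y z : (- z < lift_act (refl F) (aflip c) (- y)) = (y < act c z).
  by rewrite (act_refl _ _ FL) opprK ltrN2 (act_ltN FL).
have flipM c n : aflip c *+ n = aflip (c *+ n).
  elim: n => [|n IH]; first by rewrite !mulr0n /aflip /= oppr0.
  by rewrite !mulrS IH /aflip /= opprD.
have cR y : phi_crit F dF b y -> phi_crit (refl F) (fun x => dF (- x)) (aflip b) (- y).
  by move=> cy; apply/phi_crit_refl; rewrite opprK.
have [] := H2 _ _ lab' b1' s2 (- r) (- s) (- x) l k (cR _ cr) (cR _ cs).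
- move=> y /andP[y1 y2] /phi_crit_refl; apply: nc; apply/andP; split; lra.
- by rewrite !ltrN2 xr.
- rewrite flipM (act_refl _ _ FL) opprK lerN2.
  by rewrite -(act_le FL (a *+ 4)) (actNK FL).
- by rewrite !flipM actR actR' l1.
- by rewrite !flipM actR actR' k1.
rewrite minnC; set m := minn k l => h1 h2.
have X0 : 0 <= (1 + m%:R) ^+ 2 :> R by rewrite sqr_ge0.
have M0 : 0 <= gap b x * (1 + m%:R) ^+ 2 by rewrite mulr_ge0 // ltW.
split; apply: (weak C2); [by apply: W1; lra|by []| |by apply: W1; lra|exact: ltW (ga0 _)|].
  apply: chain h1 _ => //; first by lra.
  by rewrite mulrA; apply: ler_wpM2r.
apply: chain h2 (ga1 x); first by lra.
by rewrite mulrA; apply: ler_wpM2r.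
Qed.

End BridgeAll.

(** * Comparing conjugate maps *)

Lemma deriv_shift (R : realType) (F dF : R -> R) (t s : R) :
  (forall x : R, is_derive x 1 F (dF x)) -> (forall x, F (x + t) = F x + s) ->
  forall x, dF (x + t) = dF x.
Proof.
move=> Fd Ft x.
have h1 : is_derive (x + t) 1 F (dF x).
  have -> : F = (fun y => F (y - t) + s) by apply/funext => y; rewrite -Ft subrK.
  have h : is_derive (x + t) 1 (F \o (fun y : R => y - t)) (dF x * 1).
    have hS : is_derive (x + t : R) 1 (fun y : R => y - t) (1 - 0) by apply: is_deriveB.
    have hF := Fd (x + t - t); rewrite addrK in hF; rewrite subr0 in hS.
    by apply: is_derive1_comp; rewrite addrK.
  by rewrite -[dF x]addr0 -[dF x]mulr1; apply: is_deriveD.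
exact: is_derive_unique (Fd _) h1.
Qed.

Lemma deriv_periodic (R : realType) (F dF : R -> R) : circle_lift_map F ->
  (forall x : R, is_derive x 1 F (dF x)) -> forall x (m : int), dF (x + m%:~R) = dF x.
Proof. by move=> FL Fd x m; apply: (deriv_shift Fd) => y; exact: F_int. Qed.

Lemma lift_growth (R : realType) (F : R -> R) : circle_lift_map F ->
  forall x t, t - 1 <= F (x + t) - F x <= t + 1.
Proof.
move=> FL x t; have /andP[k1 k2] := floor_itv t; set k := Num.floor t in k1 k2.
have : F (x + t) <= F (x + (k + 1)%:~R) by rewrite (F_le FL) lerD2l ltW.
have : F (x + k%:~R) <= F (x + t) by rewrite (F_le FL) lerD2l.
by rewrite !(F_int FL); move: k2; rewrite intrD; move=> ? ? ?; apply/andP; split; lra.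
Qed.

(** * Neighbouring critical points of an iterate *)

Section Zeros.
Variables (R : realType) (q : R -> R).
Hypothesis qc : continuous q.

Lemma last_zero y x : q y = 0 -> y <= x ->
  exists s, [/\ y <= s <= x, q s = 0 & forall z, s < z <= x -> q z <> 0].
Proof.
move=> qy yx; pose A := [set z | y <= z <= x /\ q z = 0].
have Ay : A y by split=> //; rewrite lexx.
have uA : has_ubound A by exists x => z [/andP[]].
have sA : has_sup A by split; [exists y|].
have [s1 s2] : y <= sup A /\ sup A <= x.
  split; first exact: ub_le_sup.
  by apply: ge_sup; [exists y|move=> z [/andP[]]].
have qs : q (sup A) = 0.
  have cl : closed [set z | q z = 0].
    rewrite -[X in closed X]/(q @^-1` [set 0]); apply: closed_comp; first by move=> z _; exact: qc.
    exact: closed_eq.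
  apply: cl; have := closure_sup sA.1 sA.2.
  by apply: closure_subset => z [].
exists (sup A); split; rewrite ?s1 //.
move=> z /andP[sz zx] qz; suff : z <= sup A by rewrite leNgt sz.
by apply: ub_le_sup => //; split => //; rewrite zx andbT; apply: le_trans s1 (ltW sz).
Qed.

End Zeros.

Lemma first_zero (R : realType) (q : R -> R) y x : continuous q ->
  q y = 0 -> x <= y ->
  exists s, [/\ x <= s <= y, q s = 0 & forall z, x <= z < s -> q z <> 0].
Proof.
move=> qc qy xy; have [] := @last_zero R (fun z => q (- z)) _ (- y) (- x).
- move=> z; apply: continuous_comp; last exact: qc.
  by apply: continuousN; exact: cvg_id.
- by rewrite opprK.
- by rewrite lerN2.
move=> s [/andP[s1 s2] s3 s4]; exists (- s); split => //; first by apply/andP; split; lra.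
move=> z /andP[z1 z2]; rewrite -[z]opprK; apply: s4; apply/andP; split; lra.
Qed.

Section CriticalNeighbours.
Variables (R : realType) (F dF : R -> R) (rho c0 : R).
Local Notation val := (rval rho).
Local Notation act := (lift_act F).
Hypothesis tF : tame F dF.
Hypothesis rotF : is_rotation F rho.
Hypothesis irr : forall a, val a = 0 -> a = 0.
Hypothesis crit0 : dF c0 = 0.
Implicit Types (a b c : int * int) (x y z : R) (i j k : nat).

Let FL : circle_lift_map F. Proof. by case: tF. Qed.
Let Fd x : is_derive x 1 F (dF x). Proof. by case: tF. Qed.

Lemma iter_F_continuous i : continuous (iter i F).
Proof.
move=> x; have [_ Fc _] := FL.
by elim: i x => [|i IH] x; [exact: cvg_id|apply: continuous_comp; [exact: IH|exact: Fc]].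
Qed.

Lemma diter_continuous i : continuous (diter F dF i).
Proof.
have [_ _ [dc _] _ _] := tF.
elim: i => [|i IH] x.
  have -> : diter F dF 0 = fun=> 1 by apply/funext => y; rewrite /diter big_ord0.
  exact: cst_continuous.
have -> : diter F dF i.+1 = (fun y => diter F dF i y * dF (iter i F y)).
  by apply/funext => y; rewrite /diter big_ord_recr.
apply: continuousM; first exact: IH.
by apply: continuous_comp; [exact: iter_F_continuous|exact: dc].
Qed.

Lemma phi_critP b x : phi_crit F dF b x <-> diter F dF `|b.1|%N x = 0.
Proof.
split=> [[i [ib h]]|/eqP].
  by apply/eqP; rewrite /diter prodf_seq_eq0; apply/hasP; exists (Ordinal ib);
    rewrite ?mem_index_enum //= h eqxx.
by rewrite /diter prodf_seq_eq0 => /hasP[i _ /= /eqP h]; exists i; split.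
Qed.

(** Preimages of the critical point [c0] of order below [|b.1|] are critical for the iterate, and
    [hit] in backward time shows that they meet every such interval. *)
Lemma phi_crit_hit a b x : level rho a b ->
  exists y, phi_crit F dF b y /\ x <= y < act (a + b) x.
Proof.
move=> lab; have [c [c1 c2 c3]] := hit FL rotF x c0 (or_intror erefl) lab.
exists (act c c0); split => //; exists `|c.1|%N; split; first by lia.
have E : (`|c.1|%N%:Z, 0%Z) + c = (0, c.2) :> (int * int)%type.
  by case: c c1 {c2 c3} => u v /= u1; congr (_, _); rewrite /=; [lia|rewrite add0r].
rewrite -(act_nat F) -(actD FL) E.
by rewrite /lift_act /= (deriv_periodic FL Fd).
Qed.

(** The critical points of the iterate are the zeros of a continuous function, so nearest ones exist
    on both sides of [x]. Each is within one step by [a + b] of [x]; two such steps are shorter than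
    four by [a]. *)
Lemma crit_neighbours a b x : level rho a b -> ~ phi_crit F dF b x ->
  exists s r, [/\ phi_crit F dF b s, phi_crit F dF b r,
    (forall y, s < y < r -> ~ phi_crit F dF b y), s < x < r & r <= act (a *+ 4) s].
Proof.
move=> lab nx.
have [/andP[b0 ba] _ _ _ _] := lab.
have [y1 [/phi_critP c1 /andP[y11 y12]]] := phi_crit_hit (act (- (a + b)) x) lab.
have [y2 [/phi_critP c2 /andP[y21 y22]]] := phi_crit_hit x lab.
rewrite (actNK FL) in y12.
have qc := @diter_continuous `|b.1|%N.
have [s [/andP[s1 s2] s3 s4]] := last_zero qc c1 (ltW y12).
have [r [/andP[r1 r2] r3 r4]] := first_zero qc c2 y21.
have sx : s < x by rewrite lt_neqAle s2 andbT; apply/eqP => E; apply: nx; apply/phi_critP; rewrite -E.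
have xr : x < r by rewrite lt_neqAle r1 andbT; apply/eqP => E; apply: nx; apply/phi_critP; rewrite E.
exists s, r; split; rewrite ?sx //; try by apply/phi_critP.
  move=> y /andP[y3 y4] /phi_critP; have [yx|yx] := leP y x; first by apply: s4; rewrite y3.
  by apply: r4; rewrite y4 ltW.
have h : x <= act (a + b) s.
  by rewrite -[a + b]opprK (act_leN FL); exact: le_trans y11 s1.
apply: le_trans r2 (le_trans (ltW y22) _).
apply: (@le_trans _ _ (act (a + b) (act (a + b) s))); first by rewrite (act_le FL).
rewrite -(actD FL); apply: (act_rval_le FL rotF irr).
by rewrite rvalMn !rvalD -[_ *+ 4]mulr_natl; lra.
Qed.

End CriticalNeighbours.

(** * Ratios of consecutive gaps under a conjugacy *)

Section Conjugacy.
Variables (R : realType) (F dF G dG H : R -> R) (rho c0 : R).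
Local Notation val := (rval rho).
Implicit Types (a b c : int * int) (x y z : R) (i j k : nat).
Hypothesis FL : circle_lift_map F.
Hypothesis GL : circle_lift_map G.
Hypothesis HL : circle_lift_map H.
Hypothesis conj : forall x, H (F x) = G (H x).

Lemma conj_iter i x : H (iter i F x) = iter i G (H x).
Proof. by elim: i => //= i <-; rewrite conj. Qed.

Lemma conj_act a x : H (lift_act F a x) = lift_act G a (H x).
Proof.
rewrite /lift_act (F_int HL); congr (_ + _).
case: a.1 => n; first exact: conj_iter.
rewrite /itz; elim: n.+1 => // m IH; rewrite !iterS -IH.
by apply: (F_inj GL); rewrite -conj !FinvK.
Qed.

Lemma conj_rotation : is_rotation F rho -> is_rotation G rho.
Proof.
move=> rF a a0 y; have [x <-] := F_surj HL y.
by rewrite -conj_act (F_lt HL); exact: rF.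
Qed.

Lemma conj_inv x : finv H (G x) = F (finv H x).
Proof. by apply: (F_inj HL); rewrite conj !(FinvK HL). Qed.

Hypothesis tF : tame F dF.
Hypothesis tG : tame G dG.
Hypothesis rotF : is_rotation F rho.
Hypothesis irr : forall a, val a = 0 -> a = 0.
Hypothesis crit0 : dF c0 = 0.
Hypothesis critE : forall x, dF x = 0 <-> dG (H x) = 0.

Lemma conj_phi_crit b x : phi_crit F dF b x <-> phi_crit G dG b (H x).
Proof.
by split=> -[i [ib h]]; exists i; split=> //; [rewrite -conj_iter -critE|rewrite critE conj_iter].
Qed.

(** Both ratios of consecutive gaps are comparable to the same (1 + min(k, l))^(-2), since [H]
    carries neighbouring critical points and step counts of [F] to those of [G]. At a critical point
    of the iterate the two gaps of [G] are comparable, and monotonicity of the gaps of [F] is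
    enough. *)
Lemma gap_ratio : exists C t : R, [/\ 1 <= C, 0 < t & forall a b x, level rho a b ->
  (forall x, lift_gap F a x < t) -> (forall x, lift_gap G a x < t) ->
  lift_gap F b x * lift_gap G a (H x) <= C * (lift_gap F a x * lift_gap G b (H x))].
Proof.
have rotG := conj_rotation rotF.
have [C1 [t1 [C11 t10 H1]]] := bridge_all tF rotF irr.
have [C2 [t2 [C21 t20 H2]]] := bridge_all tG rotG irr.
exists (C1 * C2), (Num.min t1 t2); split; [by rewrite mulr_ege1|by rewrite lt_min t10|].
move=> a b x lab sF sG.
have [/andP[b0 ba] _ _ _ _] := lab; have a0 : 0 < val a by apply: lt_trans ba.
have gap0 c y : 0 < val c -> 0 <= lift_gap F c y by move=> c1; exact/ltW/(gap_gt0 rotF).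
have gapG0 c y : 0 < val c -> 0 <= lift_gap G c y by move=> c1; exact/ltW/(gap_gt0 rotG).
have [y|K1 L1] := H1 a b lab; first by have := sF y; rewrite lt_min => /andP[].
have [y|K2 L2] := H2 a b lab; first by have := sG y; rewrite lt_min => /andP[].
have [cx|nx] := pselect (phi_crit F dF b x).
  have h1 := K2 _ ((conj_phi_crit b x).1 cx).
  have h2 := gap_mono FL rotF x ba.
  apply: (@le_trans _ _ (lift_gap F a x * (C2 * lift_gap G b (H x)))); first by apply: ler_pM => //; auto.
  have -> : C1 * C2 * (lift_gap F a x * lift_gap G b (H x)) =
    C1 * (lift_gap F a x * (C2 * lift_gap G b (H x))) by ring.
  by apply: ler_peMl => //; rewrite !mulr_ge0 ?gap0 ?gapG0 //; lra.
have [s [r [cs cr nc sxr rs]]] := crit_neighbours tF rotF irr crit0 lab nx.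
have /andP[sx xr] := sxr.
have [k hk] := steps FL rotF b0 (ltW sx).
have [l hl] := steps FL rotF b0 (ltW xr).
have [_ h1] := L1 s r x k l cs cr nc sxr rs hk hl.
have h2 : lift_gap G a (H x) <= C2 * (lift_gap G b (H x) * (1 + (minn k l)%:R) ^+ 2).
  apply: (L2 (H s) (H r) (H x) k l _ _ _ _ _ _ _).1.
  - by rewrite -conj_phi_crit.
  - by rewrite -conj_phi_crit.
  - move=> y; have [z <-] := F_surj HL y; rewrite !(F_lt HL) -conj_phi_crit; exact: nc.
  - by rewrite !(F_lt HL).
  - by rewrite -conj_act (F_le HL).
  - by rewrite -!conj_act (F_le HL) (F_lt HL).
  - by rewrite -!conj_act (F_le HL) (F_lt HL).
set M := (1 + _) ^+ 2 in h1 h2.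
have M0 : 0 <= M by rewrite sqr_ge0.
apply: (@le_trans _ _ (lift_gap F b x * (C2 * (lift_gap G b (H x) * M)))).
  by apply: ler_wpM2l; [auto|].
have -> : lift_gap F b x * (C2 * (lift_gap G b (H x) * M)) = (lift_gap F b x * M) * (C2 * lift_gap G b (H x)) by ring.
have -> : C1 * C2 * (lift_gap F a x * lift_gap G b (H x)) = (C1 * lift_gap F a x) * (C2 * lift_gap G b (H x)) by ring.
by apply: ler_wpM2r => //; rewrite mulr_ge0 ?gapG0 //; lra.
Qed.

End Conjugacy.

Lemma finv_lift (R : realType) (H : R -> R) : circle_lift_map H -> circle_lift_map (finv H).
Proof.
move=> HL.
have lt x y : (finv H x < finv H y) = (x < y) by rewrite -(F_lt HL) !(FinvK HL).
split.
- by move=> x y; rewrite lt.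
- move=> y; apply/cvgrPdist_lt => e e0; near=> z.
  have h1 : H (finv H y - e) < z.
    by near: z; apply: lt_nbhsr; rewrite -[ltRHS](FinvK HL) (F_lt HL); lra.
  have h2 : z < H (finv H y + e).
    by near: z; apply: lt_nbhsl; rewrite -[ltLHS](FinvK HL) (F_lt HL); lra.
  move: h1 h2; rewrite -{1}(FinvK HL z) -{2}(FinvK HL z) !(F_lt HL) => h1 h2.
  by rewrite ltr_norml; apply/andP; split; lra.
- move=> x; apply: (F_inj HL); have [_ _ H1] := HL.
  by rewrite H1 !(FinvK HL).
Unshelve. all: by end_near. Qed.


Section Conjugacy2.
Variables (R : realType) (F dF G dG H : R -> R) (rho c0 : R).
Local Notation val := (rval rho).
Implicit Types (a b c : int * int) (x y z : R) (i j k : nat).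
Hypothesis HL : circle_lift_map H.
Hypothesis conj : forall x, H (F x) = G (H x).
Hypothesis tF : tame F dF.
Hypothesis tG : tame G dG.
Hypothesis rotF : is_rotation F rho.
Hypothesis irr : forall a, val a = 0 -> a = 0.
Hypothesis crit0 : dF c0 = 0.
Hypothesis critE : forall x, dF x = 0 <-> dG (H x) = 0.

Let FL : circle_lift_map F. Proof. by case: tF. Qed.
Let GL : circle_lift_map G. Proof. by case: tG. Qed.

Lemma critE_inv x : dG x = 0 <-> dF (finv H x) = 0.
Proof. by rewrite critE (FinvK HL). Qed.

(** The conjugacy [finv H] exchanges the roles of [F] and [G] and gives the opposite comparison. *)
Lemma gap_ratio_inv : exists C t : R, [/\ 1 <= C, 0 < t & forall a b x, level rho a b ->
  (forall x, lift_gap F a x < t) -> (forall x, lift_gap G a x < t) ->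
  lift_gap G b (H x) * lift_gap F a x <= C * (lift_gap G a (H x) * lift_gap F b x)].
Proof.
have [|C [t [C1 t0 h]]] := gap_ratio GL FL (finv_lift HL) (conj_inv HL conj) tG tF
    (conj_rotation FL GL HL conj rotF) irr (c0 := H c0) _ critE_inv.
  by apply/critE.
exists C, t; split => // a b x lab sF sG.
by have := h a b (H x) lab sG sF; rewrite (FK HL).
Qed.

(** The interval is tiled by steps of [b]. On each tile [H] stretches at most a constant times as
    much as on the step of [a] at [x], by [gap_ratio_inv] and comparability inside the window, and
    the bound adds up. As one full step fits into [y, z], the overshoot of the last tile is
    comparable to z - y. *)
Lemma interval_ratio : exists C t : R, [/\ 1 <= C, 0 < t & forall a b x y z, level rho a b ->
  (forall x, lift_gap F a x < t) -> (forall x, lift_gap G a x < t) ->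
  lift_act F (- a) x <= y -> lift_act F b y <= z -> z <= lift_act F a x ->
  (H z - H y) * lift_gap F a x <= C * ((z - y) * lift_gap G a (H x))].
Proof.
have rotG := conj_rotation FL GL HL conj rotF.
have [_ _ _ [crF _] _] := tF; have [_ _ _ [crG _] _] := tG.
have [C [t [C1 t0 ratio]]] := gap_ratio_inv.
have [CF CF1 wF] := gap_near FL rotF irr crF 1.
have [DF DF1 uF] := gap_window FL rotF irr crF 1.
have [DG DG1 uG] := gap_window GL rotG irr crG 1.
pose K := DF * C * DG; have K0 : 0 < K by rewrite !mulr_gt0 //; lra.
have CF2 : 1 <= 1 + CF by lra.
exists (K * (1 + CF)), t; split => //.
  by rewrite !mulr_ege1.
move=> a b x y z lab sF sG y1 yz z1.
have [/andP[b0 ba] _ _ _ _] := lab; have a0 : 0 < val a by apply: lt_trans ba.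
have gF c w : 0 < val c -> 0 < lift_gap F c w by exact: (gap_gt0 rotF).
have gG c w : 0 < val c -> 0 < lift_gap G c w by exact: (gap_gt0 rotG).
have step w : lift_act F (- a) x <= w -> w <= lift_act F a x ->
    (H (lift_act F b w) - H w) * lift_gap F a x <= K * ((lift_act F b w - w) * lift_gap G a (H x)).
  move=> w1 w2; rewrite (conj_act FL GL HL conj) -[_ - H w]/(lift_gap G b (H w)) -[_ - w]/(lift_gap F b w).
  have [h1 h2 _] := uF a b x w lab w1 w2.
  have [] := uG a b (H x) (H w) lab; rewrite ?mulr1n.
  - by rewrite -(conj_act FL GL HL conj) (F_le HL).
  - by rewrite -(conj_act FL GL HL conj) (F_le HL).
  move=> h3 _ _.
  have h4 := ratio a b w lab sF sG.
  apply: (@le_trans _ _ (lift_gap G b (H w) * (DF * lift_gap F a w))).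
    by apply: ler_wpM2l => //; exact/ltW/gG.
  rewrite mulrCA; apply: (@le_trans _ _ (DF * (C * (lift_gap G a (H w) * lift_gap F b w)))).
    by apply: ler_wpM2l => //; lra using DF1.
  have -> : K * (lift_gap F b w * lift_gap G a (H x)) = DF * (C * (DG * lift_gap G a (H x) * lift_gap F b w)).
    by rewrite /K; ring.
  apply: ler_wpM2l; first by lra using DF1.
  apply: ler_wpM2l; first by lra using C1.
  by apply: ler_wpM2r => //; exact/ltW/gF.
have mono j w : w <= lift_act F (b *+ j) w.
  rewrite -{1}(act0 F w); apply: (act_rval_le FL rotF irr).
  by rewrite rval0 rvalMn mulrn_wge0 // ltW.
have many j : lift_act F (b *+ j) y <= lift_act F a x ->
    (H (lift_act F (b *+ j.+1) y) - H y) * lift_gap F a x <=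
    K * ((lift_act F (b *+ j.+1) y - y) * lift_gap G a (H x)).
  elim: j => [|j IH] jx.
    by rewrite mulr1n; apply: step => //; rewrite mulr0n act0 in jx.
  have h0 : lift_act F (b *+ j) y <= lift_act F a x.
    apply: le_trans jx; apply: (act_rval_le FL rotF irr); rewrite !rvalMn.
    by rewrite ler_wpMn2l // ltW.
  have h1 := IH h0; have h2 := step _ (le_trans y1 (mono j.+1 y)) jx.
  rewrite (mulrS _ j.+1) (actD FL); set u := lift_act F (b *+ j.+1) y in h1 h2 *.
  move: h1 h2; set P := lift_gap F a x; set Q := lift_gap G a (H x); set X := lift_act F b u => h1 h2.
  have -> : (H X - H y) * P = (H u - H y) * P + (H X - H u) * P by ring.
  have -> : K * ((X - y) * Q) = K * ((u - y) * Q) + K * ((X - u) * Q) by ring.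
  exact: lerD.
have yz' : y <= z by apply: le_trans yz; rewrite -[b]mulr1n; exact: mono.
have [j /andP[j1 j2]] := steps FL rotF b0 yz'.
have h := many j (le_trans j1 z1).
have gx := ltW (gF a x a0); have Gx := ltW (gG a (H x) a0).
apply: (@le_trans _ _ ((H (lift_act F (b *+ j.+1) y) - H y) * lift_gap F a x)).
  by apply: ler_wpM2r => //; rewrite lerD2r (F_le HL) ltW.
apply: le_trans h _; rewrite -mulrA; apply: ler_wpM2l; first exact: ltW.
rewrite mulrA; apply: ler_wpM2r => //.
case: j j1 j2 => [|j] j1 j2; first by move: j2; rewrite mulr1n ltNge yz.
have [d [_ ld]] := level_next irr lab.
rewrite (mulrS _ j.+1) (actD FL).
have [|h1 _ _] := wF b (a - b *+ d) (lift_act F (b *+ j) y) b ld.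
  by rewrite gtr0_norm // mul1r.
rewrite -(actD FL) -mulrS in h1.
have h2 : lift_gap F b (lift_act F (b *+ j) y) <= z - y.
  rewrite /lift_gap -(actD FL) -mulrS; apply: lerB => //; exact: mono.
have h3 : CF * lift_gap F b (lift_act F (b *+ j) y) <= CF * (z - y) by apply: ler_wpM2l => //; lra using CF1.
have E w : lift_act F b w = w + lift_gap F b w by rewrite /lift_gap; ring.
by rewrite E; lra using h1 h3 j1.
Qed.

End Conjugacy2.

(** * Geometric decay of gaps along the levels *)

Section LevelDecay.
Variables (R : realType) (F : R -> R) (rho : R) (e : nat -> int * int).
Local Notation val := (rval rho).
Local Notation gap := (lift_gap F).
Hypothesis FL : circle_lift_map F.
Hypothesis rotF : is_rotation F rho.
Hypothesis irr : forall a, val a = 0 -> a = 0.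
Hypothesis crF : cross_bound F.
Hypothesis lev : forall n, level rho (e n) (e n.+1) /\
  exists2 m, (0 < m)%N & e n.+2 = e n - e n.+1 *+ m.
Implicit Types (x y z : R) (i j k n m : nat).

Lemma level_rval_gt0 n : 0 < val (e n).
Proof. by have [[/andP[b0 ba] _ _ _ _] _] := lev n; exact: lt_trans ba. Qed.

Lemma gap_level_le n m x : (n <= m)%N -> gap (e m) x <= gap (e n) x.
Proof.
elim: m => [|m IH]; first by rewrite leqn0 => /eqP ->.
rewrite leq_eqVlt => /orP[/eqP -> //|nm]; apply: le_trans (IH nm).
by have [[/andP[_ ba] _ _ _ _] _] := lev m; exact: (gap_mono FL rotF).
Qed.

Lemma gap_decay : exists2 t : R, 0 < t < 1 &
  forall n m k x, (n + k.*2 <= m)%N -> gap (e m) x <= t ^+ k * gap (e n) x.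
Proof.
have [t t01 H] := gap_contract FL rotF irr crF; exists t => // n m k x.
have /andP[t0 _] := t01.
have S i : gap (e i.+2) x <= t * gap (e i) x.
  have [l1 [d d0 E]] := lev i; rewrite E; apply: (H _ _ _ _ l1) => //.
  by rewrite -E; have [] := lev i.+1.
move=> nm; apply: le_trans (gap_level_le x nm) _ => {nm m}.
elim: k n => [|k IH] n; first by rewrite addn0 expr0 mul1r.
rewrite doubleS !addnS -!addSn; apply: le_trans (IH _) _.
rewrite exprSr -mulrA; apply: ler_wpM2l; first by rewrite exprn_ge0 // ltW.
exact: S.
Qed.

Lemma exp_small (t u K : R) : 0 < t < 1 -> 0 < u -> exists k, K * t ^+ k < u.
Proof.
move=> /andP[t0 t1] u0.
have c : (fun n => K * t ^+ n) @ \oo --> K * 0.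
  by apply: cvgMr; apply: cvg_expr; rewrite gtr0_norm.
rewrite mulr0 in c.
have := cvgr_lt _ c u u0.
by move=> [k _ /(_ k (leqnn _))] h; exists k.
Qed.

Lemma gap_small (u : R) : 0 < u -> exists n, forall m x, (n <= m)%N -> gap (e m) x < u.
Proof.
move=> u0; have [t t01 H] := gap_decay.
have [k] := exp_small 1 t01 u0; rewrite mul1r => hk.
exists k.*2 => m x nm; apply: le_lt_trans (H 0%N m k x _) _; first by rewrite add0n.
apply: le_lt_trans hk; apply: ler_piMr; first by rewrite exprn_ge0 //; lra.
rewrite /lift_gap lerBlDr addrC.
have -> : x + 1 = lift_act F (0, 1) x by rewrite /lift_act /=.
apply: (act_rval_le FL rotF irr).
have [[_ h _ _ _] _] := lev 0; apply: le_trans h _.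
by rewrite /rval /= mul0r add0r.
Qed.

End LevelDecay.

Lemma seq_crossing (R : realType) (u : nat -> R) (t : R) n0 N :
  t < u n0 -> (n0 <= N)%N -> u N <= t -> exists n, (n0 <= n)%N /\ u n.+1 <= t < u n.
Proof.
move=> h0; elim: N => [|N IH]; first by rewrite leqn0 => /eqP <- /(lt_le_trans h0); rewrite ltxx.
rewrite leq_eqVlt => /orP[/eqP <- /(lt_le_trans h0)|nN hN]; first by rewrite ltxx.
have [h|h] := leP (u N) t; first exact: IH.
by exists N; split => //; rewrite hN.
Qed.

Lemma bounded_steps (R : realType) (r : nat -> R) (C : R) n0 : 1 <= C ->
  (forall k, 0 < r k) ->
  (forall k, (n0 <= k)%N -> r k <= C * r k.+1 /\ r k.+1 <= C * r k) ->
  forall M n m, (n0 <= n)%N -> (n0 <= m)%N -> (n <= m + M)%N -> (m <= n + M)%N ->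
  r n <= C ^+ M * r m.
Proof.
move=> C1 r0 H M n m hn hm nm mn.
have D j k : (n0 <= k)%N -> r k <= C ^+ j * r (k + j)%N /\ r (k + j)%N <= C ^+ j * r k.
  elim: j => [|j IH] hk; first by rewrite addn0 expr0 mul1r.
  have [h1 h2] := IH hk; have [h3 h4] := H _ (leq_trans hk (leq_addr j k)).
  have P : 0 <= C ^+ j by rewrite exprn_ge0 //; lra.
  rewrite addnS; split.
    by apply: le_trans h1 _; rewrite exprSr -mulrA; exact: ler_wpM2l.
  by apply: le_trans h4 _; rewrite exprS -mulrA; apply: ler_wpM2l => //; lra.
have up j k : (j <= M)%N -> C ^+ j * r k <= C ^+ M * r k.
  by move=> jM; apply: ler_wpM2r; [exact: ltW|exact: ler_weXn2l].
have [h|/ltnW h] := leqP n m.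
  have [h1 _] := D (m - n)%N n hn; rewrite subnKC // in h1.
  by apply: le_trans h1 (up _ _ _); lia.
have [_ h1] := D (n - m)%N m hm; rewrite subnKC // in h1.
by apply: le_trans h1 (up _ _ _); lia.
Qed.

(** For [t] at least [t0] all increments are at least [mu]. Up to t = 2 they are also at most 3;
    beyond that the bounds t - 1 and t + 1 of [lift_growth] differ by a factor of at most 3. *)
Lemma symmetric_all_scales (R : realType) (H : R -> R) (C t0 : R) : circle_lift_map H -> 0 < t0 ->
  (forall x t, 0 < t < t0 ->
    H (x + t) - H x <= C * (H x - H (x - t)) /\ H x - H (x - t) <= C * (H (x + t) - H x)) ->
  exists2 K : R, 1 <= K & forall x t, 0 < t ->
    H (x + t) - H x <= K * (H x - H (x - t)) /\ H x - H (x - t) <= K * (H (x + t) - H x).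
Proof.
move=> HL t00 small; have [_ Hc _] := HL.
have [x0 hx0] : exists x0, forall x, H (x0 + t0) - H x0 <= H (x + t0) - H x.
  apply: (@periodic_min _ (fun x => H (x + t0) - H x)).
    move=> x; apply: continuousB; last exact: Hc.
    apply: continuous_comp; last exact: Hc.
    by apply: continuousD; [exact: cvg_id|exact: cst_continuous].
  by move=> x m; rewrite addrAC !(F_int HL); ring.
set mu := H (x0 + t0) - H x0 in hx0.
have mu0 : 0 < mu by rewrite subr_gt0 (F_lt HL); lra.
have lo x t : t0 <= t -> mu <= H (x + t) - H x.
  by move=> tt; apply: le_trans (hx0 x) _; rewrite lerD2r (F_le HL) lerD2l.
pose K := 1 + `|C| + 3 / mu + 3.
have m3 : 0 < 3 / mu by rewrite divr_gt0.
have K1 : 1 <= K by rewrite /K; have := normr_ge0 C; lra.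
exists K => // x t tt.
have p1 : 0 <= H (x + t) - H x by rewrite subr_ge0 (F_le HL); lra.
have p2 : 0 <= H x - H (x - t) by rewrite subr_ge0 (F_le HL); lra.
have big y z : t0 <= t -> H (y + t) - H y <= K * (H (z + t) - H z).
  move=> tb; have l1 := lo z t tb; have /andP[l2 _] := lift_growth HL z t.
  have /andP[_ h] := lift_growth HL y t.
  set D := H (z + t) - H z in l1 l2 *.
  have D0 : 0 < D by lra.
  apply: le_trans h _; have [t2|t2] := leP t 2.
    apply: (@le_trans _ _ (3 / mu * D)); last by apply: ler_wpM2r; [lra|rewrite /K; have := normr_ge0 C; lra].
    have : 3 / mu * mu <= 3 / mu * D by apply: ler_wpM2l => //; lra.
    rewrite divfK; [lra|by rewrite gt_eqF].
  apply: (@le_trans _ _ (3 * D)); first lra.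
  by apply: ler_wpM2r; [lra using l1 m3 mu0|rewrite /K; have := normr_ge0 C; lra using l1 m3 mu0].
have [tb|ts] := leP t0 t.
  have h1 := big x (x - t) tb; have h2 := big (x - t) x tb.
  by rewrite subrK in h1 h2.
have CK : C <= K by rewrite /K; have := ler_norm C; lra.
have [|h1 h2] := small x t; first by rewrite tt.
by split; [apply: le_trans h1 _|apply: le_trans h2 _]; apply: ler_wpM2r.
Qed.

(** * Quasisymmetry of the conjugacy *)

Section ConjugacyQs.
Variables (R : realType) (F dF G dG H : R -> R) (rho c0 : R).
Local Notation val := (rval rho).
Hypothesis HL : circle_lift_map H.
Hypothesis conj : forall x, H (F x) = G (H x).
Hypothesis tF : tame F dF.
Hypothesis tG : tame G dG.
Hypothesis rotF : is_rotation F rho.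
Hypothesis irr : forall a, val a = 0 -> a = 0.
Hypothesis crit0 : dF c0 = 0.
Hypothesis critE : forall x, dF x = 0 <-> dG (H x) = 0.

(** The scale selects one level on the right of [x] and one on its left. Gaps on the two sides are
    comparable and decay geometrically, so these levels differ boundedly. On either side [H]
    stretches by about the ratio [r] of the gaps of [G] and [F] at the selected level, and [r]
    varies by a bounded factor from one level to the next. *)
Lemma conj_symmetric : exists2 K : R, 1 <= K & forall x t, 0 < t ->
    H (x + t) - H x <= K * (H x - H (x - t)) /\ H x - H (x - t) <= K * (H (x + t) - H x).
Proof.
have [FL _ _ [crF _] _] := tF; have [GL _ _ [crG _] _] := tG.
have rotG := conj_rotation FL GL HL conj rotF.
have HL' := finv_lift HL; have conj' := conj_inv HL conj.
have critE' := critE_inv HL critE.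
have critG : dG (H c0) = 0 by apply/critE.
have [Ca [ta [Ca1 ta0 ra]]] := gap_ratio FL GL HL conj tF tG rotF irr crit0 critE.
have [Cb [tb [Cb1 tb0 rb]]] := gap_ratio_inv HL conj tF tG rotF irr crit0 critE.
have [Cc [tc [Cc1 tc0 rc]]] := interval_ratio HL conj tF tG rotF irr crit0 critE.
have [Cd [td [Cd1 td0 rd]]] := interval_ratio HL' conj' tG tF rotG irr critG critE'.
have [e lev] := level_seq irr.
pose tm := Num.min (Num.min ta tb) (Num.min tc td).
have tm0 : 0 < tm by rewrite !lt_min ta0 tb0 tc0.
have [nF hnF] := gap_small FL rotF irr crF lev tm0.
have [nG hnG] := gap_small GL rotG irr crG lev tm0.
pose n0 := maxn nF nG.
have sF n x : (n0 <= n)%N -> lift_gap F (e n) x < tm.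
  by move=> h; apply: hnF; apply: leq_trans h; rewrite leq_maxl.
have sG n x : (n0 <= n)%N -> lift_gap G (e n) x < tm.
  by move=> h; apply: hnG; apply: leq_trans h; rewrite leq_maxr.
have tmE (z : R) : z < tm -> [/\ z < ta, z < tb, z < tc & z < td].
  by rewrite !lt_min => /andP[/andP[-> ->] /andP[-> ->]].
pose C := Ca * Cb * Cc * Cd.
have [CaC CbC CcC CdC] : [/\ Ca <= C, Cb <= C, Cc <= C & Cd <= C].
  rewrite /C; split.
  - by rewrite -!mulrA ler_peMr ?mulr_ege1 //; lra.
  - by rewrite [Ca * Cb]mulrC -!mulrA ler_peMr ?mulr_ege1 //; lra.
  - by rewrite -mulrA mulrCA ler_peMr ?mulr_ege1 //; lra.
  - by rewrite ler_peMl ?mulr_ege1 //; lra.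
have C1 : 1 <= C by apply: le_trans CaC.
have [t t01 dec] := gap_decay FL rotF irr crF lev.
have [K K1 near] := gap_near FL rotF irr crF 1.
have [k0 hk0] := exp_small K t01 (@ltr01 R).
(* After [k0] pairs of levels the decay outweighs the constant [K] between left and right gaps; the
   additional level accounts for the passage from [n] to [n.+1] in the choice of levels. *)
pose M := (k0.*2).+1.
have [x0 hx0] := gap_min FL (e n0).
have v0 n := level_rval_gt0 lev n.
have gF n x : 0 < lift_gap F (e n) x := gap_gt0 rotF x (v0 n).
have gG n x : 0 < lift_gap G (e n) x := gap_gt0 rotG x (v0 n).
apply: (@symmetric_all_scales _ H (C * C ^+ M * C) (lift_gap F (e n0) x0)) => //.
move=> x s /andP[s0 st].
have [n [n1 /andP[n2 n3]]] : exists n, (n0 <= n)%N /\ lift_gap F (e n.+1) x <= s < lift_gap F (e n) x.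
  have [N hN] := gap_small FL rotF irr crF lev s0.
  apply: (@seq_crossing _ (fun n => lift_gap F (e n) x) s n0 (maxn n0 N)).
  - exact: lt_le_trans st (hx0 x).
  - by rewrite leq_maxl.
  - by apply: ltW; apply: hN; rewrite leq_maxr.
pose B n := x - lift_act F (- e n) x.
have BE n' : B n' = lift_gap F (e n') (lift_act F (- e n') x) by rewrite /B /lift_gap (actNK FL).
have [m [m1 /andP[m2 m3]]] : exists m, (n0 <= m)%N /\ B m.+1 <= s < B m.
  have [N hN] := gap_small FL rotF irr crF lev s0.
  apply: (@seq_crossing _ B s n0 (maxn n0 N)).
  - rewrite BE; exact: lt_le_trans st (hx0 _).
  - by rewrite leq_maxl.
  - by rewrite BE; apply: ltW; apply: hN; rewrite leq_maxr.
have BK k : B k <= K * lift_gap F (e k) x /\ lift_gap F (e k) x <= K * B k.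
  have [lk _] := lev k; have [|h1 h2 _] := near (e k) _ x (- e k) lk.
    by rewrite rvalN normrN gtr0_norm // mul1r.
  by rewrite BE.
have t0 : 0 < t by case/andP: t01.
have mn : (m <= n + M)%N.
  rewrite leqNgt; apply/negP => h.
  have h1 : lift_gap F (e m) x <= t ^+ k0 * lift_gap F (e n.+1) x by apply: dec; rewrite addSnnS; exact: ltnW.
  have [h2 _] := BK m.
  have h3 : K * lift_gap F (e m) x <= K * (t ^+ k0 * lift_gap F (e n.+1) x) by apply: ler_wpM2l => //; lra using K1.
  have h4 : K * t ^+ k0 * lift_gap F (e n.+1) x <= 1 * lift_gap F (e n.+1) x by apply: ler_wpM2r; exact: ltW.
  by rewrite -mulrA mul1r in h4; lra using h2 h3 h4 m3 n2.
have nm : (n <= m + M)%N.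
  rewrite leqNgt; apply/negP => h.
  have h1 : lift_gap F (e n) x <= t ^+ k0 * lift_gap F (e m.+1) x by apply: dec; rewrite addSnnS; exact: ltnW.
  have [_ h2] := BK m.+1.
  have h3 : t ^+ k0 * lift_gap F (e m.+1) x <= t ^+ k0 * (K * B m.+1).
    by apply: ler_wpM2l => //; rewrite exprn_ge0 // ltW.
  have B0 : 0 <= B m.+1 by rewrite BE ltW.
  have h4 : K * t ^+ k0 * B m.+1 <= 1 * B m.+1 by apply: ler_wpM2r => //; exact: ltW.
  by rewrite mul1r [K * _]mulrC -mulrA in h4; lra using h1 h3 h4 m2 n3.
pose r k := lift_gap G (e k) (H x) / lift_gap F (e k) x.
have r0 k : 0 < r k by rewrite divr_gt0.
have rstep k : (n0 <= k)%N -> r k <= C * r k.+1 /\ r k.+1 <= C * r k.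
  move=> hk; have [lk _] := lev k; rewrite /r !mulrA; split.
    rewrite ler_pdivrMr // mulrAC ler_pdivlMr // mulrC.
    apply: le_trans (ra _ _ x lk _ _) _.
    - by move=> y; have /tmE[] := sF k y hk.
    - by move=> y; have /tmE[] := sG k y hk.
    by rewrite [lift_gap F _ _ * _]mulrC mulrA; apply: ler_wpM2r; [exact: ltW|apply: ler_wpM2r => //; exact: ltW].
  rewrite ler_pdivrMr // mulrAC ler_pdivlMr //.
  apply: le_trans (rb _ _ x lk _ _) _.
  - by move=> y; have /tmE[] := sF k y hk.
  - by move=> y; have /tmE[] := sG k y hk.
  by rewrite mulrA; apply: ler_wpM2r; [exact: ltW|apply: ler_wpM2r => //; exact: ltW].
have rnm := bounded_steps C1 r0 rstep n1 m1 nm mn.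
have rmn := bounded_steps C1 r0 rstep m1 n1 mn nm.
have int k y z : (n0 <= k)%N -> lift_act F (- e k) x <= y -> lift_act F (e k.+1) y <= z -> z <= lift_act F (e k) x ->
    H z - H y <= C * (z - y) * r k /\ (z - y) * r k <= C * (H z - H y).
  move=> hk y1 yz z1; have [lk _] := lev k.
  have yz0 : 0 <= z - y.
    by rewrite subr_ge0; apply: le_trans yz; apply/ltW; exact: rotF.
  have Hyz0 : 0 <= H z - H y by rewrite subr_ge0 (F_le HL) -subr_ge0.
  rewrite /r; split.
    rewrite mulrA ler_pdivlMr // -mulrA; apply: le_trans (rc _ _ x y z lk _ _ y1 yz z1) _.
    - by move=> w; have /tmE[] := sF k w hk.
    - by move=> w; have /tmE[] := sG k w hk.
    by apply: ler_wpM2r => //; rewrite mulr_ge0 // ltW.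
  rewrite mulrA ler_pdivrMr // -mulrA.
  have := rd _ _ (H x) (H y) (H z) lk; rewrite !(FK HL) => h.
  apply: le_trans (h _ _ _ _ _) _.
  - by move=> w; have /tmE[] := sG k w hk.
  - by move=> w; have /tmE[] := sF k w hk.
  - by rewrite -(conj_act FL GL HL conj) (F_le HL).
  - by rewrite -(conj_act FL GL HL conj) (F_le HL).
  - by rewrite -(conj_act FL GL HL conj) (F_le HL).
  by apply: ler_wpM2r => //; rewrite mulr_ge0 // ltW.
have [a1 a2] : H (x + s) - H x <= C * s * r n /\ s * r n <= C * (H (x + s) - H x).
  have := int n x (x + s) n1; rewrite [x + s - x]addrC addKr; apply.
  - by have := gF n (lift_act F (- e n) x); rewrite -BE /B subr_gt0 => /ltW.
  - by move: n2; rewrite /lift_gap lerBlDl.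
  - by move: n3; rewrite /lift_gap ltrBrDl => /ltW.
have [b1 b2] : H x - H (x - s) <= C * s * r m /\ s * r m <= C * (H x - H (x - s)).
  have := int m (x - s) x m1; have -> : x - (x - s) = s by ring.
  apply.
  - by move: m3; rewrite /B => h; lra using h.
  - rewrite -(act_leN FL); move: m2; rewrite /B => h; lra using h.
  - by have := gF m x; rewrite /lift_gap subr_gt0 => /ltW.
have CM : 0 <= C ^+ M by rewrite exprn_ge0 //; lra using Ca1 CaC.
have s0' := ltW s0.
have fin (X Y u v : R) : X <= C * s * u -> u <= C ^+ M * v -> s * v <= C * Y -> X <= C * C ^+ M * C * Y.
  move=> h1 h2 h3; apply: le_trans h1 _.
  apply: (@le_trans _ _ (C * s * (C ^+ M * v))); first by apply: ler_wpM2l => //; rewrite mulr_ge0 //; lra.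
  have -> : C * s * (C ^+ M * v) = C * C ^+ M * (s * v) by ring.
  by rewrite -[leRHS]mulrA; apply: ler_wpM2l => //; rewrite mulr_ge0 //; lra.
by split; [exact: fin a1 rnm b2|exact: fin b1 rmn a2].
Qed.

End ConjugacyQs.

(** * Negative Schwarzian derivative and power laws *)

(** Compactness of [0, 1] with a single parameter t tending to 0, which serves as the radius and,
    through its inverse, as the constant; monotonicity of [P] allows this. Invariance under integer
    translations extends the result to the line. *)
Lemma local_uniform (R : realType) (P : R -> R -> R -> Prop) :
  (forall C C' a b a' b', C <= C' -> a <= a' -> b' <= b -> P C a b -> P C' a' b') ->
  (forall C a b (m : int), P C a b -> P C (a + m%:~R) (b + m%:~R)) ->
  (forall x, exists C t, 0 < t /\ P C (x - t) (x + t)) ->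
  exists C t, [/\ 0 < C, 0 < t & forall x, P C (x - t) (x + t)].
Proof.
move=> mono per loc.
have /compact_near_coveringP/(_ R (0:R)^'+ (fun t x => P t^-1 (x - t) (x + t)) _) := @segment_compact R 0 1.
move=> [|e /= e0 H].
  move=> x _; have [C [t [t0 Px]]] := loc x.
  pose u := Num.min (t / 2) (`|C| + 1)^-1.
  have c0 : 0 < `|C| + 1 by rewrite ltr_wpDl.
  have u0 : 0 < u by rewrite lt_min divr_gt0 // invr_gt0.
  have [ut uC] : u <= t / 2 /\ u <= (`|C| + 1)^-1 by rewrite !ge_min !lexx orbT.
  near=> y s; rewrite /=.
  have s0 : 0 < s by near: s; exact: nbhs_right_gt.
  have su : s < u by near: s; exact: nbhs_right_lt.
  have yx : `|x - y| < t / 2 by near: y; apply: (@cvgr_dist_lt _ _ _ (nbhs x) _ id) => //; lra.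
  move: yx; rewrite ltr_norml => /andP[h1 h2].
  apply: mono Px; [|lra|lra].
  apply: le_trans (ler_norm C) _; apply: (@le_trans _ _ (`|C| + 1)); first by rewrite lerDl.
  rewrite -[leLHS]invrK lef_pV2 ?posrE ?invr_gt0 //; lra.
have {}H s x : 0 < s < e -> 0 <= x <= 1 -> P s^-1 (x - s) (x + s).
  move=> /andP[s0 se] x01; have xI : x \in `[0, 1] by rewrite in_itv.
  by apply: (H s) => //=; rewrite sub0r normrN gtr0_norm.
exists (e / 2)^-1, (e / 2); rewrite invr_gt0 divr_gt0 //; split => // x.
have /andP[h1 h2] := mem_rg1_floor x.
have := H (e / 2) (x - (Num.floor x)%:~R); move=> /(_ _ _)/(per _ _ _ (Num.floor x)).
have -> : x - (Num.floor x)%:~R - e / 2 + (Num.floor x)%:~R = x - e / 2 by ring.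
have -> : x - (Num.floor x)%:~R + e / 2 + (Num.floor x)%:~R = x + e / 2 by ring.
apply; apply/andP; split; lra.
Unshelve. all: by end_near. Qed.

(** * Koebe-type estimates for F' = w^(-2) with [w] almost convex *)

Section Koebe.
Variables (R : realType) (F w w1 : R -> R) (a b C D : R).
Implicit Types (p x y : R).
Hypothesis Fd : forall x, a < x < b -> is_derive x 1 F (w x ^- 2).
Hypothesis wd : forall x, a < x < b -> is_derive x 1 w (w1 x).
Hypothesis w0 : forall x, a < x < b -> 0 < w x.
Hypothesis tangent : forall p y, a < p < b -> a < y < b ->
  w p + w1 p * (y - p) - D * (y - p) ^+ 2 <= w y.
Hypothesis C0 : 0 <= C.
Hypothesis D0 : 0 <= D.
Hypothesis DC : forall x, a < x < b -> D <= C * w x.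

(** With C = D = 0 this is the inequality F'(p) F'(x) (x - p)^2 <= (F x - F p)^2 for convex [w]. The
    function [g] decreases because the tangent to [w] at y, evaluated at [p], is at most
    [c * w p]. *)
Lemma koebe_product p x : a < p -> p < x -> x < b ->
  x - p <= (1 + C * (x - p) ^+ 2) * (w p * w x * (F x - F p)).
Proof.
move=> ap px xb; set c := 1 + _.
have c0 : 1 <= c by rewrite /c lerDl mulr_ge0 // sqr_ge0.
have inI y : p <= y <= x -> a < y < b by move=> /andP[h1 h2]; apply/andP; split; lra.
have wp : 0 < w p by apply: w0; apply: inI; rewrite lexx ltW.
pose g y := (y - p) / w y / w p - c * (F y - F p).
pose dg y := (w y - (y - p) * w1 y) / w y ^+ 2 / w p - c * w y ^- 2.
have gd y : a < y < b -> is_derive y 1 g (dg y).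
  move=> yI; have h1 := wd yI; have h2 := Fd yI; have wy := w0 yI.
  have wy0 : w y != 0 by rewrite gt_eqF.
  have h3 : is_derive y 1 (fun y => y - p) (1 - 0) by apply: is_deriveB.
  have h4 := is_deriveV wy0 h1.
  have h5 := is_deriveM h3 h4.
  have h6 : is_derive y 1 (fun=> (w p)^-1) 0 by apply: is_derive_cst.
  have h7 := is_deriveM h5 h6.
  have h8 : is_derive y 1 (fun y => c * (F y - F p)) (c * (w y ^- 2 - 0)).
    by apply: is_deriveZ; apply: is_deriveB.
  have h9 := is_deriveB h7 h8.
  apply: is_derive_eq h9 _; rewrite /dg /GRing.scale /=.
  by field; rewrite wy0 gt_eqF.
have : g x <= g p.
  apply: (@monotone_deriv _ g dg); first exact: ltW.
  - by move=> y /andP[h1 h2]; apply: gd; apply: inI; apply/andP; split; lra.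
  - by move=> y /inI/gd; exact: is_derive_continuous.
  move=> y yI; have yI' : a < y < b by apply: inI; case/andP: yI => *; apply/andP; split; lra.
  have wy := w0 yI'; have pI : a < p < b by apply/andP; split; lra.
  have T := tangent yI' pI; have DC' := DC pI.
  have h : w y - (y - p) * w1 y <= c * w p.
    have h1 : D * (p - y) ^+ 2 <= C * w p * (x - p) ^+ 2.
      apply: ler_pM => //; first exact: sqr_ge0.
      rewrite -[(p - y) ^+ 2]sqrrN opprB ler_sqr ?nnegrE; case/andP: yI => *; lra.
    have -> : c * w p = w p + C * w p * (x - p) ^+ 2 by rewrite /c; ring.
    by lra.
  have -> : dg y = ((w y - (y - p) * w1 y) / w p - c) * w y ^- 2.
    by rewrite /dg; field; rewrite !gt_eqF.
  by rewrite pmulr_lle0 ?invr_gt0 ?exprn_gt0 // subr_le0 ler_pdivrMr.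
have wx : 0 < w x by apply: w0; apply/andP; split; lra.
rewrite /g subrr mul0r mul0r subrr mulr0 subr0 subr_le0 ler_pdivrMr // ler_pdivrMr //.
by move=> h; apply: le_trans h _; rewrite le_eqVlt; apply/orP; left; apply/eqP; ring.
Qed.

(** Comparison with a Moebius map. The linear function [T] lies below [w] on [p, x], so [F] grows at
    most like (y - p) / (w p T y), whose derivative is T^(-2). If [T x] is not positive the bound is
    trivial. *)
Lemma koebe_quot_right p x : a < p -> p < x -> x < b ->
  (x - p)^-1 + w1 p / w p - C * (x - p) <= w p ^- 2 / (F x - F p).
Proof.
move=> ap px xb; have pI : a < p < b by apply/andP; split; lra.
have xI : a < x < b by apply/andP; split; lra.
have wp := w0 pI; have wx := w0 xI.
have r0 : 0 < x - p by lra.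
have wp0 : w p != 0 by rewrite gt_eqF.
have r0' : x - p != 0 by rewrite gt_eqF.
have inI y : p <= y <= x -> a < y < b by move=> /andP[h1 h2]; apply/andP; split; lra.
have G0 : 0 < F x - F p.
  have := koebe_product ap px xb; rewrite mulrA => h.
  rewrite -(pmulr_rgt0 _ (_ : 0 < (1 + C * (x - p) ^+ 2) * (w p * w x))); first by lra.
  by rewrite !mulr_gt0 // ltr_wpDr // mulr_ge0 // sqr_ge0.
pose s := w1 p - D * (x - p); pose T y := w p + s * (y - p).
have LT : (x - p)^-1 + w1 p / w p - C * (x - p) <= T x / (w p * (x - p)).
  have -> : T x / (w p * (x - p)) = (x - p)^-1 + w1 p / w p - D / w p * (x - p).
    by rewrite /T /s; field; rewrite r0' wp0.
  by rewrite lerD2l lerN2; apply: ler_wpM2r; [exact: ltW|rewrite ler_pdivrMr // DC].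
apply: le_trans LT _.
have [Tx|Tx] := leP (T x) 0.
  apply: (@le_trans _ _ 0); first by rewrite ler_pdivrMr ?mul0r // mulr_gt0.
  by rewrite mulr_ge0 ?invr_ge0 ?sqr_ge0 // ltW.
have T0 y : p <= y <= x -> 0 < T y.
  move=> /andP[y1 y2]; have [s0|s0] := leP 0 s.
    by rewrite /T ltr_wpDr // mulr_ge0 // subr_ge0.
  apply: lt_le_trans Tx _; rewrite /T lerD2l; apply: ler_wnM2l; [exact: ltW|lra].
pose g y := (F y - F p) - (y - p) / T y / w p.
have Td y : is_derive y 1 T s.
  have h3 : is_derive y 1 (fun y => y - p) (1 - 0) by apply: is_deriveB.
  have h : is_derive y 1 T (0 + s * (1 - 0)) by apply: is_deriveD; apply: is_deriveZ.
  by rewrite subr0 mulr1 add0r in h.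
have gd y : p <= y <= x -> is_derive y 1 g (w y ^- 2 - T y ^- 2).
  move=> yI; have Ty0 : T y != 0 by rewrite gt_eqF // T0.
  have h3 : is_derive y 1 (fun y => y - p) (1 - 0) by apply: is_deriveB.
  have h4 := is_deriveV Ty0 (Td y).
  have h5 := is_deriveM h3 h4.
  have h6 : is_derive y 1 (fun=> (w p)^-1) 0 by apply: is_derive_cst.
  have h7 := is_deriveM h5 h6.
  have h8 : is_derive y 1 (fun y => F y - F p) (w y ^- 2 - 0).
    by apply: is_deriveB; apply: Fd; exact: inI.
  have h9 := is_deriveB h8 h7.
  apply: is_derive_eq h9 _; rewrite /GRing.scale /=.
  have -> : w p = T y - s * (y - p) by rewrite /T; ring.
  field; rewrite Ty0 gt_eqF ?w0 ?inI // /T.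
  by have -> : w p + s * (y - p) - s * (y - p) = w p by ring.
have : g x <= g p.
  apply: (@monotone_deriv _ g (fun y => w y ^- 2 - T y ^- 2)); first exact: ltW.
  - by move=> y /andP[h1 h2]; apply: gd; rewrite !ltW.
  - by move=> y /gd; exact: is_derive_continuous.
  move=> y /andP[y1 y2]; have yI : p <= y <= x by rewrite !ltW.
  have wy := w0 (inI _ yI); have Ty := T0 _ yI.
  rewrite subr_le0 lef_pV2 ?posrE ?exprn_gt0 //.
  rewrite ler_sqr ?nnegrE; [|exact: ltW|exact: ltW].
  have := tangent pI (inI _ yI); apply: le_trans; rewrite /T /s.
  have : D * (y - p) * (y - p) <= D * (y - p) * (x - p).
    by apply: ler_wpM2l; [apply: mulr_ge0 => //|]; lra.
  by rewrite expr2 => h; lra.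
rewrite /g !subrr !mul0r subr0 subr_le0 => h.
rewrite ler_pdivrMr ?mulr_gt0 // mulrAC ler_pdivlMr //.
have -> : w p ^- 2 * (w p * (x - p)) = (x - p) / w p by field.
by rewrite -ler_pdivlMl // mulrC mulrAC.
Qed.

End Koebe.

Section KoebeQuot.
Variables (R : realType) (F dF w w1 : R -> R) (a b C D : R).
Implicit Types (p x y : R).
Hypothesis Fi : {homo F : x y / x < y}.
Hypothesis Fc : continuous F.
Hypothesis dFE : forall x, a < x < b -> dF x = w x ^- 2.
Hypothesis Fd : forall x, a < x < b -> is_derive x 1 F (dF x).
Hypothesis wd : forall x, a < x < b -> is_derive x 1 w (w1 x).
Hypothesis w0 : forall x, a < x < b -> 0 < w x.
Hypothesis tangent : forall p y, a < p < b -> a < y < b ->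
  w p + w1 p * (y - p) - D * (y - p) ^+ 2 <= w y.
Hypothesis C0 : 0 <= C.
Hypothesis D0 : 0 <= D.
Hypothesis DC : forall x, a < x < b -> D <= C * w x.
Hypothesis ab1 : b - a <= 1.

Let Fd' x : a < x < b -> is_derive x 1 F (w x ^- 2).
Proof. by move=> xI; rewrite -dFE //; exact: Fd. Qed.

Lemma koebe_quot_left p x : a < x -> x < p -> p < b ->
  (p - x)^-1 - w1 p / w p - C * (p - x) <= w p ^- 2 / (F p - F x).
Proof.
move=> ax xp pb.
have N y : - b < y < - a -> a < - y < b by move=> /andP[*]; apply/andP; split; lra.
have comp (f : R -> R) y d : is_derive (- y) 1 f d -> is_derive y 1 (f \o -%R) (- d).
  move=> hf; have hN : is_derive y 1 (-%R : R -> R) (- 1) by exact: is_deriveNid.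
  by rewrite -mulrN1; apply: is_derive1_comp.
have := @koebe_quot_right _ (fun y => - F (- y)) (fun y => w (- y)) (fun y => - w1 (- y))
  (- b) (- a) C D _ _ _ _ C0 D0 _ (- p) (- x).
rewrite !opprK !ltrN2 mulNr => h.
have E1 : - x + p = p - x by ring.
have E2 : - F x + F p = F p - F x by ring.
rewrite E1 E2 in h; apply: h => //.
- by move=> y /N/Fd'/comp/is_deriveN; rewrite opprK.
- by move=> y /N/wd/comp.
- by move=> y /N/w0.
- move=> q y /N qI /N yI; have := tangent qI yI; rewrite -[(- y - - q) ^+ 2]sqrrN.
  have -> : - (- y - - q) = y - q by ring.
  have -> : w1 (- q) * (- y - - q) = - w1 (- q) * (y - q) by ring.
  done.
- by move=> y /N/DC.
Qed.

(** Satisfies (1 + C r^2)^2 <= 1 + K r^2 for 0 <= r <= 1, which turns the factor in [koebe_product]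
    into an additive error. *)
Let K := 2 * C + C ^+ 2.

(** The derivative of the quotient at z is F'(p) F'(z) / (F p - F z)^2 - (p - z)^(-2), and
    [koebe_product] bounds it by [K]. *)
Lemma quot_side p x y : a < p < b -> a <= x -> x < y -> y <= b -> (p < x \/ y < p) ->
  quot F dF p y <= quot F dF p x + K * (y - x).
Proof.
move=> pI ax xy yb side; have /andP[ap pb] := pI.
have np z : x <= z <= y -> z != p.
  by move=> /andP[h1 h2]; case: side => h; [rewrite gt_eqF|rewrite lt_eqF] => //; lra.
have Fp z : z != p -> F p - F z != 0.
  by rewrite neq_lt subr_eq0 => /orP[/Fi h|/Fi h]; [rewrite gt_eqF|rewrite lt_eqF].
pose g z := quot F dF p z - K * z.
pose dg z := dF p * dF z / (F p - F z) ^+ 2 - (p - z) ^- 2 - K.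
have gc z : x <= z <= y -> {for z, continuous g}.
  move=> /np zp; have h := Fp _ zp; have zp' : p - z != 0 by rewrite subr_eq0 eq_sym.
  apply: continuousB; last by apply: continuousM; [exact: cst_continuous|exact: cvg_id].
  apply: continuousB.
    apply: continuousM; first exact: cst_continuous.
    by apply: continuousV => //; apply: continuousB; [exact: cst_continuous|exact: Fc].
  by apply: continuousV => //; apply: continuousB; [exact: cst_continuous|exact: cvg_id].
have gd z : x < z < y -> is_derive z 1 g (dg z).
  move=> /andP[z1 z2]; have zI : a < z < b by apply/andP; split; lra.
  have zp : z != p by apply: np; rewrite !ltW.
  have h := Fp _ zp; have zp' : p - z != 0 by rewrite subr_eq0 eq_sym.
  have h1 : is_derive z 1 (fun z => F p - F z) (0 - dF z) by apply: is_deriveB; exact: Fd.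
  have h2 : is_derive z 1 (fun z => p - z) (0 - 1) by apply: is_deriveB.
  have h3 := @is_deriveV _ (fun z => F p - F z) _ _ _ h h1; have h4 := @is_deriveV _ (fun z => p - z) _ _ _ zp' h2.
  have h5 : is_derive z 1 (fun z => dF p / (F p - F z)) (dF p *: (- (F p - F z) ^- 2 *: (0 - dF z))).
    by apply: is_deriveZ.
  have h6 := is_deriveB h5 h4.
  have h7 : is_derive z 1 (fun z => K * z) (K *: 1) by apply: is_deriveZ.
  have h8 := is_deriveB h6 h7.
  apply: is_derive_eq h8 _; rewrite /dg /GRing.scale /=.
  by ring.
have : g y <= g x.
  apply: (@monotone_deriv _ g dg) => //; first exact: ltW.
  move=> z /andP[z1 z2]; have zI : a < z < b by apply/andP; split; lra.
  have zp : z != p by apply: np; rewrite !ltW.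
  have wp := w0 pI; have wz := w0 zI.
  have zp' : p - z != 0 by rewrite subr_eq0 eq_sym.
  have key (r G : R) : 0 < r -> 0 < G -> r <= 1 ->
      r <= (1 + C * r ^+ 2) * (w p * w z * G) -> dF p * dF z / G ^+ 2 - r ^- 2 - K <= 0.
    move=> r0 G0 r1 h; rewrite !dFE //.
    have h2 : r ^+ 2 <= ((1 + C * r ^+ 2) * (w p * w z * G)) ^+ 2.
      by rewrite ler_sqr ?nnegrE //; [exact: ltW|apply: le_trans h; exact: ltW].
    have X0 : 0 < (w p * w z * G) ^+ 2 * r ^+ 2 by rewrite !mulr_gt0 // exprn_gt0 // !mulr_gt0.
    have -> : w p ^- 2 * w z ^- 2 / G ^+ 2 - r ^- 2 - K =
      (r ^+ 2 - (1 + K * r ^+ 2) * (w p * w z * G) ^+ 2) / ((w p * w z * G) ^+ 2 * r ^+ 2).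
      by field; rewrite !gt_eqF.
    rewrite pmulr_lle0 ?invr_gt0 // subr_le0; apply: le_trans h2 _.
    rewrite exprMn; apply: ler_wpM2r; first exact: sqr_ge0.
    have r2 : r ^+ 2 <= 1 by rewrite expr_le1 // ltW.
    have : (C * r) ^+ 2 * r ^+ 2 <= (C * r) ^+ 2 by apply: ler_piMr => //; exact: sqr_ge0.
    rewrite /K; have -> : (1 + C * r ^+ 2) ^+ 2 = 1 + 2 * C * r ^+ 2 + (C * r) ^+ 2 * r ^+ 2 by ring.
    have -> : 1 + (2 * C + C ^+ 2) * r ^+ 2 = 1 + 2 * C * r ^+ 2 + (C * r) ^+ 2 by ring.
    lra.
  rewrite /dg; have [pz|zp2] : p < z \/ z < p by case: side => ?; [left|right]; lra.
    have -> : (F p - F z) ^+ 2 = (F z - F p) ^+ 2 by ring.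
    have -> : (p - z) ^- 2 = (z - p) ^- 2 by rewrite -sqrrN opprB.
    apply: key; rewrite ?subr_gt0 ?Fi //; first by have := ab1; case/andP: zI => *; lra.
    apply: (koebe_product Fd' wd w0 tangent C0 D0 DC ap pz).
    by case/andP: zI.
  apply: key; rewrite ?subr_gt0 ?Fi //; first by have := ab1; case/andP: zI => *; lra.
  rewrite [w p * w z]mulrC; apply: (koebe_product Fd' wd w0 tangent C0 D0 DC _ zp2 pb).
  by case/andP: zI.
rewrite /g; lra.
Qed.

(** The quotient is singular at [p]. Points on different sides are compared through the common value
    - w1 p / w p, to which the one-sided estimates relate the quotient at intermediate points on
    both sides. *)
Lemma koebe_quot p x y : a < p < b -> a <= x -> x < y -> y <= b -> x != p -> y != p ->
  quot F dF p y <= quot F dF p x + K * (y - x).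
Proof.
move=> pI ax xy yb xp yp; have /andP[ap pb] := pI.
have [px|px] := ltP p x; first by apply: quot_side => //; left.
have [py|py] := ltP y p; first by apply: quot_side => //; right.
have {}xp : x < p by rewrite lt_neqAle xp px.
have {}py : p < y by rewrite lt_neqAle eq_sym yp py.
have h1 : quot F dF p ((x + p) / 2) <= quot F dF p x + K * ((x + p) / 2 - x).
  by apply: quot_side => //; [lra|lra|right; lra].
have h2 : quot F dF p y <= quot F dF p ((p + y) / 2) + K * (y - (p + y) / 2).
  by apply: quot_side => //; [lra|lra|left; lra].
move: h1 h2; set u := (x + p) / 2; set v := (p + y) / 2 => h1 h2.
have u1 : a < u by rewrite /u; lra. have u2 : u < p by rewrite /u; lra.
have v1 : p < v by rewrite /v; lra. have v2 : v < b by rewrite /v; lra.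
have h3 := koebe_quot_left u1 u2 pb.
have h4 := koebe_quot_right Fd' wd w0 tangent C0 D0 DC ap v1 v2.
have CK : C * (v - u) <= K * (v - u).
  by apply: ler_wpM2r; [lra|rewrite /K; have := sqr_ge0 C; have := C0; lra].
have : quot F dF p v <= - (w1 p / w p) + C * (v - p).
  rewrite /quot dFE // -[F p - F v]opprB -[p - v]opprB !invrN mulrN; lra.
have : - (w1 p / w p) - C * (p - u) <= quot F dF p u.
  rewrite /quot dFE //; lra.
by lra.
Qed.

End KoebeQuot.

Lemma convex_tangent (R : realType) (h h1 h2 : R -> R) (a b D : R) :
  (forall x : R, a < x < b -> is_derive x 1 h (h1 x)) ->
  (forall x : R, a < x < b -> is_derive x 1 h1 (h2 x)) ->
  (forall x : R, a < x < b -> - (2 * D) <= h2 x) ->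
  forall p y, a < p < b -> a < y < b -> h p + h1 p * (y - p) - D * (y - p) ^+ 2 <= h y.
Proof.
move=> hd h1d h2D p y pI yI.
have mono u v : a < u < b -> a < v < b -> u < v -> 0 <= (h1 v + 2 * D * v) - (h1 u + 2 * D * u).
  move=> /andP[u1 u2] /andP[v1 v2] uv.
  have gd z : a < z < b -> is_derive z 1 (fun z => h1 z + 2 * D * z) (h2 z + 2 * D * 1).
    move=> zI; have hz := h1d z zI.
    have hk : is_derive z 1 (fun z : R => 2 * D * z) (2 * D *: (1 : R)) by apply: is_deriveZ.
    exact: is_deriveD.
  have [|z zI|c /andP[c1 c2] ->] := mvt uv (f := fun z => h1 z + 2 * D * z) (df := fun z => h2 z + 2 * D * 1).
  - by move=> z /andP[z1 z2]; apply: gd; apply/andP; split; lra.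
  - by move: zI => /andP[z1 z2]; apply: is_derive_continuous (gd z _); apply/andP; split; lra.
  have cI : a < c < b by apply/andP; split; lra.
  by apply: mulr_ge0; [rewrite mulr1; have := h2D c cI|]; lra.
have gd z : a < z < b -> is_derive z 1 (fun z => h z + D * (z - p) ^+ 2) (h1 z + 2 * D * (z - p)).
  move=> zI; have e1 : is_derive z 1 (fun z => z - p) (1 - 0) by apply: is_deriveB.
  have e2 := is_deriveM e1 e1.
  have e3 : is_derive z 1 (fun z => h z + D * ((z - p) * (z - p))) (h1 z + D *: ((z - p) *: (1 - 0) + (z - p) *: (1 - 0))).
    have e3 := hd z zI.
    have e4 : is_derive z 1 (fun z : R => D * ((z - p) * (z - p))) (D *: ((z - p) *: ((1 : R) - 0) + (z - p) *: ((1 : R) - 0))).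
      by apply: is_deriveZ.
    exact: is_deriveD.
  by apply: is_derive_eq e3 _; rewrite /GRing.scale /=; ring.
have := pI; have := yI; move=> /andP[y1 y2] /andP[p1 p2].
have gc z : a < z < b -> {for z, continuous (fun z => h z + D * (z - p) ^+ 2)}.
  by move=> /gd; exact: is_derive_continuous.
have [py|yp|<-] := ltgtP p y; last by rewrite subrr expr0n /= !mulr0 addr0 subr0.
  have [|z zI|c /andP[c1 c2]] := mvt py (f := fun z => h z + D * (z - p) ^+ 2) (df := fun z => h1 z + 2 * D * (z - p)).
  - by move=> z /andP[z1 z2]; apply: gd; apply/andP; split; lra.
  - by move: zI => /andP[z1 z2]; apply: gc; apply/andP; split; lra.
  rewrite subrr expr0n /= mulr0 addr0 => E.
  have cI : a < c < b by apply/andP; split; lra.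
  have := mono p c pI cI c1; rewrite -(pmulr_lge0 _ (_ : 0 < y - p)) ?subr_gt0 // => M.
  have : h y + D * (y - p) ^+ 2 - h p = (h1 c + 2 * D * (c - p)) * (y - p) by [].
  have -> : (h1 c + 2 * D * (c - p)) * (y - p) = (h1 c + 2 * D * c - (h1 p + 2 * D * p)) * (y - p) + h1 p * (y - p) by ring.
  lra.
have [|z zI|c /andP[c1 c2]] := mvt yp (f := fun z => h z + D * (z - p) ^+ 2) (df := fun z => h1 z + 2 * D * (z - p)).
- by move=> z /andP[z1 z2]; apply: gd; apply/andP; split; lra.
- by move: zI => /andP[z1 z2]; apply: gc; apply/andP; split; lra.
rewrite subrr expr0n /= mulr0 addr0 => E.
have cI : a < c < b by apply/andP; split; lra.
have := mono c p cI pI c2; rewrite -(pmulr_lge0 _ (_ : 0 < p - y)) ?subr_gt0 // => M.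
move: E; have -> : (h1 c + 2 * D * (c - p)) * (p - y) =
  - ((h1 p + 2 * D * p - (h1 c + 2 * D * c)) * (p - y)) + h1 p * (p - y) by ring.
have -> : h1 p * (y - p) = - (h1 p * (p - y)) by ring.
lra.
Qed.

(** * Tameness from the local form at critical points *)

Section Tame.
Variables (R : realType) (F F1 F2 F3 : R -> R) (cs : seq R).
Implicit Types (a b c p x y z : R).
Hypothesis FL : circle_lift_map F.
Hypothesis d1 : forall x : R, is_derive x 1 F (F1 x).
Hypothesis d2 : forall x : R, is_derive x 1 F1 (F2 x).
Hypothesis d3 : forall x : R, is_derive x 1 F2 (F3 x).
Hypothesis F3c : continuous F3.
Hypothesis F1_ge0 : forall x, 0 <= F1 x.
Hypothesis crit_list : forall x, F1 x = 0 -> exists2 c, c \in cs & exists m : int, x = c + m%:~R.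

(** The Schwarzian derivative after the differentiation of F''/F' has been carried out. *)
Let S x := F3 x / F1 x - 3 / 2 * (F2 x / F1 x) ^+ 2.

Hypothesis crit_local : forall c, F1 c = 0 -> exists e A B s : R,
  [/\ 0 < e, 0 < A, A < B, 1 < s & forall y, 0 < `|y - c| < e ->
    [/\ S y < 0, A * `|y - c| `^ (s - 1) < F1 y & F1 y < B * `|y - c| `^ (s - 1)]].

Let F_cont : continuous F. Proof. by move=> x; exact: is_derive_continuous. Qed.
Let F1c : continuous F1. Proof. by move=> x; exact: is_derive_continuous. Qed.
Let F2c : continuous F2. Proof. by move=> x; exact: is_derive_continuous. Qed.

Let F1_per x (m : int) : F1 (x + m%:~R) = F1 x.
Proof. exact: deriv_periodic. Qed.

Lemma F_mvt p r : p < r -> exists2 c, p < c < r & F r - F p = F1 c * (r - p).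
Proof. by move=> pr; apply: mvt => // x _; exact: F_cont. Qed.

Lemma F_mvt_abs c y : y != c ->
  exists w, 0 < `|w - c| <= `|y - c| /\ `|F y - F c| = F1 w * `|y - c|.
Proof.
move=> yc; have [h|h|E] := ltgtP y c; last by rewrite E eqxx in yc.
  have [w /andP[w1 w2] E] := F_mvt h; exists w; split.
    by rewrite !ltr0_norm ?subr_lt0 // oppr_gt0 subr_lt0 w2 lerN2 lerD2r ltW.
  by rewrite distrC E normrM ger0_norm // distrC.
have [w /andP[w1 w2] E] := F_mvt h; exists w; split.
  by rewrite !gtr0_norm ?subr_gt0 // w1 lerD2r ltW.
by rewrite E normrM ger0_norm.
Qed.

Lemma F1_noncrit x : F1 x <> 0 -> exists2 t, 0 < t & forall y, `|y - x| < t ->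
  F1 x / 2 < F1 y < 2 * F1 x.
Proof.
move=> x0; have F10 : 0 < F1 x by rewrite lt_neqAle F1_ge0 andbT eq_sym; apply/eqP.
have /cvgrPdist_lt/(_ (F1 x / 2)) := @F1c x; rewrite divr_gt0 // => /(_ isT)[t /= t0 H].
exists t => // y yx; have := H y; rewrite /= distrC => /(_ yx).
by rewrite ltr_norml => /andP[h1 h2]; apply/andP; split; lra.
Qed.

(** Let l be the larger distance of [p] and [r] from [c]. The slope at [y] is at most B l^(s-1). The
    quarter of [p, r] next to the farther end keeps a distance of at least l/2 from [c], so the
    slope there is at least A h l^(s-1); this quarter alone yields the constant. *)
Lemma crit_mean c e A B s : F1 c = 0 -> 0 < A -> A < B -> 1 < s ->
  (forall y, 0 < `|y - c| < e ->
    [/\ S y < 0, A * `|y - c| `^ (s - 1) < F1 y & F1 y < B * `|y - c| `^ (s - 1)]) ->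
  exists C, forall p r y, c - e < p -> r < c + e -> p <= y <= r -> p < r ->
    F1 y * (r - p) <= C * (F r - F p).
Proof.
move=> c0 A0 AB s1 H; pose h : R := 2^-1 `^ (s - 1).
have h0 : 0 < h by rewrite powR_gt0.
exists (4 * B / (A * h)) => p r y pe re /andP[py yr] pr.
pose l := Num.max `|p - c| `|r - c|.
have [lp lr] : `|p - c| <= l /\ `|r - c| <= l by rewrite !le_max !lexx orbT.
have s0 : 0 <= s - 1 by lra using s1.
have l0 : 0 < l.
  rewrite lt_neqAle le_max normr_ge0 andbT eq_sym; apply/eqP => E.
  by move: lp lr; rewrite E !normr_le0 => /eqP ? /eqP ?; lra.
have mono u v : 0 <= u -> u <= v -> u `^ (s - 1) <= v `^ (s - 1).
  by move=> u0 uv; apply: ge0_ler_powR; rewrite ?nnegrE //; exact: le_trans uv.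
have le : l < e.
  by rewrite gt_max !ltr_norml; apply/andP; split; apply/andP; split; lra using pe py re yr.
have yl : `|y - c| <= l.
  move: lp lr; rewrite !ler_norml => /andP[? ?] /andP[? ?]; apply/andP; split; lra.
have up : F1 y <= B * l `^ (s - 1).
  have B0 : 0 <= B by lra using A0 AB.
  have [E|yc] := eqVneq y c; first by rewrite E c0 mulr_ge0 ?powR_ge0.
  have [|_ _ /ltW yB] := H y; first by rewrite normr_gt0 subr_eq0 yc /=; exact: le_lt_trans le.
  by apply: le_trans yB _; apply: ler_wpM2l => //; apply: mono.
have low z : p < z < r -> l / 2 <= `|z - c| -> A * (h * l `^ (s - 1)) <= F1 z.
  move=> /andP[z1 z2] zl; have zl' : `|z - c| <= l.
    move: lp lr; rewrite !ler_norml => /andP[? ?] /andP[? ?]; apply/andP; split; lra.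
  have [|_ /ltW zA _] := H z; first by apply/andP; split; lra using l0 le zl zl'.
  apply: le_trans zA; apply: ler_wpM2l; first exact: ltW.
  have -> : h * l `^ (s - 1) = (l / 2) `^ (s - 1) by rewrite [l / 2]mulrC powRM ?invr_ge0 // ltW.
  by apply: mono => //; lra using l0.
pose d := (r - p) / 4.
have [u [v [pu vr uv far]]] : exists u v, [/\ p <= u, v <= r, v - u = d & forall z, u < z < v -> l / 2 <= `|z - c|].
  have [h1|h1] := leP `|p - c| `|r - c|.
    have E : l = `|r - c| by apply/max_idPr.
    have rc : 0 <= r - c.
      rewrite leNgt; apply/negP => rc; move: h1; rewrite (ltr0_norm rc) ltr0_norm; lra using pr py rc yr.
    exists (r - d), r; split; rewrite /d; try lra.
    move=> z /andP[z1 z2]; rewrite E (ger0_norm rc).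
    apply: le_trans (ler_norm _); move: h1; rewrite (ger0_norm rc) ler_norml => /andP[? ?]; lra.
  have E : l = `|p - c| by apply/max_idPl/ltW.
  have pc : p - c <= 0.
    rewrite leNgt; apply/negP => pc; move: h1; rewrite (gtr0_norm pc) gtr0_norm; lra using pc py yr.
  exists p, (p + d); split; rewrite /d; try lra.
  move=> z /andP[z1 z2]; rewrite E (ler0_norm pc) -normrN.
  apply: le_trans (ler_norm _); move: h1; rewrite (ler0_norm pc) ltr_norml => /andP[? ?]; lra.
have d0 : 0 < d by rewrite /d; lra using pr.
have uv' : u < v by lra using d0 uv.
have [z zI E] := F_mvt uv'.
have zI' : p < z < r by case/andP: zI => *; apply/andP; split; lra.
have Fz := low z zI' (far z zI).
have G : A * (h * l `^ (s - 1)) * d <= F r - F p.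
  have Fv : F v <= F r by rewrite (F_le FL).
  have Fu : F p <= F u by rewrite (F_le FL).
  apply: (@le_trans _ _ (F v - F u)); last by lra using Fu Fv.
  by rewrite E uv; apply: ler_wpM2r => //; exact: ltW.
have K0 : 0 < A * h by rewrite mulr_gt0.
rewrite mulrAC ler_pdivlMr //.
apply: (@le_trans _ _ (4 * B * (A * (h * l `^ (s - 1)) * d))); last by apply: ler_wpM2l => //; lra using A0 AB.
have -> : 4 * B * (A * (h * l `^ (s - 1)) * d) = (B * l `^ (s - 1)) * (r - p) * (A * h) by rewrite /d; field.
apply: ler_wpM2r; first exact: ltW.
by apply: ler_wpM2r => //; lra using py yr.
Qed.

(** The mean slope over an interval controls every slope in it. Short intervals are covered by the
    power law or by continuity, longer ones by periodic extrema, and very long ones by linear growth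
    of the lift. *)
Lemma deriv_mean : exists2 C : R, 1 <= C & forall p r y, p <= y <= r -> p < r ->
  F1 y * (r - p) <= C * (F r - F p).
Proof.
pose P C a b := forall p r y, a <= p -> r <= b -> p <= y <= r -> p < r ->
  F1 y * (r - p) <= C * (F r - F p).
have [] := @local_uniform R P.
- move=> C C' a b a' b' CC aa bb H p r y ap rb py pr.
  apply: le_trans (H p r y _ _ py pr) _; [lra|lra|].
  by apply: ler_wpM2r => //; rewrite subr_ge0 (F_le FL) ltW.
- move=> C a b m H p r y ap rb /andP[py yr] pr.
  have := H (p + (- m)%:~R) (r + (- m)%:~R) (y + (- m)%:~R).
  rewrite !(F_int FL) F1_per.
  have E (u v k : R) : u + k - (v + k) = u - v by ring.
  rewrite !E mulrNz; apply; try (apply/andP; split); lra.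
- move=> x; have [x0|x0] := pselect (F1 x = 0).
    have [e [A [B [s [e0 A0 AB s1 H]]]]] := crit_local x0.
    have [C HC] := crit_mean x0 A0 AB s1 H.
    exists C, (e / 2); split; first by rewrite divr_gt0.
    by move=> p r y h1 h2 h3 h4; apply: HC => //; lra.
  have [t t0 H] := F1_noncrit x0.
  exists 4, (t / 2); split; first by rewrite divr_gt0.
  move=> p r y h1 h2 /andP[h3 h4] pr; have [c /andP[c1 c2] ->] := F_mvt pr.
  rewrite mulrA; apply: ler_wpM2r; first by lra.
  have := H y; have := H c; rewrite !ltr_norml => /(_ _)/andP[|c3 c4]; first by apply/andP; split; lra.
  by move=> /(_ _)/andP[|y3 y4]; [apply/andP; split; lra|lra].
move=> C [t [C0 t0 H]].
have [xm hm] : exists xm, forall x, - F1 xm <= - F1 x.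
  apply: (@periodic_min _ (fun x => - F1 x)); first by move=> x; apply: continuousN; exact: F1c.
  by move=> x m; rewrite F1_per.
have [xu hu] : exists xu, forall x, F (xu + t) - F xu <= F (x + t) - F x.
  apply: (@periodic_min _ (fun x => F (x + t) - F x)).
    move=> x; apply: continuousB; last exact: F_cont.
    apply: continuous_comp; last exact: F_cont.
    by apply: continuousD; [exact: cvg_id|exact: cst_continuous].
  by move=> x m; rewrite addrAC !(F_int FL); ring.
move: hm hu; set M := F1 xm; set mu := F (xu + t) - F xu => hm hu.
have M0 : 0 <= M by exact: F1_ge0.
have mu0 : 0 < mu by rewrite subr_gt0 (F_lt FL); lra.
have K1 : 0 <= 2 * M / mu by rewrite !mulr_ge0 ?invr_ge0 // ltW.
exists (1 + C + 2 * M / mu + 2 * M); first by lra.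
move=> p r y pyr pr; have D0 : 0 <= F r - F p by rewrite subr_ge0 (F_le FL) ltW.
have weak K : K <= 1 + C + 2 * M / mu + 2 * M -> F1 y * (r - p) <= K * (F r - F p) ->
    F1 y * (r - p) <= (1 + C + 2 * M / mu + 2 * M) * (F r - F p).
  by move=> h1 h2; apply: le_trans h2 _; apply: ler_wpM2r.
have Fy : F1 y * (r - p) <= M * (r - p) by apply: ler_wpM2r; [lra|have := hm y; lra].
have [short|long] := leP (r - p) t.
  apply: (weak C); first by lra.
  by apply: (H ((p + r) / 2)) => //; lra.
have lo : mu <= F r - F p.
  apply: le_trans (hu p) _; rewrite lerD2r (F_le FL); lra.
have [h2|h2] := leP (r - p) 2.
  apply: (weak (2 * M / mu)); first by lra.
  apply: le_trans Fy _; apply: (@le_trans _ _ (2 * M)).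
    by rewrite mulrC; apply: ler_wpM2r.
  have : 2 * M / mu * mu <= 2 * M / mu * (F r - F p) by apply: ler_wpM2l.
  by rewrite divfK // gt_eqF.
apply: (weak (2 * M)); first by lra.
apply: le_trans Fy _; rewrite mulrAC [leRHS]mulrC; apply: ler_wpM2l => //.
have /andP[h _] := lift_growth FL p (r - p).
have E : p + (r - p) = r by ring.
by rewrite E in h; lra.
Qed.

(** The power law bounds |F y - F c| by B |y - c|^s, and [deriv_mean] bounds |F z - F c| below by A
    |z - c|^s / C0. The quotient gains the factor (|y - c| / |z - c|)^(s-1), and [L] is the ratio of
    distances beyond which this gain yields [eps]. *)
Lemma tame_contraction : crit_contraction F [set x | F1 x = 0].
Proof.
have [C0 C01 mean] := deriv_mean; have C00 : 0 < C0 by lra.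
move=> eps eps0.
pose P C a b := forall c y z, F1 c = 0 -> a <= c <= b -> a <= z <= b -> 0 < (y - c) * (z - c) ->
  C * `|y - c| <= `|z - c| -> `|F y - F c| * `|z - c| <= eps * `|y - c| * `|F z - F c|.
have [] := @local_uniform R P.
- move=> C C' a b a' b' CC aa bb H c y z c0 /andP[c1 c2] /andP[z1 z2] yz hC.
  apply: H => //; [by apply/andP; split; lra|by apply/andP; split; lra|].
  by apply: le_trans hC; apply: ler_wpM2r.
- move=> C a b m H c y z c0 /andP[c1 c2] /andP[z1 z2] yz hC.
  have := H (c + (- m)%:~R) (y + (- m)%:~R) (z + (- m)%:~R).
  have E (u v k : R) : u + k - (v + k) = u - v by ring.
  rewrite !(F_int FL) F1_per !E mulrNz; apply => //; apply/andP; split; lra.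
- move=> x; have [x0|x0] := pselect (F1 x = 0); last first.
    have [t t0 H] := F1_noncrit x0; exists 0, (t / 2); split; first by rewrite divr_gt0.
    move=> c y z c0 /andP[c1 c2]; have := H c; rewrite c0 ltr_norml => /(_ _)/andP[|h1 h2].
      by apply/andP; split; lra.
    by have := F1_ge0 x; lra.
  have [e [A [B [s [e0 A0 AB s1 H]]]]] := crit_local x0.
  have s0 : 0 <= s - 1 by lra.
  have B0 : 0 < B by lra.
  pose L := (B * C0 / (eps * A)) `^ (s - 1)^-1.
  have L0 : 0 <= L by exact: powR_ge0.
  exists (1 + L), (e / 2); split; first by rewrite divr_gt0.
  move=> c y z c0 /andP[c1 c2] /andP[z1 z2] yz hC.
  (* The lower power bound leaves no other critical point in the neighbourhood. *)
  have ex : x = c.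
    apply/eqP; rewrite eq_sym; apply/negPn/negP => cx.
    have [|_ h _] := H c; first by rewrite normr_gt0 subr_eq0 cx /= ltr_norml; apply/andP; split; lra.
    by have := powR_ge0 `|c - x| (s - 1); rewrite c0 in h; rewrite -(pmulr_rge0 _ A0); lra.
  subst x.
  have yc : y != c by apply: contraTneq yz => ->; rewrite subrr mul0r ltxx.
  have zc : z != c by apply: contraTneq yz => ->; rewrite subrr mulr0 ltxx.
  have Y0 : 0 < `|y - c| by rewrite normr_gt0 subr_eq0.
  have Z0 : 0 < `|z - c| by rewrite normr_gt0 subr_eq0.
  have Ze : `|z - c| < e by rewrite ltr_norml; apply/andP; split; lra.
  have Lpos : 0 <= L * `|y - c| by rewrite mulr_ge0.
  rewrite mulrDl mul1r in hC.
  have mono u v : 0 <= u -> u <= v -> u `^ (s - 1) <= v `^ (s - 1).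
    by move=> u0 uv; apply: ge0_ler_powR; rewrite ?nnegrE //; exact: le_trans uv.
  have hy : `|F y - F c| <= B * `|y - c| `^ (s - 1) * `|y - c|.
    have [w [w1 ->]] := F_mvt_abs yc.
    have /andP[w2 w3] := w1; have [|_ _ /ltW h] := H w; first by rewrite w2 /=; lra.
    apply: ler_wpM2r; first exact: ltW.
    by apply: le_trans h _; apply: ler_wpM2l; [exact: ltW|apply: mono].
  have hz : A * `|z - c| `^ (s - 1) * `|z - c| <= C0 * `|F z - F c|.
    have [|_ /ltW h _] := H z; first by rewrite Z0.
    apply: (@le_trans _ _ (F1 z * `|z - c|)); first by apply: ler_wpM2r => //; exact: ltW.
    have [h'|h'|E] := ltgtP z c; last by rewrite E eqxx in zc.
      have hF : F z < F c by rewrite (F_lt FL).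
      rewrite !ltr0_norm ?subr_lt0 // !opprB; apply: mean => //; rewrite lexx ltW //.
    have hF : F c < F z by rewrite (F_lt FL).
    rewrite !gtr0_norm ?subr_gt0 //; apply: mean => //; rewrite lexx ltW //.
  have key : B * C0 * `|y - c| `^ (s - 1) <= eps * A * `|z - c| `^ (s - 1).
    have eA : 0 < eps * A by rewrite mulr_gt0.
    have BC : 0 <= B * C0 / (eps * A) by apply/ltW/divr_gt0 => //; exact: mulr_gt0.
    rewrite mulrC -ler_pdivlMr // ; last by rewrite mulr_gt0.
    have h : (L * `|y - c|) `^ (s - 1) <= `|z - c| `^ (s - 1) by apply: mono => //; lra.
    rewrite powRM // /L -powRrM mulVf ?powRr1 // in h; last by rewrite gt_eqF //; lra.
    move: h; rewrite mulrAC ler_pdivrMr // => h.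
    rewrite ler_pdivlMr; last by rewrite mulr_gt0.
    by rewrite mulrC [eps * A * _]mulrC.
  apply: (@le_trans _ _ (B * `|y - c| `^ (s - 1) * `|y - c| * `|z - c|)).
    by apply: ler_wpM2r => //; exact: ltW.
  rewrite -(ler_pM2l C00).
  apply: (@le_trans _ _ (eps * A * `|z - c| `^ (s - 1) * (`|y - c| * `|z - c|))).
    have -> : C0 * (B * `|y - c| `^ (s - 1) * `|y - c| * `|z - c|) =
      B * C0 * `|y - c| `^ (s - 1) * (`|y - c| * `|z - c|) by ring.
    by apply: ler_wpM2r => //; rewrite mulr_ge0.
  have -> : eps * A * `|z - c| `^ (s - 1) * (`|y - c| * `|z - c|) =
    eps * `|y - c| * (A * `|z - c| `^ (s - 1) * `|z - c|) by ring.
  have -> : C0 * (eps * `|y - c| * `|F z - F c|) = eps * `|y - c| * (C0 * `|F z - F c|) by ring.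
  by apply: ler_wpM2l => //; rewrite mulr_ge0 // ltW.
move=> C [t [C1 t0 H]]; exists C^-1, t; rewrite invr_gt0; split => //.
move=> c y z c0 yz zt; rewrite mulrC ler_pdivlMr // mulrC => h.
move: zt; rewrite ltr_norml => /andP[? ?].
by apply: (H c) => //; apply/andP; split; lra.
Qed.


(** The function (F')^(-1/2). It satisfies w'' = - S w / 2 off the critical points, so negative
    Schwarzian derivative means convexity of [w]. In this form it is positive everywhere; its values
    at critical points are meaningless. *)
Let w x := expR (- 2^-1 * ln (F1 x)).
Let w1 x := w x * (- 2^-1 * (F2 x / F1 x)).
Let w2 x := w x * (- 2^-1 * S x).

Let wE x : 0 < F1 x -> F1 x = w x ^- 2.
Proof.
move=> x0; rewrite /w -expRM_natl -expRN.
have -> : - (2 * (- 2^-1 * ln (F1 x))) = ln (F1 x) by field.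
by rewrite lnK.
Qed.

Let w_gt0 x : 0 < w x. Proof. exact: expR_gt0. Qed.

Let w_d x : 0 < F1 x -> is_derive x 1 w (w1 x).
Proof.
move=> x0; have h1 : is_derive x 1 (@ln R \o F1) ((F1 x)^-1 * F2 x).
  by have hl := is_derive1_ln x0; apply: is_derive1_comp.
have h2 : is_derive x 1 (fun y => - 2^-1 * (@ln R \o F1) y) (- 2^-1 *: ((F1 x)^-1 * F2 x)) by apply: is_deriveZ.
have h3 : is_derive x 1 (expR \o (fun y => - 2^-1 * (@ln R \o F1) y)) (w x * (- 2^-1 *: ((F1 x)^-1 * F2 x))).
  by have he := is_derive_expR (- 2^-1 * (@ln R \o F1) x); apply: is_derive1_comp.
by apply: is_derive_eq h3 _; rewrite /w1 /GRing.scale /= [(F1 x)^-1 * _]mulrC.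
Qed.

Let w1_d x : 0 < F1 x -> is_derive x 1 w1 (w2 x).
Proof.
move=> x0; have n0 : F1 x != 0 by rewrite gt_eqF.
have h1 := @is_deriveV _ F1 x (F2 x) 1 n0 (d2 x).
have h2 := is_deriveM (d3 x) h1.
have h3 : is_derive x 1 (fun y => - 2^-1 * (F2 y / F1 y)) (- 2^-1 *: (F2 x *: (- F1 x ^- 2 *: F2 x) + (F1 x)^-1 *: F3 x)) by apply: is_deriveZ.
have h4 := is_deriveM (w_d x0) h3.
apply: is_derive_eq h4 _; rewrite /GRing.scale /= /w2 /w1 /S.
by field.
Qed.

Let S_noncrit x : F1 x <> 0 -> exists2 t, 0 < t & forall y, `|y - x| < t -> S y < `|S x| + 1.
Proof.
move=> /eqP x0.
have c1 : {for x, continuous (fun y => (F1 y)^-1)} by apply: continuousV => //; exact: F1c.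
have c : {for x, continuous S}.
  apply: continuousB; first by apply: continuousM => //; exact: F3c.
  apply: continuousM; first exact: cst_continuous.
  apply: (@continuous_comp _ _ _ (fun y => F2 y / F1 y) (fun z => z ^+ 2)); last exact: exprn_continuous.
  by apply: continuousM => //; exact: F2c.
have /cvgrPdist_lt/(_ 1 ltr01)[t /= t0 H] := c.
exists t => // y yx; have := H y; rewrite /= distrC => /(_ yx).
by rewrite ltr_norml => /andP[h1 h2]; have := ler_norm (S x); lra.
Qed.

Let w_noncrit x : F1 x <> 0 -> exists2 t, 0 < t & forall y, `|y - x| < t -> w x / 2 < w y < 2 * w x.
Proof.
move=> /eqP x0; have x0' : 0 < F1 x by rewrite lt_neqAle F1_ge0 eq_sym x0.
have c : {for x, continuous w} by exact: is_derive_continuous (w_d x0').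
have wx := w_gt0 x; have wx2 : 0 < w x / 2 by rewrite divr_gt0.
have /cvgrPdist_lt/(_ _ wx2)[t /= t0 H] := c.
exists t => // y yx; have := H y; rewrite /= distrC => /(_ yx).
by rewrite ltr_norml => /andP[h1 h2]; apply/andP; split; lra.
Qed.

(** Near a critical point S < 0, so [w] is convex on either side and C = D = 0 serve. Near any other
    point S is bounded above and [w] stays within a factor 2 of its value at [x]. *)
Lemma w_local x : exists C D t, [/\ 0 <= C, 0 <= D, 0 < t & forall y, `|y - x| < t -> F1 y <> 0 ->
  - (2 * D) <= w2 y /\ D <= C * w y].
Proof.
have [x0|x0] := pselect (F1 x = 0).
  have [e [A [B [s [e0 A0 AB s1 H]]]]] := crit_local x0.
  exists 0, 0, e; split => // y yx ny; rewrite mulr0 oppr0 mul0r; split => //.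
  have [|Sy _ _] := H y.
    by rewrite yx andbT normr_gt0 subr_eq0; apply/eqP => E; apply: ny; rewrite E.
  by apply: mulr_ge0; [exact/ltW/w_gt0|lra].
have [t1 t10 H1] := S_noncrit x0; have [t2 t20 H2] := w_noncrit x0.
pose s := `|S x| + 1; have s0 : 0 < s by rewrite ltr_wpDl.
have wx := w_gt0 x.
exists (2 * s), (w x * s), (Num.min t1 t2); split; rewrite ?lt_min ?t10 //.
- by rewrite mulr_ge0 // ltW.
- by rewrite mulr_ge0 // ltW.
move=> y; rewrite lt_min => /andP[y1 y2] ny; have := H1 y y1; rewrite -/s => Sy.
have /andP[wy1 wy2] := H2 y y2; split.
  rewrite /w2; have h1 : w y * S y <= w y * s by apply: ler_wpM2l; [exact/ltW/w_gt0|exact: ltW].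
  have h2 : w y * s <= 2 * w x * s by apply: ler_wpM2r; [exact: ltW|exact: ltW].
  have -> : w y * (- 2^-1 * S y) = - (w y * S y) / 2 by ring.
  have P0 : 0 <= w x * s by rewrite mulr_ge0 // ltW.
  lra.
have h : w x * s <= (2 * w y) * s by apply: ler_wpM2r; [exact: ltW|lra].
lra.
Qed.

Lemma tame_quot : quot_bound F F1.
Proof.
pose P C A B := forall a b p x y : R, A <= a -> b <= B -> (forall z, a < z < b -> F1 z != 0) ->
  a < p < b -> a <= x -> x < y -> y <= b -> x != p -> y != p ->
  quot F F1 p y <= quot F F1 p x + C * (y - x).
have [] := @local_uniform R P.
- move=> C C' a b a' b' CC aa bb H u v p x y au vb nc up ux xy yv xp yp.
  apply: le_trans (H u v p x y _ _ nc up ux xy yv xp yp) _; [lra|lra|].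
  by rewrite lerD2l; apply: ler_wpM2r => //; lra.
- move=> C a b m H u v p x y au vb nc /andP[up pv] ux xy yv xp yp.
  have qE z : quot F F1 (p + (- m)%:~R) (z + (- m)%:~R) = quot F F1 p z.
    rewrite /quot F1_per !(F_int FL); congr (_ / _ - _^-1); ring.
  have E (s t k : R) : s + k - (t + k) = s - t by ring.
  have := H (u + (- m)%:~R) (v + (- m)%:~R) (p + (- m)%:~R) (x + (- m)%:~R) (y + (- m)%:~R).
  rewrite !qE E; apply; rewrite ?(inj_eq (addIr _)) // ?lerD2r ?ltrD2r // ?up //.
  + by rewrite mulrNz; lra.
  + by rewrite mulrNz; lra.
  move=> z /andP[z1 z2]; rewrite -(F1_per z m); apply: nc; rewrite mulrNz in z1 z2.
  by apply/andP; split; lra.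
- move=> x0; have [C [D [t [C0 D0 t0 H]]]] := w_local x0.
  (* The bound 1/2 keeps the intervals of length at most 1, as [koebe_quot] requires. *)
  exists (2 * C + C ^+ 2), (Num.min t (1 / 2)); split; first by rewrite lt_min t0 divr_gt0.
  move=> a b p x y ha hb nc pI ax xy yb xp yp.
  have [m1 m2] : Num.min t (1 / 2) <= t /\ Num.min t (1 / 2) <= 1 / 2 by rewrite !ge_min !lexx orbT.
  have pos z : a < z < b -> 0 < F1 z by move=> /nc zn; rewrite lt_neqAle F1_ge0 eq_sym zn.
  have loc z : a < z < b -> - (2 * D) <= w2 z /\ D <= C * w z.
    move=> zI; apply: H; last exact/eqP/nc.
    by case/andP: zI => z1 z2; rewrite ltr_norml; apply/andP; split; lra.
  apply: (@koebe_quot _ F F1 w w1 a b C D).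
  + by case: FL.
  + exact: F_cont.
  + by move=> z /pos; exact: wE.
  + by move=> z /pos; exact: w_d.
  + by move=> z _; exact: w_gt0.
  + apply: (@convex_tangent _ w w1 w2).
    * by move=> z /pos; exact: w_d.
    * by move=> z /pos; exact: w1_d.
    * by move=> z /loc[].
  + exact: C0.
  + exact: D0.
  + by move=> z /loc[].
  + by lra.
  + exact: pI.
  + exact: ax.
  + exact: xy.
  + exact: yb.
  + exact: xp.
  + exact: yp.
move=> C [t [C0 t0 H]]; exists C, t; split => //; first exact: ltW.
move=> a b p x y ab nc pI ax xy yb xp yp; apply: (H ((a + b) / 2)) nc pI ax xy yb xp yp; lra.
Qed.

(** The difference [g q - g r] is the logarithm of the factor by which [F] changes the cross-ratio,
    and the derivative of [g] at x is the difference of the quotients based at x, taken at [p] and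
    at [s]. The mean value theorem concludes. *)
Lemma cross_noncrit C p q r s : p < q -> q < r -> r < s ->
  (forall x, p < x < s -> quot F F1 x s <= quot F F1 x p + C * (s - p)) ->
  cross (F p) (F q) (F r) (F s) <= expR (C * (s - p) * (r - q)) * cross p q r s.
Proof.
move=> pq qr rs Q; pose K := C * (s - p).
pose g x := ln (F x - F p) + ln (s - x) - ln (F s - F x) - ln (x - p).
pose dg x := quot F F1 x p - quot F F1 x s.
have Fpos x y : x < y -> 0 < F y - F x by move=> xy; rewrite subr_gt0 (F_lt FL).
have lnd (f : R -> R) (x d : R) : 0 < f x -> is_derive x 1 f d ->
    is_derive x 1 (fun y => ln (f y)) ((f x)^-1 * d).
  by move=> f0 fd; have hl := is_derive1_ln f0; apply: (@is_derive1_comp _ (@ln R) f).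
have gd x : p < x < s -> is_derive x 1 g (dg x).
  move=> /andP[px xs].
  have h1 : is_derive x 1 (fun y => F y - F p) (F1 x - 0) by apply: is_deriveB.
  have h2 : is_derive x 1 (fun y => s - y) (0 - 1) by apply: is_deriveB.
  have h3 : is_derive x 1 (fun y => F s - F y) (0 - F1 x) by apply: is_deriveB.
  have h4 : is_derive x 1 (fun y => y - p) (1 - 0) by apply: is_deriveB.
  have l1 := @lnd (fun y => F y - F p) x _ (Fpos _ _ px) h1.
  have l2 := @lnd (fun y => s - y) x _ _ h2; rewrite subr_gt0 in l2; have {}l2 := l2 xs.
  have l3 := @lnd (fun y => F s - F y) x _ (Fpos _ _ xs) h3.
  have l4 := @lnd (fun y => y - p) x _ _ h4; rewrite subr_gt0 in l4; have {}l4 := l4 px.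
  have l := is_deriveB (is_deriveB (is_deriveD l1 l2) l3) l4.
  apply: is_derive_eq l _; rewrite /dg /quot.
  rewrite -[F x - F s]opprB -[x - s]opprB !invrN; ring.
have [||x /andP[x1 x2] E] := mvt qr (f := g) (df := dg).
- by move=> x /andP[x1 x2]; apply: gd; apply/andP; split; lra.
- by move=> x /andP[x1 x2]; apply: is_derive_continuous (gd x _); apply/andP; split; lra.
have xI : p < x < s by apply/andP; split; lra.
have B : g q - g r <= K * (r - q).
  have := Q x xI; rewrite -/K => h.
  have : - K * (r - q) <= dg x * (r - q) by apply: ler_wpM2r; rewrite /dg; lra.
  lra.
have ps : p < s by lra.
have pr : p < r by lra.
have qs : q < s by lra.
have [a1 a2 a3 a4] : [/\ 0 < F q - F p, 0 < F r - F p, 0 < F s - F q & 0 < F s - F r] by split; exact: Fpos.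
have [b1 b2 b3 b4] : [/\ 0 < q - p, 0 < r - p, 0 < s - q & 0 < s - r] by rewrite !subr_gt0.
have c0 : 0 < cross p q r s by rewrite /cross divr_gt0 // mulr_gt0.
have c1 : 0 < cross (F p) (F q) (F r) (F s) by rewrite /cross divr_gt0 // mulr_gt0.
have eX := expR_gt0 (C * (s - p) * (r - q)).
suff : ln (cross (F p) (F q) (F r) (F s)) <= ln (expR (C * (s - p) * (r - q)) * cross p q r s).
  by rewrite ler_ln // posrE // mulr_gt0.
rewrite lnM ?posrE // expRK.
rewrite /cross !lnM ?lnV ?lnM ?posrE ?invr_gt0 ?mulr_gt0 //.
by move: B; rewrite /g /K; lra.
Qed.

(** By [deriv_mean] the distortion never exceeds [C0 ^+ 2]. This cost is charged to the length if s
    - p >= t and to the count if a critical point lies inside. The remaining quadruples are short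
    and free of critical points, and [cross_noncrit] makes their distortion proportional to the
    length. *)
Lemma tame_cross : cross_bound F.
Proof.
have [C0 C01 mean] := deriv_mean; have C00 : 0 < C0 by lra.
have [C1 [t [C10 t0 Q]]] := tame_quot.
have lnC : 0 <= ln (C0 ^+ 2) by rewrite ln_ge0 // exprn_ege1.
have mean2 p q r s : p < q -> q < r -> r < s ->
    cross (F p) (F q) (F r) (F s) <= C0 ^+ 2 * cross p q r s.
  move=> pq qr rs; have pr : p < r by lra. have qs : q < s by lra.
  have Fpos x y : x < y -> 0 < F y - F x by move=> xy; rewrite subr_gt0 (F_lt FL).
  have h1 : (F q - F p) / (F r - F p) <= C0 * ((q - p) / (r - p)).
    rewrite ler_pdivrMr ?Fpos //.
    have [c /andP[c1 c2] ->] := F_mvt pq.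
    have h := mean p r c _ pr.
    have -> : C0 * ((q - p) / (r - p)) * (F r - F p) = C0 * (F r - F p) / (r - p) * (q - p) by ring.
    apply: ler_wpM2r; first by lra.
    by rewrite ler_pdivlMr ?subr_gt0 // h //; apply/andP; split; lra.
  have h2 : (F s - F r) / (F s - F q) <= C0 * ((s - r) / (s - q)).
    rewrite ler_pdivrMr ?Fpos //.
    have [c /andP[c1 c2] ->] := F_mvt rs.
    have h := mean q s c _ qs.
    have -> : C0 * ((s - r) / (s - q)) * (F s - F q) = C0 * (F s - F q) / (s - q) * (s - r) by ring.
    apply: ler_wpM2r; first by lra.
    by rewrite ler_pdivlMr ?subr_gt0 // h //; apply/andP; split; lra.
  rewrite /cross !invfM mulrACA.
  have -> : C0 ^+ 2 * ((q - p) * (s - r) * ((r - p)^-1 / (s - q))) =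
    (C0 * ((q - p) / (r - p))) * (C0 * ((s - r) / (s - q))) by ring.
  by apply: ler_pM => //; rewrite divr_ge0 // ltW // Fpos.
pose L := ln (C0 ^+ 2); rewrite -/L in lnC; pose C := C1 * t + L + L / t.
have Lt : 0 <= L / t by rewrite divr_ge0 // ltW.
have C1t : 0 <= C1 * t by rewrite mulr_ge0 // ltW.
have C_ge0 : 0 <= C by rewrite /C; lra.
exists C, cs; split => // p q r s pq qr rs.
have ps : 0 < s - p by lra.
set n := \sum_(c <- cs) _.
have n0 : 0 <= n by apply: sumr_ge0.
have cr0 := cross_ge0 pq qr rs.
have big : L <= C * (s - p) + C * n -> cross (F p) (F q) (F r) (F s) <= expR (C * (s - p) + C * n) * cross p q r s.
  move=> h; apply: le_trans (mean2 p q r s pq qr rs) _; apply: ler_wpM2r => //.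
  rewrite -[C0 ^+ 2]lnK ?posrE ?exprn_gt0 // ler_expR //.
have Cps : 0 <= C * (s - p) by rewrite mulr_ge0 // ltW.
have [long|short] := leP t (s - p).
  apply: big; have : L / t * t <= C * (s - p).
    by apply: ler_pM => //; [exact: ltW|rewrite /C; lra].
  have : 0 <= C * n by exact: mulr_ge0.
  rewrite divfK ?gt_eqF //; lra.
have [[z [zI z0]]|nc] := pselect (exists z, p < z < s /\ F1 z = 0).
  apply: big; have [c cc [m zE]] := crit_list z0.
  have n1 : 1 <= n.
    rewrite /n (perm_big _ (perm_to_rem cc)) big_cons /=.
    have -> : `[< exists m0 : int, p <= c + m0%:~R <= s >].
      by apply/asboolP; exists m; rewrite -zE; case/andP: zI => *; rewrite !ltW.
    by rewrite lerDl sumr_ge0.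
  have : C * 1 <= C * n by apply: ler_wpM2l.
  have CL : L <= C by rewrite /C; lra.
  by rewrite mulr1; lra.
apply: le_trans (cross_noncrit pq qr rs (C := C1) _) _.
  move=> x xI; have /andP[px xs] := xI; apply: (Q p s x p s).
  - exact: short.
  - by move=> z zI; apply/eqP => z0; apply: nc; exists z.
  - exact: xI.
  - by [].
  - by lra.
  - by [].
  - by rewrite lt_eqF.
  - by rewrite gt_eqF.
apply: ler_wpM2r => //; rewrite ler_expR.
have h : C1 * (s - p) * (r - q) <= C1 * (s - p) * t.
  by apply: ler_wpM2l; [rewrite mulr_ge0 // ltW|lra].
have h' : C1 * t * (s - p) <= C * (s - p).
  by apply: ler_wpM2r; [exact: ltW|rewrite /C; lra].
have : 0 <= C * n by exact: mulr_ge0.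
lra.
Qed.

Lemma tame_of_local : tame F F1.
Proof.
by split; [exact: FL|exact: d1|split; [exact: F1c|exact: F1_ge0]|split; [exact: tame_cross|exact: tame_quot]|exact: tame_contraction].
Qed.

End Tame.

(** * Lifting maps of the circle *)

Section Circle.
Variable R : realType.
Local Notation S1 := (circle R).
Implicit Types (x y z t : R) (u v : S1) (f h : S1 -> S1) (F H : R -> R).

Lemma to_circleP x y : to_circle x = to_circle y <-> exists m : int, x - y = m%:~R.
Proof.
split=> [/eqquotP|[m E]].
  by rewrite Quotient.equivE => h; apply/intrP.
by apply/eqquotP; rewrite Quotient.equivE E; exact: intr_int.
Qed.

Lemma to_circle_int x (m : int) : to_circle (x + m%:~R) = to_circle x.
Proof. by apply/to_circleP; exists m; rewrite addrC addKr. Qed.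

Lemma to_circle_repr u : to_circle (repr u) = u.
Proof. exact: reprK. Qed.

Lemma repr_to_circle x : exists m : int, repr (to_circle x) = x + m%:~R.
Proof.
have /to_circleP[m E] := to_circle_repr (to_circle x).
by exists m; rewrite -E; ring.
Qed.

Lemma to_circle_continuous : continuous (@to_circle R).
Proof. exact: pi_continuous. Qed.

(** The projection is open: the preimage of this set is a union of integer translates of a ball. *)
Lemma to_circle_nbhs x e : 0 < e ->
  nbhs (to_circle x) [set u | exists2 y, u = to_circle y & `|y - x| < e].
Proof.
move=> e0; rewrite nbhsE; exists [set u | exists2 y, u = to_circle y & `|y - x| < e] => //.
split; last by exists x => //; rewrite subrr normr0.
have op : open (@to_circle R @^-1` [set u | exists2 y, u = to_circle y & `|y - x| < e]).
  rewrite openE => z [y zy yx] /=.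
  near=> z'; exists (y + (z' - z)).
    have /to_circleP[m E] := zy; apply/to_circleP; exists m; rewrite -E; ring.
  have h : `|z - z'| < e - `|y - x|.
    by near: z'; apply: (@cvgr_dist_lt _ _ _ (nbhs z) _ id) => //; rewrite subr_gt0.
  have -> : y + (z' - z) - x = (y - x) - (z - z') by ring.
  by apply: le_lt_trans (ler_normB _ _) _; rewrite addrC -ltrBrDr.
exact: op.
Unshelve. all: by end_near. Qed.

Lemma circle_cvg (g : R -> S1) (c : R -> R) x e : {for x, continuous g} ->
  (forall y, g y = to_circle (c y)) -> 0 < e ->
  exists2 t, 0 < t & forall y, `|y - x| < t -> exists m : int, `|c y - c x - m%:~R| < e.
Proof.
move=> gc gE e0; have N := to_circle_nbhs (c x) e0; rewrite -gE in N.
have [t /= t0 H] := gc _ N; exists t => // y yx.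
have [|w gw wx] := H y; first by rewrite /= distrC.
move: gw; rewrite gE => /to_circleP[m E]; exists m.
by have -> : c y - c x - m%:~R = w - c x by rewrite -E; ring.
Qed.

(** Between two different integer values the intermediate value theorem would produce an integer
    plus one half. *)
Lemma int_valued_const (F : R -> R) : continuous F ->
  (forall x, exists m : int, F x = m%:~R) -> forall x y, F x = F y.
Proof.
move=> Fc Fi.
have step x y : x <= y -> F x = F y.
  move=> xy; apply/eqP/negPn/negP => ne.
  have [m Em] := Fi x; have [n En] := Fi y.
  have half k : (k%:~R + 2^-1 : R) != (k%:~R : R) by rewrite -subr_eq0 addrC addKr.
  pose v := Num.min (F x) (F y) + 2^-1.
  have vI : Num.min (F x) (F y) <= v <= Num.max (F x) (F y).
    rewrite /v lerDl invr_ge0 ler0n /=.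
    have H k l : (k < l)%R -> (k%:~R + 2^-1 <= l%:~R :> R).
      move=> kl; have : k + 1 <= l by rewrite lezD1.
      by rewrite -(ler_int R) intrD; lra.
    rewrite Em En; case: (ltgtP m n) => [mn|nm|mn]; last by rewrite Em En mn eqxx in ne.
      have h : m%:~R <= n%:~R :> R by rewrite ler_int ltW.
      by rewrite (min_idPl h) (max_idPr h); exact: H.
    have h : n%:~R <= m%:~R :> R by rewrite ler_int ltW.
    by rewrite (min_idPr h) (max_idPl h); exact: H.
  have [c _ Ec] := IVT xy (continuous_subspaceT Fc) vI.
  have [k Ek] := Fi c.
  have [l El] : exists l : int, Num.min (F x) (F y) = l%:~R.
    by rewrite minEle; case: ifP => _; [exists m|exists n].
  move: Ec; rewrite Ek /v El => /eqP; rewrite -subr_eq => /eqP E.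
  have E2 : 2^-1 = (k - l)%:~R :> R by rewrite intrB; lra.
  have : (2 * (k - l))%:~R = (1 : int)%:~R :> R by rewrite intrM -E2 divff.
  by move=> /intr_inj; lia.
by move=> x y; case: (leP x y) => [/step//|/ltW/step].
Qed.

Lemma lift_unique (F H : R -> R) : continuous F -> continuous H ->
  (forall x, to_circle (F x) = to_circle (H x)) -> exists m : int, forall x, F x = H x + m%:~R.
Proof.
move=> Fc Hc E.
have dc : continuous (fun x => F x - H x) by move=> x; apply: continuousB; [exact: Fc|exact: Hc].
have di x : exists m : int, F x - H x = m%:~R by apply/to_circleP.
have [m Em] := di 0; exists m => x.
by rewrite -Em (int_valued_const dc di 0 x); ring.
Qed.

(* The representative of [z] modulo 1 that is closest to 0. *)
Definition centred z : R := z - (Num.floor (z + 2^-1))%:~R.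

Lemma centredE z e (m : int) : `|e| < 2^-1 -> z = e + m%:~R -> centred z = e.
Proof.
move=> he ->; rewrite /centred.
suff -> : Num.floor (e + m%:~R + 2^-1) = m by rewrite addrK.
apply/eqP; rewrite floor_eq intrD; move: he; rewrite ltr_norml => /andP[h1 h2].
by apply/andP; split; lra.
Qed.

Lemma to_circle_centred z : exists m : int, centred z = z + m%:~R.
Proof. by exists (- Num.floor (z + 2^-1)); rewrite mulrNz. Qed.

Section PathLifting.
Variable g : R -> S1.
Hypothesis gc : continuous g.
Hypothesis g1 : forall x (m : int), g (x + m%:~R) = g x.

(** An arbitrary, in general discontinuous choice of representatives; only its increments modulo 1
    carry information. *)
Let c x : R := repr (g x).

Let gE x : g x = to_circle (c x). Proof. by rewrite to_circle_repr. Qed.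

Lemma path_uniform : exists2 t, 0 < t & forall x y, `|x - y| < t ->
  exists m : int, `|c x - c y - m%:~R| < 4^-1.
Proof.
pose P (_ a b : R) := forall x y, a <= x <= b -> a <= y <= b ->
  exists m : int, `|c x - c y - m%:~R| < 4^-1.
have [] := @local_uniform R P.
- move=> C C' a b a' b' _ aa bb H x y /andP[x1 x2] /andP[y1 y2].
  by apply: H; apply/andP; split; lra.
- move=> C a b m H x y /andP[x1 x2] /andP[y1 y2].
  have [||k hk] := H (x - m%:~R) (y - m%:~R); try (apply/andP; split; lra).
  have [i Ei] : exists i : int, c (x - m%:~R) - c x = i%:~R.
    by apply/to_circleP; rewrite -!gE -mulrNz g1.
  have [j Ej] : exists j : int, c (y - m%:~R) - c y = j%:~R.
    by apply/to_circleP; rewrite -!gE -mulrNz g1.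
  exists (k - i + j); rewrite intrD intrB -Ei -Ej.
  by have -> : c x - c y - (k%:~R - (c (x - m%:~R) - c x) + (c (y - m%:~R) - c y)) =
    c (x - m%:~R) - c (y - m%:~R) - k%:~R by ring.
- move=> x; have e0 : 0 < 8^-1 :> R by rewrite invr_gt0.
  have [t t0 H] := @circle_cvg g c x _ (@gc x) gE e0.
  exists 0, (t / 2); split; first by rewrite divr_gt0.
  move=> y z /andP[y1 y2] /andP[z1 z2].
  have [|m hm] := H y; first by rewrite ltr_norml; apply/andP; split; lra.
  have [|n hn] := H z; first by rewrite ltr_norml; apply/andP; split; lra.
  exists (m - n); rewrite intrB.
  have -> : c y - c z - (m%:~R - n%:~R) = (c y - c x - m%:~R) - (c z - c x - n%:~R) by ring.
  apply: le_lt_trans (ler_normB _ _) _; lra.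
move=> C [t [_ t0 H]]; exists t => // x y; rewrite ltr_norml => /andP[h1 h2].
by apply: (H x); apply/andP; split; lra.
Qed.

(** An increment within 1/4 of an integer stays away from the half-integers, where [centred] jumps.
    The integer jumps of [c] are then cancelled by [centred]. *)
Lemma centred_continuous (a b : R -> R) x : {for x, continuous a} -> {for x, continuous b} ->
  (exists m : int, `|c (a x) - c (b x) - m%:~R| < 4^-1) ->
  {for x, continuous (fun y => centred (c (a y) - c (b y)))}.
Proof.
move=> ac bc [m hm].
have loc (p : R -> R) e : {for x, continuous p} -> 0 < e ->
    \forall y \near x, exists m : int, `|c (p y) - c (p x) - m%:~R| < e.
  move=> pc e0.
  have [t t0 H] := @circle_cvg g c (p x) e (@gc _) gE e0.
  have /cvgrPdist_lt/(_ t t0) near_p := pc.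
  by near=> y; apply: H; rewrite distrC; near: y.
have E0 : centred (c (a x) - c (b x)) = c (a x) - c (b x) - m%:~R.
  by apply: (@centredE _ _ m); [apply: lt_trans hm _; lra|ring].
apply/cvgrPdist_lt => e e0; rewrite E0.
pose d := Num.min (e / 2) 16^-1.
have d0 : 0 < d by rewrite lt_min divr_gt0 //= invr_gt0.
have [d1 d2] : d <= e / 2 /\ d <= 16^-1 by rewrite !ge_min !lexx orbT.
near=> y.
have [i hi] : exists m : int, `|c (a y) - c (a x) - m%:~R| < d by near: y; exact: loc.
have [j hj] : exists m : int, `|c (b y) - c (b x) - m%:~R| < d by near: y; exact: loc.
set A := c (a y) - c (a x) - i%:~R in hi; set B := c (b y) - c (b x) - j%:~R in hj.
rewrite (@centredE _ (c (a x) - c (b x) - m%:~R + (A - B)) (m + i - j)).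
- rewrite opprD addNKr normrN; apply: le_lt_trans (ler_normB _ _) _; lra.
- apply: le_lt_trans (ler_normD _ _) _.
  have := ler_normB A B; lra.
- by rewrite /A /B intrB intrD; ring.
Unshelve. all: by end_near. Qed.

(** The retraction of the line onto [-n, n], by a formula that is visibly continuous. It makes one
    subdivision fine enough for all points. *)
Let clamp (n : nat) x : R := (`|x + n%:R| - `|x - n%:R|) / 2.

Let clamp_continuous n : continuous (clamp n).
Proof.
move=> x; apply: (@continuousM _ _ (fun y => `|y + n%:R| - `|y - n%:R|) (fun=> 2^-1) x); last exact: cst_continuous.
apply: continuousB; (apply: continuous_comp; last exact: norm_continuous).
  by apply: continuousD; [exact: cvg_id|exact: cst_continuous].
by apply: continuousB; [exact: cvg_id|exact: cst_continuous].
Qed.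

Let clamp_id n x : `|x| <= n%:R -> clamp n x = x.
Proof.
rewrite ler_norml => /andP[h1 h2]; rewrite /clamp ger0_norm ?ler0_norm; lra.
Qed.

Let clamp_le n x : `|clamp n x| <= n%:R.
Proof.
rewrite /clamp normrM [`|2^-1|]ger0_norm ?invr_ge0 // ler_pdivrMr //.
apply: le_trans (ler_dist_dist _ _) _.
have -> : x + n%:R - (x - n%:R) = n%:R * 2 by ring.
by rewrite ger0_norm // mulr_ge0.
Qed.

(** The segment from 0 to the clamped point is cut into [k] equal steps shorter than the uniform
    radius, and the lift sums the centred increments along them. *)
Lemma path_lift_bounded n : exists L : R -> R, [/\ continuous L,
  forall x, `|x| <= n%:R -> g x = to_circle (L x) & L 0 = c 0].
Proof.
have [t t0 H] := path_uniform.
pose k := (Num.truncn (n%:R / t)).+1.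
have k0 : 0 < k%:R :> R by rewrite ltr0n.
have kt : n%:R < k%:R * t.
  by rewrite -ltr_pdivrMr // truncnS_gt.
pose p i x := clamp n x * (i%:R / k%:R).
have pc i : continuous (p i).
  by move=> x; apply: continuousM; [exact: clamp_continuous|exact: cst_continuous].
have close i x : `|p i.+1 x - p i x| < t.
  have -> : p i.+1 x - p i x = clamp n x / k%:R by rewrite /p -natr1; field; rewrite gt_eqF.
  rewrite normrM [`|_^-1|]gtr0_norm ?invr_gt0 // ltr_pdivrMr // mulrC.
  exact: le_lt_trans (clamp_le n x) kt.
exists (fun x => c 0 + \sum_(i < k) centred (c (p i.+1 x) - c (p i x))); split.
- elim: (k) => [|j IH].
    by under eq_fun do rewrite big_ord0; move=> x; exact: cst_continuous.
  under eq_fun do rewrite big_ord_recr /= addrA.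
  move=> x; apply: (@continuousD _ _ _ (fun x => c 0 + \sum_(i < j) centred (c (p i.+1 x) - c (p i x)))
    (fun x => centred (c (p j.+1 x) - c (p j x))) x); first exact: IH.
  by apply: centred_continuous; [exact: pc|exact: pc|exact: H].
- move=> x xn; rewrite gE; apply/to_circleP.
  have tele j : exists m : int, c 0 + \sum_(i < j) centred (c (p i.+1 x) - c (p i x)) = c (p j x) + m%:~R.
    elim: j => [|j [m IH]]; first by exists 0; rewrite big_ord0 /p mul0r mulr0 !addr0.
    have [m' E] := to_circle_centred (c (p j.+1 x) - c (p j x)).
    by exists (m + m'); rewrite big_ord_recr /= addrA IH E intrD; ring.
  have [m E] := tele k; exists (- m); rewrite E /p divff ?gt_eqF // mulr1 clamp_id // mulrNz.
  by ring.
- rewrite big1 ?addr0 // => i _; rewrite /p clamp_id ?normr0 // !mul0r subrr.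
  by apply: (@centredE _ _ 0); rewrite ?normr0 ?addr0 // invr_gt0.
Qed.

(** Bounded lifts agree on common intervals because they agree at 0. The index depends on the point,
    but near a given point one larger index serves for all. *)
Lemma path_lift : exists L : R -> R, continuous L /\ forall x, g x = to_circle (L x).
Proof.
have [L HL] := choice path_lift_bounded.
have coh n m x : (n <= m)%N -> `|x| <= n%:R -> L m x = L n x.
  move=> nm xn.
  have [Lm1 Lm2 Lm3] := HL m; have [Ln1 Ln2 Ln3] := HL n.
  have [||z|k E] := @lift_unique (L m \o clamp n) (L n \o clamp n).
  - by move=> z; apply: continuous_comp; [exact: clamp_continuous|exact: Lm1].
  - by move=> z; apply: continuous_comp; [exact: clamp_continuous|exact: Ln1].
  - rewrite /= -Ln2 ?clamp_le // -Lm2 //.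
    by apply: le_trans (clamp_le n z) _; rewrite ler_nat.
  have := E 0; rewrite /= clamp_id ?normr0 // Lm3 Ln3 => /eqP; rewrite addrC -subr_eq subrr => /eqP k0.
  by have := E x; rewrite /= clamp_id // -k0 addr0.
pose N x := (Num.truncn `|x|).+1.
have Nx x : `|x| < (N x)%:R by exact: truncnS_gt.
exists (fun x => L (N x) x); split; last by move=> x; have [_ h _] := HL (N x); rewrite h // ltW.
move=> x; pose M := (N x).+1.
have eqn y : `|y - x| < 1 -> L (N y) y = L M y.
  move=> yx; have yN : `|y| < M%:R.
    have -> : y = (y - x) + x by rewrite subrK.
    by apply: le_lt_trans (ler_normD _ _) _; rewrite /M -natr1 addrC; apply: ltrD.
  have [h|/ltnW h] := leqP (N y) M; first by rewrite (coh _ _ _ h) // ltW.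
  by rewrite (coh _ _ _ h) // ltW.
have [Mc _ _] := HL M.
have E : L (N x) x = L M x by apply: eqn; rewrite subrr normr0.
rewrite /continuous_at E.
apply: (@cvg_trans _ (L M @ x)); last exact: Mc.
apply: near_eq_cvg; near=> y; apply/esym/eqn.
by rewrite distrC; near: y; apply: (@cvgr_dist_lt _ _ _ (nbhs x) _ id).
Unshelve. all: by end_near. Qed.

End PathLifting.

End Circle.

(** * Rotation numbers *)

Section Lifts.
Variable R : realType.
Implicit Types (x y z t : R) (f h : circle R -> circle R) (F H L : R -> R).

Lemma circle_lift_lift h : continuous h -> is_lift h (circle_lift h).
Proof.
move=> hc.
have [||L [Lc LE]] := @path_lift R (h \o @to_circle R).
- by move=> x; apply: continuous_comp; [exact: to_circle_continuous|exact: hc].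
- by move=> x m; rewrite /= to_circle_int.
by rewrite /circle_lift; case: xgetP => [F -> //|/(_ L)[]]; split.
Qed.

Lemma lift_degree h L : is_lift h L -> exists k : int, forall x (m : int), L (x + m%:~R) = L x + (k * m)%:~R.
Proof.
move=> [Lc LE]; have [||x|k E] := @lift_unique R (fun x => L (x + 1)) L.
- move=> x; apply: continuous_comp; last exact: Lc.
  by apply: continuousD; [exact: cvg_id|exact: cst_continuous].
- exact: Lc.
- by rewrite -!LE (to_circle_int x 1).
exists k.
have pos n x : L (x + n%:R) = L x + (k * n%:Z)%:~R.
  elim: n => [|n IH]; first by rewrite mulr0 !addr0.
  by rewrite -natr1 addrA E IH -addn1 PoszD mulrDr mulr1 intrD addrA.
move=> x [n|n]; first exact: pos.
have := pos n.+1 (x - n.+1%:R); rewrite subrK NegzE mulrNz => ->.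
by rewrite mulrN mulrNz addrK.
Qed.

(** Lifts of [h] and of its inverse compose to a translation by an integer, so the first is
    injective and the degrees have product 1. *)
Lemma homeomorphism_lift h : homeomorphism h -> injective (circle_lift h) /\
  exists k : int, (k = 1 \/ k = -1) /\ forall x (m : int), circle_lift h (x + m%:~R) = circle_lift h x + (k * m)%:~R.
Proof.
move=> [hc [h' [h'c hK h'K]]].
have lh := circle_lift_lift hc; have lh' := circle_lift_lift h'c.
have [k Ek] := lift_degree lh; have [k' Ek'] := lift_degree lh'.
move: lh lh' Ek Ek'; set L := circle_lift h; set L' := circle_lift h' => -[Lc LE] [Lc' LE'] Ek Ek'.
have [||x|j Ej] := @lift_unique R (L' \o L) id.
- by move=> x; apply: continuous_comp; [exact: Lc|exact: Lc'].
- by move=> x; exact: cvg_id.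
- by rewrite /= -LE' -LE hK.
have kk : k' * k = 1.
  have E1 : L' (L (0 + 1%:~R)) = 0 + 1%:~R + j%:~R := Ej _.
  have E0 : L' (L 0) = 0 + j%:~R := Ej 0.
  rewrite Ek mulr1 Ek' E0 in E1.
  by apply: (@intr_inj R); lra.
split; first by move=> x y xy; have := Ej x; rewrite /= xy -[L' _]/((L' \o L) y) Ej => /addIr.
exists k; split => //.
have : (`|k'| * `|k| == 1)%N by rewrite -abszM kk.
rewrite muln_eq1 => /andP[_ /eqP k1]; lia.
Qed.

Lemma injective_lift L : continuous L -> injective L -> (forall x (m : int), L (x + m%:~R) = L x + m%:~R) ->
  circle_lift_map L.
Proof.
move=> Lc Li L1; split => //; last by move=> x; exact: (L1 x 1).
move=> x y xy; rewrite ltNge le_eqVlt; apply/negP => /orP[/eqP /Li yx|yx]; first by rewrite yx ltxx in xy.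
have [n hn] : exists n : nat, L x - L y + (y - x) < n%:R by exists (Num.truncn (L x - L y + (y - x))).+1; exact: truncnS_gt.
have yn : y <= x + n%:R by have := ltW yx; lra.
have [] := @IVT R L y (x + n%:R) (L x) yn (continuous_subspaceT Lc).
  have n0 : 0 <= n%:R :> R by [].
  have -> : L (x + n%:R) = L x + n%:R by exact: (L1 x n).
  by rewrite ge_min le_max (ltW yx) lerDl n0 orbT.
move=> z; rewrite in_itv /= => /andP[yz _] /Li zx; lra.
Qed.

Lemma increasing_lift f : homeomorphism f -> {homo circle_lift f : x y / x < y} ->
  circle_lift_map (circle_lift f).
Proof.
move=> fh fi; have [Li [k [k1 Ek]]] := homeomorphism_lift fh.
have [Lc _] := circle_lift_lift fh.1.
apply: injective_lift => // x m; rewrite Ek.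
case: k1 => E; first by rewrite E mul1r.
have := fi x (x + 1); rewrite ltrDl ltr01 => /(_ isT).
by rewrite (Ek x 1) E mulr1 mulrN1z; lra.
Qed.

End Lifts.

(** * The translation number of a lift and the order of its orbits *)

Section Rotation.
Variables (R : realType) (F : R -> R).
Hypothesis FL : circle_lift_map F.
Implicit Types (x y : R) (n m : nat).

Lemma iter_lift n : circle_lift_map (iter n F).
Proof.
have [Fi Fc F1] := FL; elim: n => [|n [Ii Ic I1]]; first by split => // x; exact: cvg_id.
split=> [x y /Ii/Fi //|x|x]; last by rewrite !iterS I1 F1.
by apply: continuous_comp; [exact: Ic|exact: Fc].
Qed.

Lemma lift_dev x : `|F x - x - F 0| <= 1.
Proof.
have /andP[k1 k2] := floor_itv x; set k := Num.floor x in k1 k2.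
have : F x <= F (0 + (k + 1)%:~R) by rewrite (F_le FL) add0r ltW.
have : F (0 + k%:~R) <= F x by rewrite (F_le FL) add0r.
rewrite !(F_int FL); move: k2; rewrite intrD => *.
by rewrite ler_norml; apply/andP; split; lra.
Qed.

End Rotation.

(** The sequence a n = F^n(0) is additive up to 1, so every (a n - 1) / n is at most every (a m + 1)
    / m. The supremum of the former is the translation number, with an explicit error of 1/n. *)
Lemma rotation_exists (R : realType) (F : R -> R) : circle_lift_map F -> exists rho : R,
  [/\ forall n, `|iter n F 0 - n%:R * rho| <= 1 &
      lim ((fun n => iter n F 0 / n%:R) @ \oo) = rho].
Proof.
move=> FL; pose a n := iter n F 0.
have quasi n m : `|a (n + m)%N - a n - a m| <= 1.
  by rewrite /a iterD addrAC; exact: (lift_dev (iter_lift FL n)).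
have mult n m : `|a (n * m)%N - m%:R * a n| <= m%:R.
  elim: m => [|m IH]; first by rewrite muln0 mul0r subr0 /a normr0.
  have := quasi n (n * m)%N; rewrite mulnS -natr1; move: IH; rewrite !ler_norml.
  by move=> /andP[? ?] /andP[? ?]; apply/andP; split; lra.
have sep n m : (0 < n)%N -> (0 < m)%N -> (a n - 1) / n%:R <= (a m + 1) / m%:R.
  move=> n0 m0; rewrite ler_pdivrMr ?ltr0n // mulrAC ler_pdivlMr ?ltr0n //.
  have := mult n m; have := mult m n; rewrite mulnC !ler_norml.
  by move=> /andP[? ?] /andP[? ?]; lra.
pose A := [set (a n.+1 - 1) / n.+1%:R | n in setT].
have A0 : A !=set0 by exists ((a 1%N - 1) / 1); exists 0%N.
have uA m : ubound A ((a m.+1 + 1) / m.+1%:R) by move=> _ [n _ <-]; exact: sep.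
have hA : has_sup A by split => //; exists ((a 1%N + 1) / 1); exact: (uA 0%N).
have bound n : `|a n - n%:R * sup A| <= 1.
  case: n => [|n]; first by rewrite mul0r subr0 normr0.
  have h1 : (a n.+1 - 1) / n.+1%:R <= sup A by apply: ub_le_sup; [case: hA|exists n].
  have h2 : sup A <= (a n.+1 + 1) / n.+1%:R by apply: ge_sup.
  move: h1 h2; rewrite ler_pdivrMr ?ltr0n // ler_pdivlMr ?ltr0n // => h1 h2.
  by rewrite ler_norml; apply/andP; split; lra.
exists (sup A); split => //; apply: cvg_lim => //.
apply/cvgrPdist_lt => e e0; near=> n.
have n0 : 0 < n%:R :> R by rewrite ltr0n; near: n; exact: nbhs_infty_gt.
have ne : e^-1 < n%:R by near: n; exact: nbhs_infty_gtr.
have -> : sup A - iter n F 0 / n%:R = - (a n - n%:R * sup A) / n%:R.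
  by rewrite /a; field; rewrite gt_eqF.
rewrite normrM normrN [`|_^-1|]gtr0_norm ?invr_gt0 // ltr_pdivrMr //.
apply: le_lt_trans (bound n) _.
by rewrite mulrC -ltr_pdivrMr // div1r.
Unshelve. all: by end_near. Qed.

Section RotationAct.
Variables (R : realType) (F : R -> R) (rho : R).
Hypothesis FL : circle_lift_map F.
Hypothesis dev0 : forall n, `|iter n F 0 - n%:R * rho| <= 1.
Implicit Types (x y : R) (n m : nat) (c : int * int).

Lemma iter_dev n x : `|iter n F x - x - n%:R * rho| <= 2.
Proof.
have := lift_dev (iter_lift FL n) x; have := dev0 n; rewrite !ler_norml.
by move=> /andP[? ?] /andP[? ?]; apply/andP; split; lra.
Qed.

Lemma act_dev c x : `|lift_act F c x - x - rval rho c| <= 2.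
Proof.
case: c => -[n|n] p; rewrite /lift_act /rval /=.
  have := iter_dev n x; rewrite -[n%:~R]/(n%:R : R).
  by have -> : iter n F x + p%:~R - x - (n%:R * rho + p%:~R) = iter n F x - x - n%:R * rho by ring.
have inv m y : iter m F (iter m (finv F) y) = y.
  by elim: m y => [//|m IH] y; rewrite iterSr iterS (FinvK FL) IH.
have := iter_dev n.+1 (iter n.+1 (finv F) x); rewrite inv NegzE mulrNz -[n.+1%:~R]/(n.+1%:R : R).
rewrite -[iter n.+1 (finv F) x]/(finv F (iter n (finv F) x)); set y := finv F _.
have -> : y + p%:~R - x - (- n.+1%:R * rho + p%:~R) = - (x - y - n.+1%:R * rho) by ring.
by rewrite normrN.
Qed.

(** If [act a] did not move [x] to the right, neither would its powers, whereas the n-th power moves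
    [x] by n times a positive value up to an error of 2. *)
Lemma rotation_act : is_rotation F rho.
Proof.
move=> a a0 x; rewrite ltNge; apply/negP => ax.
have le n : lift_act F (a *+ n) x <= x.
  elim: n => [|n IH]; first by rewrite mulr0n act0.
  by rewrite mulrS (actD FL); apply: le_trans ax; rewrite (act_le FL).
pose n := (Num.truncn (2 / rval rho a)).+1.
have hn : 2 < rval rho a * n%:R by rewrite mulrC -ltr_pdivrMr // truncnS_gt.
have := act_dev (a *+ n) x; rewrite rvalMn ler_norml -mulr_natr => /andP[h _].
by have := le n; lra.
Qed.

End RotationAct.

(** * Multicritical circle maps *)

Lemma norm_int_ge1 (R : realType) (k : int) : k != 0 -> 1 <= `|k%:~R| :> R.
Proof. by move=> k0; rewrite -intr_norm ler1z -gtz0_ge1 normr_gt0. Qed.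

Lemma circle_distE (R : realType) (x y : R) : `|x - y| < 2^-1 ->
  circle_dist (to_circle x) (to_circle y) = `|x - y|.
Proof.
move=> xy; rewrite /circle_dist; set A := (X in inf X).
have Axy : A `|x - y| by exists x => //; exists y.
have lb : lbound A `|x - y|.
  move=> _ [u /to_circleP[m um] [v /to_circleP[n vn] <-]].
  have -> : u - v = (x - y) + (m - n)%:~R by rewrite intrB -um -vn; ring.
  have [->|k0] := eqVneq (m - n) 0; first by rewrite addr0.
  have k1 := @norm_int_ge1 R _ k0.
  by have := lerB_normD (m - n)%:~R (x - y); rewrite [_ + (x - y)]addrC; lra.
apply/eqP; rewrite eq_le; apply/andP; split; first by apply: ge_inf => //; exists `|x - y|.
by apply: lb_le_inf => //; exists `|x - y|.
Qed.

Section Multicritical.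
Variables (R : realType) (r : nat) (f : circle R -> circle R).
Hypothesis r3 : (3 <= r)%N.
Hypothesis mf : multicritical r f.
Implicit Types (x y c : R).

Local Notation F := (circle_lift f).

Lemma multicritical_lift : circle_lift_map F.
Proof. by case: mf => fh fi _ _ _; exact: increasing_lift. Qed.

Let FL := multicritical_lift.

Let Fd k x : (k < 3)%N -> is_derive x 1 (derive1n k F) (derive1n k.+1 F x).
Proof.
move=> k3; have [_ _ [Fk _] _ _] := mf.
have h := Fk k (leq_trans k3 r3) x.
have -> : derive1n k.+1 F x = 'D_1 (derive1n k F) x by rewrite -derive1E.
exact: derivableP.
Qed.

Lemma lift_is_derive x : is_derive x 1 F (derive1 F x).
Proof. exact: (@Fd 0). Qed.

Let per k x (m : int) : (k < 3)%N -> derive1n k.+1 F (x + m%:~R) = derive1n k.+1 F x.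
Proof.
elim: k x => [|k IH] x k3.
  by apply: (deriv_periodic FL) => y; exact: (@Fd 0).
apply: (@deriv_shift _ (derive1n k.+1 F) (derive1n k.+2 F) _ 0) => y; first exact: Fd.
by rewrite addr0 IH // ltnW.
Qed.

Lemma circle_derivE x : circle_deriv f (to_circle x) = derive1 F x.
Proof. by rewrite /circle_deriv; have [m ->] := repr_to_circle x; exact: (@per 0). Qed.

Lemma critical_pointsE x : critical_points f (to_circle x) <-> derive1 F x = 0.
Proof. by rewrite /critical_points /= circle_derivE. Qed.

Let schwarzianE x : derive1 F x != 0 ->
  circle_schwarzian f (to_circle x) =
  derive1n 3 F x / derive1 F x - 3 / 2 * (derive1n 2 F x / derive1 F x) ^+ 2.
Proof.
rewrite /circle_schwarzian; have [m ->] := repr_to_circle x.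
have E1 : derive1 F (x + m%:~R) = derive1 F x := @per 0 x m isT.
rewrite -E1 -(@per 1 x m) // -(@per 2 x m) //; set y := x + _ => y0.
rewrite /schwarzian derive1E.
have h1 := @is_deriveV _ (derive1 F) y (derive1n 2 F y) 1 y0 (@Fd 1 y isT).
have [_ ->] := is_deriveM (@Fd 2 y isT) h1.
rewrite /GRing.scale /=; rewrite -[derive1 (derive1 F)]/(derive1n 2 F) -[derive1 (derive1n 2 F)]/(derive1n 3 F).
by move: (derive1n 2 F y) (derive1n 3 F y) (derive1 F y) y0 => a b c c0; field.
Qed.

Let F1_ge0 x : 0 <= derive1 F x.
Proof.
have := is_deriveN (lift_is_derive x); rewrite -oppr_le0 => h.
apply: (@is_derive_le _ _ x _ _ 1 h) => // y /andP[xy _].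
rewrite -[(- F) y]/(- F y) -[(- F) x]/(- F x) mul0r opprK addrC subr_le0.
by rewrite (F_le FL) ltW.
Qed.

Let F3c : continuous (derive1n 3 F).
Proof.
have [_ _ [Fk Fr] _ _] := mf.
move: r3; rewrite leq_eqVlt => /orP[/eqP -> //|r4] x.
by apply/differentiable_continuous/derivable1_diffP; exact: Fk.
Qed.

(** The shift by an integer is needed for [g]: the conjugacy equation holds for the chosen lifts
    only up to an integer, which is absorbed into the lift of [g]. *)
Lemma multicritical_tame (j : int) : tame (fun x => F x + j%:~R) (derive1 F).
Proof.
have [_ _ _ [fin _] [W [W1 W2 W3 _]]] := mf.
have [s sE] := (finite_seqP _).1 fin.
apply: (@tame_of_local R (fun x => F x + j%:~R) (derive1 F) (derive1n 2 F) (derive1n 3 F) (map repr s)).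
- have [Fi Fc F1] := FL; split.
  + by move=> x y xy; rewrite ltrD2r; exact: Fi.
  + by move=> x; apply: continuousD; [exact: Fc|exact: cst_continuous].
  + by move=> x; rewrite F1 addrAC.
- by move=> x; rewrite -[derive1 F x]addr0; apply: is_deriveD; exact: lift_is_derive.
- by move=> x; exact: (@Fd 1).
- by move=> x; exact: (@Fd 2).
- exact: F3c.
- exact: F1_ge0.
- move=> x x0; have := (critical_pointsE x).2 x0; rewrite sE /= => xs.
  exists (repr (to_circle x)); first exact: (@map_f (circle R : eqType) _ _ s _ xs).
  by have [m ->] := repr_to_circle x; exists (- m); rewrite mulrNz addrK.
move=> c c0; have cc := (critical_pointsE c).2 c0.
have [A [B [t [A0 AB t1 H]]]] := W3 _ cc.
have [Wo Wc] := W1 _ cc.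
have [e /= e0 He] := to_circle_continuous (open_nbhs_nbhs (conj Wo Wc)).
(* Below 1/2 distances on the circle and on the line agree, and no integer translate of [c] other
   than [c] itself is near. *)
exists (Num.min e 2^-1), A, B, t; rewrite lt_min e0 invr_gt0 ltr0n; split => // y.
rewrite lt_min => /and3P[y0 ye yh].
have Wy : (W (to_circle c) `\ to_circle c) (to_circle y).
  split; first by apply: He; rewrite /= distrC.
  move=> /to_circleP[m E]; move: y0 yh; rewrite E => y0.
  have m0 : m != 0 by apply: contraTneq y0 => ->; rewrite normr0 ltxx.
  by have := @norm_int_ge1 R _ m0; lra.
have [h1 h2] := H _ Wy.
rewrite circle_derivE circle_distE // in h1 h2.
split => //; have := W2 _ cc _ Wy; rewrite schwarzianE //.
rewrite gt_eqF //; apply: le_lt_trans h1.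
by rewrite mulr_ge0 ?powR_ge0 // ltW.
Qed.

End Multicritical.

Lemma irrational_rval (R : realType) (rho : R) (m : int) : irrational rho ->
  forall a, rval (rho + m%:~R) a = 0 -> a = 0.
Proof.
move=> irr [k p]; rewrite /rval /= => E.
have [k0|k0] := eqVneq k 0.
  by move: E; rewrite k0 mul0r add0r => /eqP; rewrite intr_eq0 => /eqP ->.
exfalso; apply: irr; exists (- p%:~R / k%:~R - m%:~R) => //.
rewrite rmorphB /= fmorph_div /= rmorphN /= !ratr_int.
have kR : k%:~R != 0 :> R by rewrite intr_eq0.
apply: (mulfI kR); rewrite mulrBr mulrCA divff // mulr1.
by move: E; rewrite mulrDr; lra.
Qed.

Lemma bounded_multiples (R : realType) (z C : R) : (forall n, `|n%:R * z| <= C) -> z = 0.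
Proof.
move=> H; apply/eqP/negPn/negP => z0; have z1 : 0 < `|z| by rewrite normr_gt0.
pose n := (Num.truncn (C / `|z|)).+1.
have := H n; rewrite normrM ger0_norm // leNgt => /negP; apply.
by rewrite -ltr_pdivrMr // truncnS_gt.
Qed.

Lemma finite_image_eq (T : choiceType) (A B : set T) (h : T -> T) : injective h ->
  finite_set A -> finite_set B -> (A #= B)%card -> h @` A `<=` B -> h @` A = B.
Proof.
move=> hi fA fB AB sub; have fhA : finite_set (h @` A) by exact: finite_image.
have E : (h @` A #= B)%card.
  by apply: card_eq_trans AB; apply: inj_card_eq => x y _ _; exact: hi.
have /(fcard_eq fhA fB) c := E.
apply: (fset_set_inj fhA fB); apply/finmap.fsetP/finmap.fsubset_cardP => //.
by rewrite -(fset_set_sub fhA fB).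
Qed.

Theorem theoremA (R : realType) (r : nat) (f g h : circle R -> circle R) :
  (3 <= r)%N ->
  multicritical r f ->
  multicritical r g ->
  rotation_number f = rotation_number g ->
  (@to_circle R @` @irrational R) (rotation_number f) ->
  (critical_points f #= critical_points g)%card ->
  homeomorphism h ->
  h \o f = g \o h ->
  (forall c, critical_points f c -> critical_points g (h c)) ->
  quasisymmetric h.
Proof.
move=> r3 mf mg rot [rho irr rhoE] card hh hfg crit.
have FL := multicritical_lift mf; have GL := multicritical_lift mg.
have [[fc _] _ _ [finf [u0 cu0]] _] := mf; have [[gc _] _ _ [fing _] _] := mg.
have [_ fE] := circle_lift_lift fc; have [_ gE] := circle_lift_lift gc.
have [hc [h' [_ hK _]]] := hh.
have [Hc HE] := circle_lift_lift hc.
have [Hi [k [k1 Hk]]] := homeomorphism_lift hh.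
have [rF [devF limF]] := rotation_exists FL; have [rG [devG limG]] := rotation_exists GL.
have [m Em] : exists m : int, rF - rG = m%:~R.
  by apply/to_circleP; rewrite -limF -limG; exact: rot.
have [i Ei] : exists i : int, rF - rho = i%:~R.
  by apply/to_circleP; rewrite rhoE -limF.
have {}irr a : rval rF a = 0 -> a = 0.
  have -> : rF = rho + i%:~R by rewrite -Ei; ring.
  exact: irrational_rval.
(* Both sides of the conjugacy equation lift the same map, so they differ by a constant integer
   [j]. *)
have [||x|j Ej] := @lift_unique R (circle_lift h \o circle_lift f) (circle_lift g \o circle_lift h).
- by case: FL => _ Fc _ x; apply: continuous_comp; [exact: Fc|exact: Hc].
- by case: GL => _ Gc _ x; apply: continuous_comp; [exact: Hc|exact: Gc].
- by rewrite /= -HE -fE -gE -HE; exact: (congr1 (fun p => p (to_circle x)) hfg).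
move: FL GL Hc HE Hi Hk devF devG Ej.
have tF := multicritical_tame r3 mf 0; have tG := multicritical_tame r3 mg j.
have cF := critical_pointsE r3 mf; have cG := critical_pointsE r3 mg.
rewrite /quasisymmetric; move: tF tG cF cG.
set F := circle_lift f; set Gl := circle_lift g; set H := circle_lift h.
move=> tF tG cF cG FL GL Hc HE Hi Hk devF devG Ej.
(* A conjugacy reversing orientation would make [rF + rG] an integer. As [rF - rG] is one too,
   [2 * rF] would be an integer, against irrationality. *)
have k_pos : k = 1.
  case: k1 => // k1; exfalso.
  have NL : circle_lift_map (fun x => - H x).
    apply: injective_lift.
    - by move=> x; apply: continuousN; exact: Hc.
    - by move=> x y /oppr_inj/Hi.
    - by move=> x n; rewrite Hk k1 mulN1r mulrNz; ring.
  have itG n y : iter n (fun x => Gl x + j%:~R) y = iter n Gl y + (n%:R * j%:~R).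
    elim: n => [|n IH]; first by rewrite mul0r addr0.
    rewrite !iterS IH -natr1.
    have -> : n%:R * j%:~R = (n%:Z * j)%:~R :> R by rewrite intrM.
    by rewrite (F_int GL); rewrite intrM; ring.
  have itH n : H (iter n F 0) = iter n Gl (H 0) + n%:R * j%:~R.
    rewrite -itG; elim: n => [//|n IH]; rewrite !iterS -IH; exact: Ej.
  have z : rF + rG + j%:~R = 0.
    apply: (@bounded_multiples _ _ 4) => n.
    have := devF n; have := iter_dev GL devG n (H 0); have := lift_dev NL (iter n F 0).
    rewrite itH !ler_norml => /andP[? ?] /andP[? ?] /andP[? ?]; apply/andP; split; lra.
  have : rval rF (2, j - m) = 0 by rewrite /rval /= intrB -Em; lra.
  by move=> /irr.
have HL : circle_lift_map H.
  by apply: injective_lift => // x n; rewrite Hk k_pos mul1r.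
have hi : injective h by exact: can_inj hK.
(* An injection between finite sets of equal size is onto, so [h] also reflects critical points. *)
have imE : h @` critical_points f = critical_points g.
  apply: finite_image_eq => //; by move=> _ [u cu <-]; exact: crit.
have critE x : derive1 F x = 0 <-> derive1 Gl (H x) = 0.
  rewrite -cF -cG -HE; split; first exact: crit.
  by rewrite -imE => -[u cu /hi <-].
have tF' : tame F (derive1 F).
  have E : F = (fun x => F x + 0%:~R) by apply/funext => x; rewrite addr0.
  by rewrite {1}E; exact: tF.
have c0 : derive1 F (repr u0) = 0 by apply: (cF _).1; rewrite to_circle_repr.
have [K K1 HK] := conj_symmetric HL Ej tF' tG (rotation_act FL devF) irr c0 critE.
exists K => // x t t0; have [h1 h2] := HK x t t0.
have d1 : 0 < H (x + t) - H x by rewrite subr_gt0 (F_lt HL) ltrDl.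
have d2 : 0 < H x - H (x - t) by rewrite subr_gt0 (F_lt HL) gtrBl.
have K0 : 0 < K by lra.
rewrite !gtr0_norm // ler_pdivlMr // ler_pdivrMr // h1 andbT.
by rewrite mulrC ler_pdivrMr // mulrC.
Qed.
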